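(* Every finite dimensional irreducible left (respectively right) $\mathcal{A}(\sigma)$-comodule is isomorphic to $V^L_\ell\sigma^s$ (respectively $V^R_\ell\sigma^s$) for some $\ell\in\frac12\mathbb{Z}_+$ and $s\in\{0,1\}$, and $\mathcal{A}(\sigma)$ decomposes as the direct sum of $\mathcal{A}(\sigma)$-bicomodules $$\mathcal{A}(\sigma)=\bigoplus_{\ell\in\frac12\mathbb{Z}_+}\left(M_\ell\oplus M_\ell\sigma\right).$$
   Context: Throughout, $q\in\mathbb{C}$, $q\neq 0$, $q$ is not a root of $1$, and $t=\sqrt{-1}\,\sqrt q$ (so $t^2=-q$). $\mathbb{Z}_+=\{0,1,2,\dots\}$. Tensor products of $\mathbb{Z}_2$-graded algebras have multiplication $(u\otimes v)(u'\otimes v')=(-1)^{p(v)p(u')}uu'\otimes vv'$, where $p$ is parity. $\mathcal{A}(\sigma)$ is the $\mathbb{Z}_2$-graded associative unital $\mathbb{C}$-algebra with generators $a,b,c,d,\sigma$, parities $p(a)=p(d)=p(\sigma)=0$, $p(b)=p(c)=1$, and relations $ab=tba$, $ac=tca$, $bc=-cb$, $bd=-tdb$, $cd=-tdc$, $ad-da=(t^{-1}-t)bc$, $\sigma a=a\sigma$, $\sigma d=d\sigma$, $\sigma b=-b\sigma$, $\sigma c=-c\sigma$, $\sigma^2=1$, $ad+tbc=\sigma$. It is a $\mathbb{Z}_2$-graded bialgebra (in fact Hopf algebra) with $\Delta(a)=a\otimes a+b\otimes c$, $\Delta(b)=a\otimes b+b\otimes d$, $\Delta(c)=c\otimes a+d\otimes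 c$, $\Delta(d)=c\otimes b+d\otimes d$, $\Delta(\sigma)=\sigma\otimes\sigma$, $\varepsilon(a)=\varepsilon(d)=\varepsilon(\sigma)=1$, $\varepsilon(b)=\varepsilon(c)=0$. Comodules are comodules over the coalgebra $(\mathcal{A}(\sigma),\Delta,\varepsilon)$. Put $(u;v)_m=\prod_{k=0}^{m-1}(1-uv^k)$ and $\binom{m}{n}_v=\frac{(v;v)_m}{(v;v)_n(v;v)_{m-n}}$; $[x]$ is the integer part of $x$. Square roots of the numbers $\binom{2\ell}{\ell+i}_{t^{-2}}$ are fixed once and for all. For $\ell\in\frac12\mathbb{Z}_+$ let $I_\ell=\{-\ell,-\ell+1,\dots,\ell\}$ and, for $i\in I_\ell$, $$\xi^{(\ell)}_i=(\sqrt{-1})^{[\frac{\ell+i}{2}]}\binom{2\ell}{\ell+i}^{1/2}_{t^{-2}}a^{\ell-i}c^{\ell+i},\qquad \eta^{(\ell)}_i=(\sqrt{-1})^{[\frac{\ell+i}{2}]}\binom{2\ell}{\ell+i}^{1/2}_{t^{-2}}a^{\ell-i}b^{\ell+i}.$$ For $s\in\{0,1\}$, $V^L_\ell\sigma^s$ is the span of the $\xi^{(\ell)}_i\sigma^s$ ($i\in I_\ell$) and $V^R_\ell\sigma^s$ the span of the $\eta^{(\ell)}_i\sigma^s$ ($i\in I_\ell$); these are respectively a left and a right subcomodule of $\mathcal{A}(\sigma)$ under $\Delta$. The matrix elements $m^{(\ell)}_{ij}\in\mathcal{A}(\sigma)$ ($i,j\in I_\ell$) are defined by $\Delta(\xi^{(\ell)}_i)=\sum_{j\in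 I_\ell}m^{(\ell)}_{ij}\otimes\xi^{(\ell)}_j$, and $M_\ell\sigma^s=\sum_{i,j\in I_\ell}\mathbb{C}\,m^{(\ell)}_{ij}\sigma^s$, with $M_\ell=M_\ell\sigma^0$; it is a bi-subcomodule of $\mathcal{A}(\sigma)$. *)

(* Defs.v *)
From HB Require Import structures.
From mathcomp Require Import all_boot all_order all_algebra generic_quotient.
From mathcomp Require Import boolp classical_sets reals.
From mathcomp Require Import complex ring.

Set Implicit Arguments.
Unset Strict Implicit.
Unset Printing Implicit Defensive.

Import Order.TTheory GRing.Theory Num.Theory.

Local Open Scope ring_scope.
Local Open Scope quotient_scope.

(** [tens U V], the tensor product of two vector spaces, is the set of formal
  linear combinations of symbols [TPure u v] modulo the least congruence
  containing the vector space axioms and the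
  bilinearity of [TPure]. *)
Section Tensor.
Variables (K : fieldType) (U V : lmodType K).

Inductive texpr : Type :=
| TZero
| TPure of U & V
| TAdd of texpr & texpr
| TScale of K & texpr.

Inductive teq : texpr -> texpr -> Prop :=
| teq_refl x : teq x x
| teq_sym x y : teq x y -> teq y x
| teq_trans x y z : teq x y -> teq y z -> teq x z
| teq_add x x' y y' : teq x x' -> teq y y' -> teq (TAdd x y) (TAdd x' y')
| teq_scale k x x' : teq x x' -> teq (TScale k x) (TScale k x')
| teq_addA x y z : teq (TAdd x (TAdd y z)) (TAdd (TAdd x y) z)
| teq_addC x y : teq (TAdd x y) (TAdd y x)
| teq_add0 x : teq (TAdd TZero x) x
| teq_addN x : teq (TAdd (TScale (-1) x) x) TZero
| teq_scaleA k l x : teq (TScale k (TScale l x)) (TScale (k * l) x)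
| teq_scale1 x : teq (TScale 1 x) x
| teq_scaleDr k x y : teq (TScale k (TAdd x y)) (TAdd (TScale k x) (TScale k y))
| teq_scaleDl k l x : teq (TScale (k + l) x) (TAdd (TScale k x) (TScale l x))
| teq_pureDl u u' v : teq (TPure (u + u') v) (TAdd (TPure u v) (TPure u' v))
| teq_pureDr u v v' : teq (TPure u (v + v')) (TAdd (TPure u v) (TPure u v'))
| teq_pureZl k u v : teq (TPure (k *: u) v) (TScale k (TPure u v))
| teq_pureZr k u v : teq (TPure u (k *: v)) (TScale k (TPure u v)).

HB.instance Definition _ := gen_eqMixin texpr.
HB.instance Definition _ := gen_choiceMixin texpr.

Definition teqb (x y : texpr) : bool := `[< teq x y >].

Lemma teqb_refl : reflexive teqb.
Proof. by move=> x; apply/asboolP; exact: teq_refl. Qed.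
Lemma teqb_sym : symmetric teqb.
Proof. by move=> x y; apply/asboolP/asboolP; exact: teq_sym. Qed.
Lemma teqb_trans : transitive teqb.
Proof.
by move=> y x z /asboolP xy /asboolP yz; apply/asboolP; exact: teq_trans yz.
Qed.

Canonical teqb_equiv := EquivRel teqb teqb_refl teqb_sym teqb_trans.

Definition tens : Type := {eq_quot teqb}.
HB.instance Definition _ := Choice.on tens.

Definition tpi (x : texpr) : tens := \pi_{eq_quot teqb} x.
Definition trepr (x : tens) : texpr := repr (x : {eq_quot teqb}).

Lemma tpiP x y : teq x y <-> tpi x = tpi y.
Proof.
split=> [xy|/eqquotP xy]; last exact/asboolP.
by apply/eqquotP; apply/asboolP.
Qed.

Lemma treprK x : tpi (trepr x) = x.
Proof. exact: (@reprK _ {eq_quot teqb}). Qed.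

Definition tpure (u : U) (v : V) : tens := tpi (TPure u v).
Definition tens_zero : tens := tpi TZero.
Definition tens_add (x y : tens) : tens := tpi (TAdd (trepr x) (trepr y)).
Definition tens_scale k (x : tens) : tens := tpi (TScale k (trepr x)).
Definition tens_opp : tens -> tens := tens_scale (-1).

Lemma tens_addE x y : tens_add (tpi x) (tpi y) = tpi (TAdd x y).
Proof. by apply/tpiP; apply: teq_add; apply/tpiP; rewrite treprK. Qed.
Lemma tens_scaleE k x : tens_scale k (tpi x) = tpi (TScale k x).
Proof. by apply/tpiP; apply: teq_scale; apply/tpiP; rewrite treprK. Qed.

Lemma tpi_ind (P : tens -> Prop) : (forall x, P (tpi x)) -> forall x, P x.
Proof. by move=> h x; rewrite -[x]treprK. Qed.

Lemma tens_addA : associative tens_add.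
Proof.
elim/tpi_ind => x; elim/tpi_ind => y; elim/tpi_ind => z.
by rewrite !tens_addE; apply/tpiP; exact: teq_addA.
Qed.
Lemma tens_addC : commutative tens_add.
Proof.
elim/tpi_ind => x; elim/tpi_ind => y.
by rewrite !tens_addE; apply/tpiP; exact: teq_addC.
Qed.
Lemma tens_add0 : left_id tens_zero tens_add.
Proof. by elim/tpi_ind => x; rewrite tens_addE; apply/tpiP; exact: teq_add0. Qed.
Lemma tens_addN : left_inverse tens_zero tens_opp tens_add.
Proof.
elim/tpi_ind => x; rewrite /tens_opp tens_scaleE tens_addE.
by apply/tpiP; exact: teq_addN.
Qed.

HB.instance Definition _ :=
  GRing.isZmodule.Build tens tens_addA tens_addC tens_add0 tens_addN.

Lemma tens_scaleA k l x : tens_scale k (tens_scale l x) = tens_scale (k * l) x.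
Proof.
by elim/tpi_ind: x => x; rewrite !tens_scaleE; apply/tpiP; exact: teq_scaleA.
Qed.
Lemma tens_scale1 : left_id 1 tens_scale.
Proof. by elim/tpi_ind=> x; rewrite tens_scaleE; apply/tpiP; exact: teq_scale1. Qed.
Lemma tens_scaleDr : right_distributive tens_scale +%R.
Proof.
move=> k; elim/tpi_ind=> x; elim/tpi_ind=> y.
rewrite /GRing.add /= !(tens_addE, tens_scaleE); apply/tpiP.
exact: teq_scaleDr.
Qed.
Lemma tens_scaleDl x : {morph tens_scale^~ x : k l / k + l}.
Proof.
move=> k l; elim/tpi_ind: x => x.
rewrite {2}/GRing.add /= !(tens_addE, tens_scaleE); apply/tpiP.
exact: teq_scaleDl.
Qed.

HB.instance Definition _ := GRing.Zmodule_isLmodule.Build K tens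
  tens_scaleA tens_scale1 tens_scaleDr tens_scaleDl.

Lemma tpiD x y : tpi (TAdd x y) = tpi x + tpi y.
Proof. by rewrite -tens_addE. Qed.
Lemma tpiZ k x : tpi (TScale k x) = k *: tpi x.
Proof. by rewrite -tens_scaleE. Qed.

Lemma tpureDl u u' v : tpure (u + u') v = tpure u v + tpure u' v.
Proof. by rewrite /tpure -tpiD; apply/tpiP; exact: teq_pureDl. Qed.
Lemma tpureDr u v v' : tpure u (v + v') = tpure u v + tpure u v'.
Proof. by rewrite /tpure -tpiD; apply/tpiP; exact: teq_pureDr. Qed.
Lemma tpureZl k u v : tpure (k *: u) v = k *: tpure u v.
Proof. by rewrite /tpure -tpiZ; apply/tpiP; exact: teq_pureZl. Qed.
Lemma tpureZr k u v : tpure u (k *: v) = k *: tpure u v.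
Proof. by rewrite /tpure -tpiZ; apply/tpiP; exact: teq_pureZr. Qed.

Lemma tpure0l v : tpure 0 v = 0.
Proof. by have := tpureZl 0 0 v; rewrite !scale0r. Qed.
Lemma tpure0r u : tpure u 0 = 0.
Proof. by have := tpureZr 0 u 0; rewrite !scale0r. Qed.
Lemma tpureNl u v : tpure (- u) v = - tpure u v.
Proof. by rewrite -!scaleN1r tpureZl. Qed.
Lemma tpureNr u v : tpure u (- v) = - tpure u v.
Proof. by rewrite -!scaleN1r tpureZr. Qed.

Lemma tens_ind (P : tens -> Prop) :
    (forall u v, P (tpure u v)) -> (forall x y, P x -> P y -> P (x + y)) ->
    (forall k x, P x -> P (k *: x)) -> forall x, P x.
Proof.
move=> Pp PD PZ; elim/tpi_ind; elim=> [|u v|x Px y Py|k x Px].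
- have -> : tpi TZero = 0 *: tpure 0 0 by rewrite scale0r.
  exact/PZ/Pp.
- exact: Pp.
- by rewrite tpiD; exact: PD.
- by rewrite tpiZ; exact: PZ.
Qed.

End Tensor.

Notation "u ⊗ v" := (tpure u v) (at level 40, left associativity) : ring_scope.

(** The linear map [tens U V -> W] induced by a bilinear [f]; the definition
  makes sense for any [f] but is only meaningful for bilinear ones. *)
Section TensorLift.
Variables (K : fieldType) (U V W : lmodType K).

Fixpoint teval (f : U -> V -> W) (x : texpr U V) : W :=
  match x with
  | TZero => 0
  | TPure u v => f u v
  | TAdd x y => teval f x + teval f y
  | TScale k x => k *: teval f x
  end.

Definition tens_lift (f : U -> V -> W) (x : tens U V) : W := teval f (trepr x).

Definition bilin (f : U -> V -> W) : Prop :=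
  (forall v, linear (f^~ v)) /\ (forall u, linear (f u)).

Lemma linearPD (X Y : lmodType K) (g : X -> Y) : linear g ->
  forall x y, g (x + y) = g x + g y.
Proof. by move=> gl x y; rewrite -[x]scale1r gl !scale1r. Qed.
Lemma linearPZ (X Y : lmodType K) (g : X -> Y) : linear g ->
  forall k x, g (k *: x) = k *: g x.
Proof.
move=> gl k x; have g0 : g 0 = 0.
  by apply: (@addrI _ (g 0)); rewrite -(linearPD gl) !addr0.
by rewrite -[k *: x]addr0 gl g0 addr0.
Qed.

Variables (f : U -> V -> W) (fb : bilin f).

Lemma teval_teq x y : teq x y -> teval f x = teval f y.
Proof.
case: fb => fl fr.
elim=> {x y} //=; do ?[by move=> *; congruence].
- by move=> x y z; rewrite addrA.
- by move=> x y; rewrite addrC.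
- by move=> x; rewrite add0r.
- by move=> x; rewrite scaleN1r addNr.
- by move=> k l x; rewrite scalerA.
- by move=> x; rewrite scale1r.
- by move=> k x y; rewrite scalerDr.
- by move=> k l x; rewrite scalerDl.
- by move=> u u' v; rewrite (linearPD (fl v)).
- by move=> u v v'; rewrite (linearPD (fr u)).
- by move=> k u v; rewrite (linearPZ (fl v)).
- by move=> k u v; rewrite (linearPZ (fr u)).
Qed.

Lemma tens_lift_pi x : tens_lift f (tpi x) = teval f x.
Proof. by apply: teval_teq; apply/tpiP; rewrite treprK. Qed.

Lemma tens_liftE u v : tens_lift f (u ⊗ v) = f u v.
Proof. exact: tens_lift_pi. Qed.

Lemma tens_lift_linear : linear (tens_lift f).
Proof.
move=> k; elim/tpi_ind=> x; elim/tpi_ind=> y.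
by rewrite -tpiZ -tpiD !tens_lift_pi.
Qed.

End TensorLift.

Section TensorMaps.
Variable K : fieldType.

Definition tens_map (U V U' V' : lmodType K) (f : U -> U') (g : V -> V')
  : tens U V -> tens U' V' := tens_lift (fun u v => f u ⊗ g v).

Definition tens_assoc (U V W : lmodType K)
  : tens (tens U V) W -> tens U (tens V W) :=
  tens_lift (fun x w => tens_lift (fun u v => u ⊗ (v ⊗ w)) x).

(** The image of P ⊗ Q in U ⊗ V, for subspaces P of U and Q of V. *)
Definition tsub (U V : lmodType K) (P : set U) (Q : set V) : set (tens U V) :=
  [set x | exists2 s : seq (U * V),
     (forall p, p \in s -> P p.1 /\ Q p.2) & x = \sum_(p <- s) p.1 ⊗ p.2].

Lemma tens_map_bilin (U V U' V' : lmodType K)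
    (f : {linear U -> U'}) (g : {linear V -> V'}) :
  bilin (fun u v => f u ⊗ g v).
Proof.
split=> [v k x y|u k x y]; first by rewrite linearP tpureDl tpureZl.
by rewrite linearP tpureDr tpureZr.
Qed.

Lemma tens_mapE (U V U' V' : lmodType K)
    (f : {linear U -> U'}) (g : {linear V -> V'}) u v :
  tens_map f g (u ⊗ v) = f u ⊗ g v.
Proof. by rewrite /tens_map tens_liftE//; exact: tens_map_bilin. Qed.

Lemma tens_assocE (U V W : lmodType K) (u : U) (v : V) (w : W) :
  tens_assoc (u ⊗ v ⊗ w) = u ⊗ (v ⊗ w).
Proof.
have bw z : bilin (fun (u : U) (v : V) => u ⊗ (v ⊗ (z : W))).
  split=> [x k y y'|x k y y']; first by rewrite tpureDl tpureZl.
  by rewrite tpureDl tpureZl tpureDr tpureZr.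
rewrite /tens_assoc tens_liftE ?tens_liftE//; split=> [z|x].
  exact: tens_lift_linear.
move=> k y y'; elim/tens_ind: x => [p r|x x' IH IH'|l x IH].
- by rewrite !tens_liftE// !(tpureDr, tpureZr).
- rewrite !(linearPD (tens_lift_linear (bw _))) IH IH' scalerDr.
  by rewrite !addrA; congr (_ + _); rewrite -!addrA; congr (_ + _); rewrite addrC.
- rewrite !(linearPZ (tens_lift_linear (bw _))) IH scalerDr !scalerA.
  by rewrite [l * k]mulrC.
Qed.

End TensorMaps.

(* A decision procedure for linear identities: [lmod_tac K V] reduces an equation
  between linear combinations in V to equalities of coefficients in K. *)
Section LinearExpressions.
Variables (K : fieldType) (V : lmodType K).

Inductive lexpr : Type :=
| LVar of nat | LAdd of lexpr & lexpr | LOpp of lexpr | LScale of K & lexpr.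

Fixpoint leval (env : seq V) (e : lexpr) : V :=
  match e with
  | LVar i => env`_i
  | LAdd x y => leval env x + leval env y
  | LOpp x => - leval env x
  | LScale k x => k *: leval env x
  end.

Fixpoint lcoef (e : lexpr) (i : nat) : K :=
  match e with
  | LVar j => if eqn i j then 1 else 0
  | LAdd x y => lcoef x i + lcoef y i
  | LOpp x => - lcoef x i
  | LScale k x => k * lcoef x i
  end.

Fixpoint lbound (n : nat) (e : lexpr) : bool :=
  match e with
  | LVar i => (i < n)%N
  | LAdd x y => lbound n x && lbound n y
  | LOpp x => lbound n x
  | LScale _ x => lbound n x
  end.

Fixpoint lcoef_eq (n : nat) (x y : lexpr) : Prop :=
  if n is n'.+1 then lcoef x n' = lcoef y n' /\ lcoef_eq n' x y else True.

Lemma levalE env n e : lbound n e ->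
  leval env e = \sum_(i < n) lcoef e i *: env`_i.
Proof.
elim: e => /= [j jn|x IHx y IHy /andP[/IHx -> /IHy ->]|x IH /IH ->|k x IH /IH ->].
- rewrite (bigD1 (Ordinal jn)) //= -[eqn j j]/(j == j) eqxx scale1r big1 ?addr0//.
  move=> i ij; rewrite -[eqn i j]/(nat_of_ord i == nat_of_ord (Ordinal jn)).
  by rewrite (inj_eq val_inj) (negPf ij) scale0r.
- by rewrite -big_split; apply: eq_bigr => i _; rewrite scalerDl.
- by rewrite -sumrN; apply: eq_bigr => i _; rewrite scaleNr.
- by rewrite scaler_sumr; apply: eq_bigr => i _; rewrite scalerA.
Qed.

Lemma leval_eq env n x y : lbound n x && lbound n y -> lcoef_eq n x y ->
  leval env x = leval env y.
Proof.
move=> /andP[hx hy] h; rewrite (levalE _ hx) (levalE _ hy).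
have {h} h i : (i < n)%N -> lcoef x i = lcoef y i.
  elim: n h {hx hy} => //= n IH [h0 /IH h]; rewrite ltnS leq_eqVlt.
  by case/orP=> [/eqP ->|/h].
by apply: eq_bigr => i _; rewrite h.
Qed.

End LinearExpressions.

Ltac lmod_index v vs :=
  match vs with
  | cons v _ => constr:(O)
  | cons _ ?vs' => let i := lmod_index v vs' in constr:(S i)
  end.
Ltac lmod_reify K e vs :=
  match e with
  | @GRing.add _ ?x ?y =>
    let x' := lmod_reify K x vs in let y' := lmod_reify K y vs in
    constr:(@LAdd K x' y')
  | @GRing.opp _ ?x => let x' := lmod_reify K x vs in constr:(@LOpp K x')
  | @GRing.scale _ _ ?k ?x =>
    let x' := lmod_reify K x vs in constr:(@LScale K k x')
  | _ => let i := lmod_index e vs in constr:(@LVar K i)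
  end.
Ltac lmod_atoms e vs :=
  match e with
  | @GRing.add _ ?x ?y => let vs' := lmod_atoms x vs in lmod_atoms y vs'
  | @GRing.opp _ ?x => lmod_atoms x vs
  | @GRing.scale _ _ _ ?x => lmod_atoms x vs
  | _ => match vs with
         | _ => let i := lmod_index e vs in vs
         | _ => constr:(cons e vs)
         end
  end.
Ltac lmod_tac K V :=
  match goal with |- @eq ?T ?x ?y =>
    let vs := lmod_atoms x (@nil V) in
    let vs := lmod_atoms y vs in
    let x' := lmod_reify K x vs in let y' := lmod_reify K y vs in
    let n := eval compute in (size vs) in
    refine (@leval_eq K V vs n x' y' isT _);
    cbv [lcoef_eq lcoef eqn]
  end.

(** [palg R], the associative unital K-algebra given by generators in G and
  relations R, is the set of noncommutative polynomial expressions in the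
  generators, modulo the least congruence containing the axioms of associative
  unital K-algebras and the relations [R]; [PScal c] stands for c times 1. *)
Section PresentedAlgebra.
Variables (K : fieldType) (G : Type).

Inductive pexpr : Type :=
| PGen of G
| PScal of K
| PAdd of pexpr & pexpr
| PMul of pexpr & pexpr.

Variable R : pexpr -> pexpr -> Prop.

Inductive peq : pexpr -> pexpr -> Prop :=
| peq_rel x y : R x y -> peq x y
| peq_refl x : peq x x
| peq_sym x y : peq x y -> peq y x
| peq_trans x y z : peq x y -> peq y z -> peq x z
| peq_add x x' y y' : peq x x' -> peq y y' -> peq (PAdd x y) (PAdd x' y')
| peq_mul x x' y y' : peq x x' -> peq y y' -> peq (PMul x y) (PMul x' y')
| peq_addA x y z : peq (PAdd x (PAdd y z)) (PAdd (PAdd x y) z)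
| peq_addC x y : peq (PAdd x y) (PAdd y x)
| peq_add0 x : peq (PAdd (PScal 0) x) x
| peq_addN x : peq (PAdd (PMul (PScal (-1)) x) x) (PScal 0)
| peq_mulA x y z : peq (PMul x (PMul y z)) (PMul (PMul x y) z)
| peq_mul1l x : peq (PMul (PScal 1) x) x
| peq_mul1r x : peq (PMul x (PScal 1)) x
| peq_mulDl x y z : peq (PMul (PAdd x y) z) (PAdd (PMul x z) (PMul y z))
| peq_mulDr x y z : peq (PMul x (PAdd y z)) (PAdd (PMul x y) (PMul x z))
| peq_scalD k l : peq (PScal (k + l)) (PAdd (PScal k) (PScal l))
| peq_scalM k l : peq (PScal (k * l)) (PMul (PScal k) (PScal l))
| peq_scalC k x : peq (PMul (PScal k) x) (PMul x (PScal k)).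

HB.instance Definition _ := gen_eqMixin pexpr.
HB.instance Definition _ := gen_choiceMixin pexpr.

Definition peqb (x y : pexpr) : bool := `[< peq x y >].

Lemma peqb_refl : reflexive peqb.
Proof. by move=> x; apply/asboolP; exact: peq_refl. Qed.
Lemma peqb_sym : symmetric peqb.
Proof. by move=> x y; apply/asboolP/asboolP; exact: peq_sym. Qed.
Lemma peqb_trans : transitive peqb.
Proof.
by move=> y x z /asboolP xy /asboolP yz; apply/asboolP; exact: peq_trans yz.
Qed.

Canonical peqb_equiv := EquivRel peqb peqb_refl peqb_sym peqb_trans.

Definition palg : Type := {eq_quot peqb}.
HB.instance Definition _ := Choice.on palg.

Definition ppi (x : pexpr) : palg := \pi_{eq_quot peqb} x.
Definition prepr (x : palg) : pexpr := repr (x : {eq_quot peqb}).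

Lemma ppiP x y : peq x y <-> ppi x = ppi y.
Proof.
split=> [xy|/eqquotP xy]; last exact/asboolP.
by apply/eqquotP; apply/asboolP.
Qed.

Lemma preprK x : ppi (prepr x) = x.
Proof. exact: (@reprK _ {eq_quot peqb}). Qed.

Lemma ppi_ind (P : palg -> Prop) : (forall x, P (ppi x)) -> forall x, P x.
Proof. by move=> h x; rewrite -[x]preprK. Qed.

Definition palg_gen (g : G) : palg := ppi (PGen g).
Definition palg_scal (k : K) : palg := ppi (PScal k).
Definition palg_add (x y : palg) : palg := ppi (PAdd (prepr x) (prepr y)).
Definition palg_mul (x y : palg) : palg := ppi (PMul (prepr x) (prepr y)).
Definition palg_scale k : palg -> palg := palg_mul (palg_scal k).
Definition palg_opp : palg -> palg := palg_scale (-1).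

Lemma palg_addE x y : palg_add (ppi x) (ppi y) = ppi (PAdd x y).
Proof. by apply/ppiP; apply: peq_add; apply/ppiP; rewrite preprK. Qed.
Lemma palg_mulE x y : palg_mul (ppi x) (ppi y) = ppi (PMul x y).
Proof. by apply/ppiP; apply: peq_mul; apply/ppiP; rewrite preprK. Qed.

Lemma palg_addA : associative palg_add.
Proof.
elim/ppi_ind => x; elim/ppi_ind => y; elim/ppi_ind => z.
by rewrite !palg_addE; apply/ppiP; exact: peq_addA.
Qed.
Lemma palg_addC : commutative palg_add.
Proof.
elim/ppi_ind => x; elim/ppi_ind => y.
by rewrite !palg_addE; apply/ppiP; exact: peq_addC.
Qed.
Lemma palg_add0 : left_id (palg_scal 0) palg_add.
Proof. by elim/ppi_ind => x; rewrite palg_addE; apply/ppiP; exact: peq_add0. Qed.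
Lemma palg_addN : left_inverse (palg_scal 0) palg_opp palg_add.
Proof.
elim/ppi_ind => x; rewrite /palg_opp /palg_scale palg_mulE palg_addE.
by apply/ppiP; exact: peq_addN.
Qed.
Lemma palg_mulA : associative palg_mul.
Proof.
elim/ppi_ind => x; elim/ppi_ind => y; elim/ppi_ind => z.
by rewrite !palg_mulE; apply/ppiP; exact: peq_mulA.
Qed.
Lemma palg_mul1l : left_id (palg_scal 1) palg_mul.
Proof. by elim/ppi_ind => x; rewrite palg_mulE; apply/ppiP; exact: peq_mul1l. Qed.
Lemma palg_mul1r : right_id (palg_scal 1) palg_mul.
Proof. by elim/ppi_ind => x; rewrite palg_mulE; apply/ppiP; exact: peq_mul1r. Qed.
Lemma palg_mulDl : left_distributive palg_mul palg_add.
Proof.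
elim/ppi_ind => x; elim/ppi_ind => y; elim/ppi_ind => z.
by rewrite !(palg_mulE, palg_addE); apply/ppiP; exact: peq_mulDl.
Qed.
Lemma palg_mulDr : right_distributive palg_mul palg_add.
Proof.
elim/ppi_ind => x; elim/ppi_ind => y; elim/ppi_ind => z.
by rewrite !(palg_mulE, palg_addE); apply/ppiP; exact: peq_mulDr.
Qed.

HB.instance Definition _ :=
  GRing.isZmodule.Build palg palg_addA palg_addC palg_add0 palg_addN.
HB.instance Definition _ := GRing.Zmodule_isPzRing.Build palg
  palg_mulA palg_mul1l palg_mul1r palg_mulDl palg_mulDr.

Lemma palg_scalD k l : palg_scal (k + l) = palg_scal k + palg_scal l.
Proof.
by rewrite {2}/GRing.add /= palg_addE; apply/ppiP; exact: peq_scalD.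
Qed.
Lemma palg_scalM k l : palg_scal (k * l) = palg_scal k * palg_scal l.
Proof.
by rewrite {2}/GRing.mul /= palg_mulE; apply/ppiP; exact: peq_scalM.
Qed.
Lemma palg_scalC k x : palg_scal k * x = x * palg_scal k.
Proof.
elim/ppi_ind: x => x; rewrite /GRing.mul /= !palg_mulE.
by apply/ppiP; exact: peq_scalC.
Qed.

Lemma palg_scaleA k l x : palg_scale k (palg_scale l x) = palg_scale (k * l) x.
Proof. by rewrite /palg_scale palg_scalM; exact: mulrA. Qed.
Lemma palg_scale1 : left_id 1 palg_scale.
Proof. exact: mul1r. Qed.
Lemma palg_scaleDr : right_distributive palg_scale +%R.
Proof. by move=> k; exact: mulrDr. Qed.
Lemma palg_scaleDl x : {morph palg_scale^~ x : k l / k + l}.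
Proof. by move=> k l; rewrite /palg_scale palg_scalD; exact: mulrDl. Qed.

HB.instance Definition _ := GRing.Zmodule_isLmodule.Build K palg
  palg_scaleA palg_scale1 palg_scaleDr palg_scaleDl.

Lemma ppiD x y : ppi (PAdd x y) = ppi x + ppi y.
Proof. by rewrite -palg_addE. Qed.
Lemma ppiM x y : ppi (PMul x y) = ppi x * ppi y.
Proof. by rewrite -palg_mulE. Qed.

Lemma palg_scalE k : palg_scal k = k *: (1 : palg).
Proof. by rewrite -[LHS]mulr1. Qed.
Lemma palg_scaleAl k (x y : palg) : k *: (x * y) = k *: x * y.
Proof. exact: mulrA. Qed.
Lemma palg_scaleAr k (x y : palg) : k *: (x * y) = x * (k *: y).
Proof.
rewrite -[k *: (x * y)]/(palg_scal k * (x * y)) -[k *: y]/(palg_scal k * y).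
by rewrite mulrA palg_scalC mulrA.
Qed.

Lemma palg_ind (P : palg -> Prop) :
  (forall g, P (palg_gen g)) -> P 1 -> (forall k x, P x -> P (k *: x)) ->
  (forall x y, P x -> P y -> P (x + y)) ->
  (forall x y, P x -> P y -> P (x * y)) -> forall x, P x.
Proof.
move=> Pg P1 PZ PD PM; elim/ppi_ind; elim=> [g|k|x Px y Py|x Px y Py].
- exact: Pg.
- by rewrite -[ppi _]/(palg_scal k) palg_scalE; exact: PZ.
- by rewrite ppiD; exact: PD.
- by rewrite ppiM; exact: PM.
Qed.

End PresentedAlgebra.

(** The algebra morphism [palg R -> B] given by the images [f] of the
  generators; only meaningful when these satisfy the relations. *)
Section PresentedLift.
Variables (K : fieldType) (G : Type) (R : pexpr K G -> pexpr K G -> Prop).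
Variables (B : algType K).

Fixpoint peval (f : G -> B) (x : pexpr K G) : B :=
  match x with
  | PGen g => f g
  | PScal k => k *: 1
  | PAdd x y => peval f x + peval f y
  | PMul x y => peval f x * peval f y
  end.

Definition palg_lift (f : G -> B) (x : palg R) : B := peval f (prepr x).

Variables (f : G -> B) (fR : forall x y, R x y -> peval f x = peval f y).

Lemma peval_peq x y : peq R x y -> peval f x = peval f y.
Proof.
elim=> {x y} //=; do ?[by move=> *; congruence].
- by move=> x y z; rewrite addrA.
- by move=> x y; rewrite addrC.
- by move=> x; rewrite scale0r add0r.
- by move=> x; rewrite mulr_algl scaleN1r addNr scale0r.
- by move=> x y z; rewrite mulrA.
- by move=> x; rewrite scale1r mul1r.
- by move=> x; rewrite scale1r mulr1.
- by move=> x y z; rewrite mulrDl.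
- by move=> x y z; rewrite mulrDr.
- by move=> k l; rewrite scalerDl.
- by move=> k l; rewrite mulr_algl scalerA.
- by move=> k x; rewrite mulr_algl mulr_algr.
Qed.

Lemma palg_lift_pi x : palg_lift f (ppi R x) = peval f x.
Proof. by apply: peval_peq; apply/ppiP; rewrite preprK. Qed.

Lemma palg_lift_gen g : palg_lift f (palg_gen R g) = f g.
Proof. exact: palg_lift_pi. Qed.

Lemma palg_lift_linear : linear (palg_lift f).
Proof.
move=> k; elim/ppi_ind=> x; elim/ppi_ind=> y.
rewrite -[k *: ppi R x]mul1r -palg_scaleAr palg_scaleAl -palg_scalE -ppiM -ppiD.
by rewrite !palg_lift_pi /= mulr_algl.
Qed.

Lemma palg_lift_multiplicative : monoid_morphism (palg_lift f).
Proof.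
split; last first.
  by elim/ppi_ind=> x; elim/ppi_ind=> y; rewrite -ppiM !palg_lift_pi.
by rewrite -[1]/(ppi R (PScal _ 1)) palg_lift_pi /= scale1r.
Qed.

End PresentedLift.

Inductive Agen : Type := Ga | Gb | Gc | Gd | Gs.

Declare Scope pexpr_scope.
Delimit Scope pexpr_scope with pexpr.
Bind Scope pexpr_scope with pexpr.
Notation "x + y" := (PAdd x y) : pexpr_scope.
Notation "x * y" := (PMul x y) : pexpr_scope.
Notation "- x" := (PMul (PScal _ (-1)) x) : pexpr_scope.
Notation "x - y" := (PAdd x (PMul (PScal _ (-1)) y)) : pexpr_scope.
Notation "k %:S" := (PScal _ k%R) : pexpr_scope.

Section Asigma.
Variables (C : numClosedFieldType) (t : C).

Section Relations.
Local Notation X := (pexpr C Agen).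
Let a : X := PGen C Ga.
Let b : X := PGen C Gb.
Let c : X := PGen C Gc.
Let d : X := PGen C Gd.
Let σ : X := PGen C Gs.

Inductive Arel : X -> X -> Prop :=
| Arel_ab : Arel (a * b) (t%:S * b * a)
| Arel_ac : Arel (a * c) (t%:S * c * a)
| Arel_bc : Arel (b * c) (- (c * b))
| Arel_bd : Arel (b * d) (- (t%:S * d * b))
| Arel_cd : Arel (c * d) (- (t%:S * d * c))
| Arel_ad : Arel (a * d - d * a) ((t^-1 - t)%:S * b * c)
| Arel_sa : Arel (σ * a) (a * σ)
| Arel_sd : Arel (σ * d) (d * σ)
| Arel_sb : Arel (σ * b) (- (b * σ))
| Arel_sc : Arel (σ * c) (- (c * σ))
| Arel_ss : Arel (σ * σ) (1%:S)
| Arel_det : Arel (a * d + t%:S * b * c) σ.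
End Relations.

Definition Asig : Type := palg Arel.
HB.instance Definition _ := GRing.PzRing.on Asig.
HB.instance Definition _ := GRing.Lmodule.on Asig.

Lemma Arel_peval (B : algType C) (f : Agen -> B) :
  let a := f Ga in let b := f Gb in let c := f Gc in let d := f Gd in
  let s := f Gs in
  a * b = t *: (b * a) -> a * c = t *: (c * a) -> b * c = - (c * b) ->
  b * d = - (t *: (d * b)) -> c * d = - (t *: (d * c)) ->
  a * d - d * a = (t^-1 - t) *: (b * c) ->
  s * a = a * s -> s * d = d * s -> s * b = - (b * s) -> s * c = - (c * s) ->
  s * s = 1 -> a * d + t *: (b * c) = s ->
  forall x y, Arel x y -> peval f x = peval f y.
Proof.
move=> a b c d s; rewrite /a /b /c /d /s.
move=> h1 h2 h3 h4 h5 h6 h7 h8 h9 h10 h11 h12 x y.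
by case; rewrite /= ?mulr_algl ?scaleN1r -?scalerAl ?scale1r.
Qed.

Definition eps_gen (g : Agen) : C^o :=
  match g with Ga | Gd | Gs => 1 | Gb | Gc => 0 end.

Definition eps (x : Asig) : C := palg_lift eps_gen x.

Lemma eps_rel x y : Arel x y -> peval eps_gen x = peval eps_gen y.
Proof.
by apply: Arel_peval;
  rewrite /eps_gen ?mulr0 ?mul0r ?mulr1 ?scaler0 ?oppr0 ?subrr ?addr0.
Qed.

HB.instance Definition _ := GRing.isLinear.Build C Asig C *%R eps
  (palg_lift_linear eps_rel).
HB.instance Definition _ := GRing.isMonoidMorphism.Build Asig C eps
  (palg_lift_multiplicative eps_rel).

Lemma Asig_neq0 : (1 : Asig) != 0.
Proof.
apply/eqP => /(congr1 eps) /eqP.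
by rewrite raddf0 rmorph1 oner_eq0.
Qed.

HB.instance Definition _ := GRing.PzSemiRing_isNonZero.Build Asig Asig_neq0.
HB.instance Definition _ :=
  GRing.Lmodule_isLalgebra.Build C Asig (@palg_scaleAl C Agen Arel).
HB.instance Definition _ :=
  GRing.Lalgebra_isAlgebra.Build C Asig (@palg_scaleAr C Agen Arel).

Definition gen : Agen -> Asig := palg_gen Arel.

Local Notation A := Asig.
Local Notation a := (gen Ga).
Local Notation b := (gen Gb).
Local Notation c := (gen Gc).
Local Notation d := (gen Gd).
Local Notation σ := (gen Gs).

Lemma Asig_rel :
  [/\ a * b = t *: (b * a), a * c = t *: (c * a), b * c = - (c * b),
      b * d = - (t *: (d * b)) & c * d = - (t *: (d * c))] /\
  [/\ a * d - d * a = (t^-1 - t) *: (b * c), σ * a = a * σ, σ * d = d * σ,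
      σ * b = - (b * σ) & σ * c = - (c * σ)] /\
  σ * σ = 1 /\ a * d + t *: (b * c) = σ.
Proof.
have H x y : Arel x y -> ppi Arel x = ppi Arel y by move=> h; apply/ppiP/peq_rel.
have S k (x : A) : ppi Arel (PScal _ k) * x = k *: x by [].
do ![split]; [move: (H _ _ Arel_ab) | move: (H _ _ Arel_ac)
  | move: (H _ _ Arel_bc) | move: (H _ _ Arel_bd) | move: (H _ _ Arel_cd)
  | move: (H _ _ Arel_ad) | move: (H _ _ Arel_sa) | move: (H _ _ Arel_sd)
  | move: (H _ _ Arel_sb) | move: (H _ _ Arel_sc) | move: (H _ _ Arel_ss)
  | move: (H _ _ Arel_det)];
  rewrite !(ppiM, ppiD) -?mulrA ?S ?scaleN1r //.
Qed.

(** The Z_2-grading, given by the algebra automorphism [parity] with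
  [parity x = (-1)^p(x) x] for homogeneous x; [hpart p x] is the component of
  parity p of x. *)
Definition parity_gen (g : Agen) : A :=
  match g with Gb | Gc => - gen g | _ => gen g end.

Definition parity (x : A) : A := palg_lift parity_gen x.

Definition hpart (p : bool) (x : A) : A :=
  2^-1 *: (x + (-1) ^+ p *: parity x).

Definition homog (p : bool) (x : A) : Prop := hpart p x = x.

Lemma parity_rel x y : Arel x y -> peval parity_gen x = peval parity_gen y.
Proof.
have [[h1 h2 h3 h4 h5] [[h6 h7 h8 h9 h10] [h11 h12]]] := Asig_rel.
by apply: Arel_peval; rewrite /parity_gen ?(mulNr, mulrN, opprK, scalerN) //;
  rewrite ?(h1, h2, h3, h4, h5, h6, h7, h8, h9, h10, h11, h12) ?scalerN ?opprK.
Qed.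

HB.instance Definition _ := GRing.isLinear.Build C A A *:%R parity
  (palg_lift_linear parity_rel).
HB.instance Definition _ := GRing.isMonoidMorphism.Build A A parity
  (palg_lift_multiplicative parity_rel).

Lemma parity_gen_homog g :
  parity (gen g) = match g with Gb | Gc => - gen g | _ => gen g end.
Proof. exact: (palg_lift_gen parity_rel). Qed.

Lemma parityK : involutive parity.
Proof.
elim/palg_ind=> [g||k x IH|x y IHx IHy|x y IHx IHy].
- by rewrite -[palg_gen _ g]/(gen g) parity_gen_homog; case: g;
    rewrite ?raddfN ?parity_gen_homog //= ?parity_gen_homog ?opprK.
- by rewrite !rmorph1.
- by rewrite !linearZ /= IH.
- by rewrite !raddfD /= IHx IHy.
- by rewrite !rmorphM /= IHx IHy.
Qed.

Lemma hpart_linear p : linear (hpart p).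
Proof.
move=> k x y; rewrite /hpart linearP /= [k *: (_ *: _)]scalerA [k * _]mulrC -scalerA -scalerDr.
congr (_ *: _); rewrite !scalerDr !scalerA [k * _]mulrC addrACA.
by [].
Qed.
HB.instance Definition _ p := GRing.isLinear.Build C A A *:%R (hpart p)
  (hpart_linear p).

Lemma hpart_sum x : hpart false x + hpart true x = x.
Proof.
rewrite /hpart expr0 expr1 scale1r scaleN1r -scalerDr addrACA subrr addr0.
by rewrite -mulr2n -scaler_nat scalerA mulVf ?scale1r ?pnatr_eq0.
Qed.

Lemma homogP p x : homog p x <-> parity x = (-1) ^+ p *: x.
Proof.
have two : (2 : C) != 0 by rewrite pnatr_eq0.
rewrite /homog /hpart; split=> [<-|->].
  rewrite linearZ /= raddfD /= linearZ /= parityK scalerA mulrC -scalerA.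
  congr (_ *: _); by rewrite scalerDr scalerA -signr_addb addbb scale1r addrC.
rewrite scalerA -signr_addb addbb scale1r -mulr2n -scaler_nat scalerA.
by rewrite mulVf ?scale1r.
Qed.

Lemma parity_hpart p x : parity (hpart p x) = (-1) ^+ p *: hpart p x.
Proof.
rewrite /hpart linearZ /= raddfD /= linearZ /= parityK [RHS]scalerA.
rewrite [_ * 2^-1]mulrC -[RHS]scalerA; congr (_ *: _).
by rewrite scalerDr scalerA -signr_addb addbb scale1r addrC.
Qed.

Lemma hpart_homog p x : homog p (hpart p x).
Proof. by apply/homogP; exact: parity_hpart. Qed.

Lemma hpart_other p x : homog p x -> hpart (~~ p) x = 0.
Proof.
move/homogP=> h; rewrite /hpart h scalerA -signr_addb addNb addbb /= scaleN1r.
by rewrite subrr scaler0.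
Qed.

Lemma homogM p q x y : homog p x -> homog q y -> homog (p (+) q) (x * y).
Proof.
move=> /homogP hx /homogP hy; apply/homogP.
by rewrite rmorphM /= hx hy -scalerAl -scalerAr scalerA signr_addb.
Qed.

Lemma homog1 : homog false 1.
Proof. by apply/homogP; rewrite rmorph1 scale1r. Qed.

Lemma gen_homog g :
  homog (match g with Gb | Gc => true | _ => false end) (gen g).
Proof. by apply/homogP; rewrite parity_gen_homog; case: g; rewrite ?scaleN1r ?scale1r. Qed.

(** The algebra A(σ) ⊗ A(σ), with
  [(u ⊗ v) (u' ⊗ v') = (-1)^(p(v) p(u')) u u' ⊗ v v'] on homogeneous elements
  ([tensAM_homog] below). *)
Definition tensA : Type := tens A A.
HB.instance Definition _ := GRing.Lmodule.on tensA.

Definition tensA_pmul (u v u' v' : A) : tensA :=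
  \sum_(p : bool) \sum_(p' : bool)
    (-1) ^+ (p && p') *: ((u * hpart p' u') ⊗ (hpart p v * v')).

Definition tensA_mul (x y : tensA) : tensA :=
  tens_lift (fun u v => tens_lift (fun u' v' => tensA_pmul u v u' v') y) x.

Definition tensA_one : tensA := (1 : A) ⊗ (1 : A).

Lemma tensA_pmulDl u1 u2 v k u' v' :
  tensA_pmul (k *: u1 + u2) v u' v' =
  k *: tensA_pmul u1 v u' v' + tensA_pmul u2 v u' v'.
Proof.
rewrite /tensA_pmul !scaler_sumr -big_split; apply: eq_bigr => p _.
rewrite !scaler_sumr -big_split; apply: eq_bigr => p' _ /=.
rewrite mulrDl -scalerAl tpureDl tpureZl scalerDr !scalerA.
by congr (_ *: _ + _); rewrite mulrC.
Qed.

Lemma tensA_pmulDr u v1 v2 k u' v' :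
  tensA_pmul u (k *: v1 + v2) u' v' =
  k *: tensA_pmul u v1 u' v' + tensA_pmul u v2 u' v'.
Proof.
rewrite /tensA_pmul !scaler_sumr -big_split; apply: eq_bigr => p _.
rewrite !scaler_sumr -big_split; apply: eq_bigr => p' _ /=.
rewrite linearP /= mulrDl -scalerAl tpureDr tpureZr scalerDr !scalerA.
by congr (_ *: _ + _); rewrite mulrC.
Qed.

Lemma tensA_pmul_bilin u v : bilin (tensA_pmul u v).
Proof.
split=> w k x y; rewrite /tensA_pmul !scaler_sumr -big_split;
  apply: eq_bigr => p _; rewrite !scaler_sumr -big_split;
  apply: eq_bigr => p' _ /=.
  rewrite linearP /= mulrDr -scalerAr tpureDl tpureZl scalerDr !scalerA.
  by congr (_ *: _ + _); rewrite mulrC.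
rewrite mulrDr -[_ * (k *: x)]scalerAr tpureDr tpureZr scalerDr !scalerA.
by congr (_ *: _ + _); rewrite mulrC.
Qed.

Lemma tens_lift_eqlin (f g h : A -> A -> tensA) k :
    bilin f -> bilin g -> bilin h ->
    (forall u v, f u v = k *: g u v + h u v) ->
  forall x, tens_lift f x = k *: tens_lift g x + tens_lift h x.
Proof.
move=> fb gb hb E; elim/tens_ind=> [u v|x y IHx IHy|l x IH].
- by rewrite !tens_liftE.
- rewrite !(linearPD (tens_lift_linear fb), linearPD (tens_lift_linear gb),
    linearPD (tens_lift_linear hb)) IHx IHy scalerDr.
  by rewrite addrACA.
- rewrite !(linearPZ (tens_lift_linear fb), linearPZ (tens_lift_linear gb),
    linearPZ (tens_lift_linear hb)) IH scalerDr !scalerA.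
  by rewrite [l * k]mulrC.
Qed.

Lemma tensA_mul_bilin y :
  bilin (fun u v => tens_lift (fun u' v' => tensA_pmul u v u' v') y).
Proof.
split=> [v k u1 u2|u k v1 v2]; apply: tens_lift_eqlin;
  do ?[exact: tensA_pmul_bilin]; move=> u' v'.
  exact: tensA_pmulDl.
exact: tensA_pmulDr.
Qed.

Lemma tensA_mulE u v u' v' : tensA_mul (u ⊗ v) (u' ⊗ v') = tensA_pmul u v u' v'.
Proof.
rewrite /tensA_mul tens_liftE; last exact: tensA_mul_bilin.
by rewrite tens_liftE //; exact: tensA_pmul_bilin.
Qed.

Lemma tensA_mul_linearl y : linear (tensA_mul^~ y).
Proof. exact: tens_lift_linear (tensA_mul_bilin y). Qed.

Lemma tensA_mul_linearr x : linear (tensA_mul x).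
Proof.
move=> k y z; elim/tens_ind: x => [u v|x x' IHx IHx'|l x IH].
- rewrite /tensA_mul !(tens_liftE (tensA_mul_bilin _)).
  exact: (tens_lift_linear (tensA_pmul_bilin u v)).
- rewrite !(linearPD (tensA_mul_linearl _)) IHx IHx' scalerDr.
  by rewrite addrACA.
- rewrite !(linearPZ (tensA_mul_linearl _)) IH scalerDr !scalerA.
  by rewrite [l * k]mulrC.
Qed.

Lemma tensA_mul_homog p p' u v u' v' : homog p v -> homog p' u' ->
  tensA_mul (u ⊗ v) (u' ⊗ v') = (-1) ^+ (p && p') *: ((u * u') ⊗ (v * v')).
Proof.
move=> hv hu.
rewrite tensA_mulE /tensA_pmul (bigD1 p) //= (bigD1 p') //= hv hu.
rewrite !big1 ?addr0 // => [q|q].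
  move=> qp; apply: big1 => q' _.
  have -> : q = ~~ p by case: (q) (p) qp => [] [].
  by rewrite (hpart_other hv) mul0r tpure0r scaler0.
move=> qp; have -> : q = ~~ p' by case: (q) (p') qp => [] [].
by rewrite (hpart_other hu) mulr0 tpure0l scaler0.
Qed.

Lemma tensA_ind (P : tensA -> Prop) :
    (forall p q u v, homog p u -> homog q v -> P (u ⊗ v)) ->
    (forall x y, P x -> P y -> P (x + y)) ->
    (forall k x, P x -> P (k *: x)) -> forall x, P x.
Proof.
move=> Pp PD PZ; elim/tens_ind=> [u v| |]; [| exact: PD | exact: PZ].
rewrite -(hpart_sum u) -(hpart_sum v) tpureDl !tpureDr.
by apply: (PD); apply: (PD); apply: (Pp _ _ _ _ (hpart_homog _ _) (hpart_homog _ _)).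
Qed.

Lemma tensA_mulDl : left_distributive tensA_mul +%R.
Proof. by move=> x y z; rewrite (linearPD (tensA_mul_linearl z)). Qed.
Lemma tensA_mulDr : right_distributive tensA_mul +%R.
Proof. by move=> x y z; rewrite (linearPD (tensA_mul_linearr x)). Qed.
Lemma tensA_mulZl k x y : tensA_mul (k *: x) y = k *: tensA_mul x y.
Proof. by rewrite (linearPZ (tensA_mul_linearl y)). Qed.
Lemma tensA_mulZr k x y : tensA_mul x (k *: y) = k *: tensA_mul x y.
Proof. by rewrite (linearPZ (tensA_mul_linearr x)). Qed.

Lemma tensA_mulA : associative tensA_mul.
Proof.
move=> x y z.
elim/tensA_ind: x => [p1 q1 u1 v1 hu1 hv1|x x' IHx IHx'|k x IH]; first last.
- by rewrite !tensA_mulZl IH.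
- by rewrite !tensA_mulDl IHx IHx'.
elim/tensA_ind: y => [p2 q2 u2 v2 hu2 hv2|x x' IHx IHx'|k x IH]; first last.
- by rewrite !(tensA_mulZl, tensA_mulZr) IH.
- by rewrite !(tensA_mulDl, tensA_mulDr) IHx IHx'.
elim/tensA_ind: z => [p3 q3 u3 v3 hu3 hv3|x x' IHx IHx'|k x IH]; first last.
- by rewrite !(tensA_mulZl, tensA_mulZr) IH.
- by rewrite !(tensA_mulDl, tensA_mulDr) IHx IHx'.
rewrite (tensA_mul_homog _ _ hv2 hu3) (tensA_mul_homog _ _ hv1 hu2).
rewrite tensA_mulZl tensA_mulZr.
rewrite (tensA_mul_homog _ _ hv1 (homogM hu2 hu3)).
rewrite (tensA_mul_homog _ _ (homogM hv1 hv2) hu3).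
rewrite !mulrA !scalerA -!signr_addb; congr (_ *: _).
by case: q1 p2 q2 p3 {hv1 hu2 hv2 hu3} => [] [] [] [].
Qed.

Lemma tensA_mul1l : left_id tensA_one tensA_mul.
Proof.
elim/tensA_ind => [p q u v hu hv|x x' IHx IHx'|k x IH].
- by rewrite (tensA_mul_homog _ _ homog1 hu) scale1r !mul1r.
- by rewrite tensA_mulDr IHx IHx'.
- by rewrite tensA_mulZr IH.
Qed.
Lemma tensA_mul1r : right_id tensA_one tensA_mul.
Proof.
elim/tensA_ind => [p q u v hu hv|x x' IHx IHx'|k x IH].
- by rewrite (tensA_mul_homog _ _ hv homog1) andbF scale1r !mulr1.
- by rewrite tensA_mulDl IHx IHx'.
- by rewrite tensA_mulZl IH.
Qed.

Lemma tensA_one_neq0 : tensA_one != 0.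
Proof.
have eb : bilin (fun u v => eps u * eps v : C^o).
  split=> [v|u] k x y; rewrite linearP /= ?mulrDl ?mulrDr; congr (_ + _).
    exact/esym/mulrA.
  exact: mulrCA.
apply/eqP => /(congr1 (tens_lift (fun u v => eps u * eps v : C^o))).
rewrite tens_liftE // -[X in tens_lift _ X](scale0r (tensA_one)).
rewrite (linearPZ (tens_lift_linear eb)) scale0r rmorph1 mulr1.
by move/eqP; rewrite oner_eq0.
Qed.

HB.instance Definition _ := GRing.Zmodule_isNzRing.Build tensA
  tensA_mulA tensA_mul1l tensA_mul1r tensA_mulDl tensA_mulDr tensA_one_neq0.

Lemma tensA_scaleAl k (x y : tensA) : k *: (x * y) = k *: x * y.
Proof. by rewrite /GRing.mul /= tensA_mulZl. Qed.
Lemma tensA_scaleAr k (x y : tensA) : k *: (x * y) = x * (k *: y).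
Proof. by rewrite /GRing.mul /= tensA_mulZr. Qed.

HB.instance Definition _ := GRing.Lmodule_isLalgebra.Build C tensA tensA_scaleAl.
HB.instance Definition _ := GRing.Lalgebra_isAlgebra.Build C tensA tensA_scaleAr.

Lemma tensAM_homog p p' u v u' v' : homog p v -> homog p' u' ->
  (u ⊗ v : tensA) * (u' ⊗ v' : tensA) =
  (-1) ^+ (p && p') *: ((u * u') ⊗ (v * v')).
Proof. exact: tensA_mul_homog. Qed.

Definition Delta_gen (g : Agen) : tensA :=
  match g with
  | Ga => a ⊗ a + b ⊗ c
  | Gb => a ⊗ b + b ⊗ d
  | Gc => c ⊗ a + d ⊗ c
  | Gd => c ⊗ b + d ⊗ d
  | Gs => σ ⊗ σ
  end.

Definition Delta (x : A) : tensA := palg_lift Delta_gen x.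

Lemma Delta_rel (t0 : t != 0) x y :
  Arel x y -> peval Delta_gen x = peval Delta_gen y.
Proof.
have [[h1 h2 h3 h4 h5] [[h6 h7 h8 h9 h10] [h11 h12]]] := Asig_rel.
have ha : homog false a := gen_homog Ga.
have hb : homog true b := gen_homog Gb.
have hc : homog true c := gen_homog Gc.
have hd : homog false d := gen_homog Gd.
have hs : homog false σ := gen_homog Gs.
have h6' : a * d = d * a + (t - t^-1) *: (c * b).
  by rewrite -[LHS](subrK (d * a)) h6 h3 scalerN -scaleNr opprB addrC.
have h12' : σ = d * a - t^-1 *: (c * b).
  by rewrite -h12 h6' h3 scalerN scalerBl addrA addrAC addrK.
pose T u v u' v' p p' hv hu := @tensAM_homog p p' u v u' v' hv hu.
apply: Arel_peval; rewrite /Delta_gen.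
all: rewrite ?(mulrDl, mulrDr) !(T _ _ _ _ _ _ ha ha, T _ _ _ _ _ _ ha hb, T _ _ _ _ _ _ ha hc,
 T _ _ _ _ _ _ ha hd, T _ _ _ _ _ _ hb ha, T _ _ _ _ _ _ hb hb, T _ _ _ _ _ _ hb hc,
 T _ _ _ _ _ _ hb hd, T _ _ _ _ _ _ hc ha, T _ _ _ _ _ _ hc hb, T _ _ _ _ _ _ hc hc,
 T _ _ _ _ _ _ hc hd, T _ _ _ _ _ _ hd ha, T _ _ _ _ _ _ hd hb, T _ _ _ _ _ _ hd hc,
 T _ _ _ _ _ _ hd hd, T _ _ _ _ _ _ hs ha, T _ _ _ _ _ _ hs hb, T _ _ _ _ _ _ hs hc,
 T _ _ _ _ _ _ hs hd, T _ _ _ _ _ _ hs hs, T _ _ _ _ _ _ ha hs, T _ _ _ _ _ _ hb hs,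
 T _ _ _ _ _ _ hc hs, T _ _ _ _ _ _ hd hs).
all: rewrite /= ?expr0 ?expr1 ?scale1r ?scaleN1r.
all: rewrite ?(h7, h8, h9, h10, h11).
all: rewrite ?(h1, h2, h3, h4, h5, h6').
all: rewrite ?(tpureDl, tpureDr, tpureZl, tpureZr, tpureNl, tpureNr,
  scalerDr, scalerN, scaleNr, opprD, opprK, scalerA).

11: by [].
11: rewrite h12' ?(tpureDl, tpureDr, tpureZl, tpureZr, tpureNl, tpureNr,
  scalerDr, scalerN, scaleNr, opprD, opprK, scalerA).
all: repeat match goal with |- context [@tpure _ _ _ ?u ?v] =>
  let z := fresh "z" in set z := (@tpure _ _ _ u v) end.
all: lmod_tac C tensA; do ![split]; by field.
Qed.

Lemma Delta_linear (t0 : t != 0) : linear Delta.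
Proof. exact: (palg_lift_linear (Delta_rel t0)). Qed.
Lemma Delta_morphism (t0 : t != 0) : monoid_morphism Delta.
Proof. exact: (palg_lift_multiplicative (Delta_rel t0)). Qed.
Lemma Delta_genE (t0 : t != 0) g : Delta (gen g) = Delta_gen g.
Proof. exact: (palg_lift_gen (Delta_rel t0)). Qed.
Lemma eps_genE g : eps (gen g) = eps_gen g.
Proof. exact: (palg_lift_gen eps_rel). Qed.

Section Comodules.
Variable V : vectType C.

Definition is_lcomodule (ρ : V -> tens A V) : Prop :=
  (forall v, tens_assoc (tens_map Delta idfun (ρ v)) = tens_map idfun ρ (ρ v)) /\
  (forall v, tens_lift (fun (x : A) (w : V) => eps x *: w) (ρ v) = v).

Definition is_rcomodule (ρ : V -> tens V A) : Prop :=
  (forall v, tens_assoc (tens_map ρ idfun (ρ v)) = tens_map idfun Delta (ρ v)) /\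
  (forall v, tens_lift (fun (w : V) (x : A) => eps x *: w) (ρ v) = v).

Definition lsubcomodule (ρ : V -> tens A V) (W : {vspace V}) : Prop :=
  forall w, w \in W -> tsub setT [set` W] (ρ w).

Definition rsubcomodule (ρ : V -> tens V A) (W : {vspace V}) : Prop :=
  forall w, w \in W -> tsub [set` W] setT (ρ w).

Definition irreducible_lcomodule (ρ : V -> tens A V) : Prop :=
  is_lcomodule ρ /\ (fullv != 0%VS :> {vspace V}) /\
  (forall W : {vspace V}, lsubcomodule ρ W -> W = 0%VS \/ W = fullv).

Definition irreducible_rcomodule (ρ : V -> tens V A) : Prop :=
  is_rcomodule ρ /\ (fullv != 0%VS :> {vspace V}) /\
  (forall W : {vspace V}, rsubcomodule ρ W -> W = 0%VS \/ W = fullv).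

(** Isomorphism of the comodule (V, ρ) with a subcomodule S of A(σ), whose
  coaction is the restriction of [Delta]. *)
Definition lcomodule_iso (ρ : V -> tens A V) (S : set A) : Prop :=
  exists f : {linear V -> A},
    [/\ injective f, range f = S &
        forall v, Delta (f v) = tens_map idfun f (ρ v)].

Definition rcomodule_iso (ρ : V -> tens V A) (S : set A) : Prop :=
  exists f : {linear V -> A},
    [/\ injective f, range f = S &
        forall v, Delta (f v) = tens_map f idfun (ρ v)].
End Comodules.

Definition is_subbicomodule (S : set A) : Prop :=
  forall x, S x -> tsub setT S (Delta x) /\ tsub S setT (Delta x).

(** A(σ) is the internal direct sum of the subspaces [S i]. *)
Definition is_direct_sum (I : eqType) (S : I -> set A) : Prop :=
  (forall x, exists (r : seq I) (f : I -> A),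
     [/\ uniq r, forall i, i \in r -> S i (f i) & x = \sum_(i <- r) f i]) /\
  (forall (r : seq I) (f : I -> A),
     uniq r -> (forall i, i \in r -> S i (f i)) -> \sum_(i <- r) f i = 0 ->
     forall i, i \in r -> f i = 0).

(** The half-integer ℓ is represented by the natural number n = 2ℓ, the index
  i in {-ℓ, ..., ℓ} by k = ℓ + i in {0, ..., n}, and s in {0, 1} by a boolean;
  [qbin] is the Gaussian binomial in base v = t^-2, and [rt n k] is
  the chosen square root of [qbin (t ^- 2) n k]. *)
Definition qpoch (u v : C) (m : nat) : C := \prod_(k < m) (1 - u * v ^+ k).

Definition qbin (v : C) (m n : nat) : C :=
  qpoch v v m / (qpoch v v n * qpoch v v (m - n)).

Section Subcomodules.
Variable rt : nat -> nat -> C.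

Definition xi (n : nat) (k : 'I_n.+1) : A :=
  ('i ^+ k./2 * rt n k) *: (a ^+ (n - k) * c ^+ k).

Definition eta (n : nat) (k : 'I_n.+1) : A :=
  ('i ^+ k./2 * rt n k) *: (a ^+ (n - k) * b ^+ k).

Definition VL (n : nat) (s : bool) : set A :=
  [set x | exists l : 'I_n.+1 -> C, x = \sum_k l k *: (xi k * σ ^+ s)].

Definition VR (n : nat) (s : bool) : set A :=
  [set x | exists l : 'I_n.+1 -> C, x = \sum_k l k *: (eta k * σ ^+ s)].

Definition matrix_elements (m : forall n, 'I_n.+1 -> 'I_n.+1 -> A) : Prop :=
  forall n (i : 'I_n.+1), Delta (xi i) = \sum_j m n i j ⊗ xi j.

Definition Mspan (m : forall n, 'I_n.+1 -> 'I_n.+1 -> A) (n : nat) (s : bool)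
  : set A :=
  [set x | exists l : 'I_n.+1 -> 'I_n.+1 -> C,
     x = \sum_i \sum_j l i j *: (m n i j * σ ^+ s)].

(* z lies in A(σ) ⊗ span {a^(n-j) c^j : 0 <= j <= n}. *)
Definition in_degree (n : nat) (z : tensA) : Prop :=
  exists f : nat -> A, z = \sum_(j < n.+1) f j ⊗ (a ^+ (n - j) * c ^+ j).

Lemma in_degreeD n y z : in_degree n y -> in_degree n z -> in_degree n (y + z).
Proof.
move=> [f ->] [g ->]; exists (fun j => f j + g j).
by rewrite -big_split; apply: eq_bigr => j _; rewrite tpureDl.
Qed.

Lemma in_degree1 n x j : (j <= n)%N ->
  in_degree n (x ⊗ (a ^+ (n - j) * c ^+ j)).
Proof.
move=> jn; exists (fun k => if k == j then x else 0).
rewrite (bigD1 (Ordinal (jn : (j < n.+1)%N))) //= eqxx big1 ?addr0 // => k kj.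
by rewrite ifN ?tpure0l // -[j]/(nat_of_ord (Ordinal (jn : (j < n.+1)%N))) (inj_eq val_inj).
Qed.

Lemma in_degree0 n : in_degree n 0.
Proof. by exists (fun=> 0); rewrite big1 // => j _; rewrite tpure0l. Qed.

Lemma tensAMa (x y w : A) : (x ⊗ a : tensA) * (y ⊗ w) = (x * y) ⊗ (a * w).
Proof.
have ha : homog false a := gen_homog Ga.
rewrite -{1}(hpart_sum y) tpureDl mulrDr.
rewrite !(tensAM_homog _ _ ha (hpart_homog _ _)) !scale1r -tpureDl -mulrDr.
by rewrite hpart_sum.
Qed.

Lemma tensAMc (x y w : A) :
  (x ⊗ c : tensA) * (y ⊗ w) = (x * parity y) ⊗ (c * w).
Proof.
have hc : homog true c := gen_homog Gc.
rewrite -{1}(hpart_sum y) tpureDl mulrDr.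
rewrite !(tensAM_homog _ _ hc (hpart_homog _ _)) /= scale1r -tpureZl scalerAr.
rewrite -tpureDl -mulrDr -[in RHS](hpart_sum y) raddfD /= !parity_hpart.
by rewrite expr0 scale1r.
Qed.

Lemma c_aX (t0 : t != 0) n : c * a ^+ n = t ^- n *: (a ^+ n * c).
Proof.
have [[_ h _ _ _] _] := Asig_rel.
have h' : c * a = t^-1 *: (a * c) by rewrite h scalerA mulVf ?scale1r.
elim: n => [|n IH]; first by rewrite expr0 mulr1 mul1r invr1 scale1r.
rewrite [a ^+ _.+1]exprS mulrA h' -scalerAl -[a * c * _]mulrA IH -scalerAr.
by rewrite scalerA mulrA -invfM -[t * _]exprS -exprS.
Qed.

Lemma in_degreeM (t0 : t != 0) (x y : A) n z : in_degree n z ->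
  in_degree n.+1 ((x ⊗ a + y ⊗ c : tensA) * z).
Proof.
move=> [f ->]; rewrite mulr_sumr.
elim/big_ind: _ => [|u v|[j /= jn] _]; first exact: in_degree0.
  exact: in_degreeD.
rewrite mulrDl tensAMa tensAMc; apply: in_degreeD.
  by rewrite mulrA -exprS -subSn //; apply: in_degree1; rewrite ltnW.
rewrite mulrA c_aX // -scalerAl -mulrA -exprS tpureZr -tpureZl -subSS.
exact: in_degree1.
Qed.

Lemma in_degree_Delta (t0 : t != 0) i j :
  in_degree (i + j) (Delta (a ^+ i * c ^+ j)).
Proof.
have [D1 DM] := Delta_morphism t0.
elim: i => [|i IH]; last first.
  by rewrite exprS -mulrA DM (Delta_genE t0 Ga); exact: in_degreeM.
rewrite mul1r; elim: j => [|j IH]; last first.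
  by rewrite exprS DM (Delta_genE t0 Gc); exact: in_degreeM.
rewrite expr0 D1; have := @in_degree1 0 1 0 isT.
by rewrite expr0 mulr1.
Qed.

Lemma qpoch_neq0 v m : (forall k, (0 < k)%N -> v ^+ k != 1) -> qpoch v v m != 0.
Proof.
move=> h; apply/prodf_neq0 => k _.
by rewrite -exprS subr_eq0 eq_sym h.
Qed.

(* The equations defining the matrix elements are solvable. *)
Lemma matrix_elements_exist (q : C) :
    q != 0 -> (forall n, (0 < n)%N -> q ^+ n != 1) -> t ^+ 2 = - q ->
    (forall n k, (k <= n)%N -> rt n k ^+ 2 = qbin (t ^- 2) n k) ->
  exists m, matrix_elements m.
Proof.
move=> q0 qr tq hrt.
have t0 : t != 0 by have := expf_eq0 t 2; rewrite tq oppr_eq0 (negPf q0) /= => <-.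
have vr k : (0 < k)%N -> t ^- 2 ^+ k != 1.
  move=> k0; rewrite tq exprVn invr_eq1; apply/eqP => h.
  have := qr (2 * k)%N; rewrite muln_gt0 k0 => /(_ isT) /eqP; apply.
  by rewrite exprM -sqrrN exprAC h expr1n.
pose u n k := 'i ^+ k./2 * rt n k.
have u0 n k : (k <= n)%N -> u n k != 0.
  move=> kn; rewrite mulf_neq0 ?expf_neq0 ?neq0Ci //.
  have := expf_eq0 (rt n k) 2; rewrite andTb => <-; rewrite hrt // mulf_neq0 ?invr_neq0 ?mulf_neq0 //;
  exact: qpoch_neq0.
have H n (i : 'I_n.+1) : exists f : 'I_n.+1 -> A,
    Delta (xi i) = \sum_j f j ⊗ xi j.
  have [f E] := in_degree_Delta t0 (n - i) i.
  exists (fun j => (u n i / u n j) *: f j).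
  rewrite (linearPZ (Delta_linear t0)) {}E subnK -1?ltnS // scaler_sumr.
  apply: eq_bigr => j _; rewrite tpureZl tpureZr scalerA divfK //.
  by apply: u0; rewrite -ltnS.
exists (fun n i => projT1 (cid (H n i))) => n i.
by case: cid.
Qed.

End Subcomodules.
End Asigma.

(* Main.v *)
Require Import Defs.
From HB Require Import structures.
From mathcomp Require Import all_boot all_order all_algebra.
From mathcomp Require Import boolp classical_sets reals.
From mathcomp Require Import complex ring zify.

Set Implicit Arguments.
Unset Strict Implicit.
Unset Printing Implicit Defensive.

Import Order.TTheory GRing.Theory Num.Theory.
Local Open Scope ring_scope.

(** Contracting one leg of the comultiplication with linear functionals turns
  A(σ) into a bimodule over its dual algebra.  Two skew-primitive functionals
  lower the row and the column index of the matrix elements, and characters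
  take the values l^n z^s on the corner elements m_00 σ^s; hence a linear
  relation between the m_ij σ^s leads to one between distinct characters, and
  the m_ij σ^s are independent.  Those with n <= N lie in the span of the
  equally many monomials a^x b^y c^z σ^s and d^x b^y c^z σ^s (x > 0) with
  x + y + z <= N, so that they also span A(σ).

  The coordinate functionals of this basis multiply as matrix units, so a
  comodule is a space with an action of matrix units E_ij.  An irreducible one
  has a basis u_i with E_kl u_i = δ_ki u_l; it embeds in A(σ) by u_i |-> m_i0
  (left) or u_i |-> m_0i (right), and these are multiples of the ξ_i and η_i. *)

(** * Linear maps on tensor products *)

(** In an algebra given by generators and relations, an element is seen to be nonzero only through
    maps out of it; here these are explicit representations of dimension 1 and 2. If an upper
    triangular representation has [ε] as its lower diagonal entry and scalars for [b], [c] in its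
    corner, the relations [ab = tba] and [bd = -tdb] ask for the upper diagonal values [t] at [a]
    and [-t^-1] at [d]: these are the constants of [skew_gen]. Its corner entry obeys a twisted
    Leibniz rule, so that contracting with it acts on the [a^i c^k] like a q-derivative. The factors
    are q-numbers in base [t^-2] or [t^2], nonzero because [q] is not a root of 1.

    The count behind the spanning argument: for a fixed [s], the monomials of degree [n] are
    [(n+1)(n+2)/2] with first letter [a] and [n(n+1)/2] with first letter [d], in all [(n+1)^2], the
    number of the [m_ij]. The relation [ad = σ - tbc] mixes degrees, so the comparison is made for
    all [n <= N] at once. *)

Section LinearMaps.
Variable K : fieldType.
Implicit Types U V W : lmodType K.

Lemma lin0 U V (f : U -> V) : linear f -> f 0 = 0.
Proof. by move=> fl; rewrite -(scale0r 0) (Defs.linearPZ fl) scale0r. Qed.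

Lemma lin_sum U V (f : U -> V) : linear f -> forall I (r : seq I) P F,
  f (\sum_(i <- r | P i) F i) = \sum_(i <- r | P i) f (F i).
Proof.
move=> fl I r P F; elim/big_rec2: _ => [|i y x _ <-]; first exact: lin0.
exact: Defs.linearPD.
Qed.

Lemma lin_comp U V W (f : V -> W) (g : U -> V) :
  linear f -> linear g -> linear (fun x => f (g x)).
Proof. by move=> fl gl k x y; rewrite gl fl. Qed.

Lemma lin_add U V (f g : U -> V) :
  linear f -> linear g -> linear (fun x => f x + g x).
Proof. by move=> fl gl k x y; rewrite fl gl scalerDr addrACA. Qed.

Lemma lin_bigsum U V I (r : seq I) (F : I -> U -> V) :
  (forall i, linear (F i)) -> linear (fun x => \sum_(i <- r) F i x).
Proof.
move=> Fl k x y; rewrite scaler_sumr -big_split.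
by apply: eq_bigr => i _; exact: Fl.
Qed.

Lemma tens_ext U V W (f g : tens U V -> W) : linear f -> linear g ->
  (forall u v, f (u ⊗ v) = g (u ⊗ v)) -> f =1 g.
Proof.
move=> fl gl E; elim/tens_ind=> // [x y IHx IHy|k x IH].
  by rewrite (Defs.linearPD fl) (Defs.linearPD gl) IHx IHy.
by rewrite (Defs.linearPZ fl) (Defs.linearPZ gl) IH.
Qed.

Lemma tmap_bilin U V U' V' (f : U -> U') (g : V -> V') :
  linear f -> linear g -> bilin (fun u v => f u ⊗ g v).
Proof.
move=> fl gl; split=> [v|u] k x y; first by rewrite fl tpureDl tpureZl.
by rewrite gl tpureDr tpureZr.
Qed.

Lemma tmap_linear U V U' V' (f : U -> U') (g : V -> V') :
  linear f -> linear g -> linear (tens_map f g).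
Proof. by move=> fl gl; apply: tens_lift_linear; apply: tmap_bilin. Qed.

Lemma tmapE U V U' V' (f : U -> U') (g : V -> V') u v :
  linear f -> linear g -> tens_map f g (u ⊗ v) = f u ⊗ g v.
Proof. by move=> fl gl; rewrite /tens_map tens_liftE //; exact: tmap_bilin. Qed.

Lemma tassoc_bilin U V W :
  bilin (fun (x : tens U V) (w : W) => tens_lift (fun u v => u ⊗ (v ⊗ w)) x).
Proof.
have bw z : bilin (fun (u : U) (v : V) => u ⊗ (v ⊗ (z : W))).
  split=> [x k y y'|x k y y']; first by rewrite tpureDl tpureZl.
  by rewrite tpureDl tpureZl tpureDr tpureZr.
split=> [z|x k y y']; first exact: tens_lift_linear.
apply: (@tens_ext U V _ (fun x => _ x) (fun x => k *: tens_lift _ x + tens_lift _ x)).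
- exact: tens_lift_linear.
- apply: lin_add => [l u v|]; last exact: tens_lift_linear.
  by rewrite tens_lift_linear // scalerDr !scalerA mulrC.
- by move=> u v; rewrite !tens_liftE // !(tpureDr, tpureZr).
Qed.

Lemma tassoc_linear U V W : linear (@tens_assoc K U V W).
Proof. exact/tens_lift_linear/tassoc_bilin. Qed.

(** Naturality of the associator; it moves left multiplications by generators past [tens_assoc] in
    the proof of coassociativity. *)
Lemma tassoc_map U V W U' V' W' (f : U -> U') (g : V -> V') (h : W -> W') :
    linear f -> linear g -> linear h -> forall x w,
  tens_assoc (tens_map f g x ⊗ h w) =
  tens_map f (tens_map g h) (tens_assoc (x ⊗ w)).
Proof.
move=> fl gl hl x w; have gh := tmap_linear gl hl.
have Tl := @tassoc_linear.
have pl W1 W2 (z : W2) : linear (fun x : W1 => x ⊗ z).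
  by move=> k y y'; rewrite tpureDl tpureZl.
apply: (@tens_ext U V _ (fun x => tens_assoc (tens_map f g x ⊗ h w))
  (fun x => tens_map f (tens_map g h) (tens_assoc (x ⊗ w)))).
- exact: lin_comp (lin_comp (Tl _ _ _) (pl _ _ _)) (tmap_linear fl gl).
- apply: (@lin_comp (tens U V) (tens U (tens V W))); first exact: tmap_linear.
  exact: lin_comp (Tl _ _ _) (pl _ _ _).
- by move=> u v; rewrite tmapE // !tens_assocE !tmapE.
Qed.

Lemma tmap_comp U V U1 V1 U2 V2 (f : U1 -> U2) (g : V1 -> V2)
    (f' : U -> U1) (g' : V -> V1) :
    linear f -> linear g -> linear f' -> linear g' -> forall x,
  tens_map f g (tens_map f' g' x) =
  tens_map (fun u => f (f' u)) (fun v => g (g' v)) x.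
Proof.
move=> fl gl fl' gl'; have ff := lin_comp fl fl'; have gg := lin_comp gl gl'.
apply: tens_ext => [||u v]; [|exact: tmap_linear|by rewrite !tmapE].
by apply: lin_comp; exact: tmap_linear.
Qed.

Lemma tpure_suml U V I (r : seq I) (P : pred I) (F : I -> U) (v : V) :
  (\sum_(i <- r | P i) F i) ⊗ v = \sum_(i <- r | P i) F i ⊗ v.
Proof. by apply: (@lin_sum _ _ (fun u => u ⊗ v)) => k x y; rewrite tpureDl tpureZl. Qed.

Lemma tpure_sumr U V I (r : seq I) (P : pred I) (u : U) (F : I -> V) :
  u ⊗ (\sum_(i <- r | P i) F i) = \sum_(i <- r | P i) u ⊗ F i.
Proof. by apply: (@lin_sum _ _ (fun v => u ⊗ v)) => k x y; rewrite tpureDr tpureZr. Qed.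

End LinearMaps.

HB.instance Definition _ := gen_eqMixin Agen.

(** * Coassociativity *)

Section Coalgebra.
Variables (C : numClosedFieldType) (t : C).
Hypothesis t0 : t != 0.

Local Notation A := (Asig t).
Local Notation gen := (gen t).

(** Reduces statements about Δ to left multiplication by one generator, where [Delta_gen_mul]
    applies. *)
Lemma Asig_ind_gen (P : A -> Prop) :
    P 1 -> (forall k x y, P x -> P y -> P (k *: x + y)) ->
    (forall g x, P x -> P (gen g * x)) -> forall x, P x.
Proof.
move=> P1 PL Pg x; rewrite -[x]mulr1.
have P0 : P 0 by rewrite -(addNr 1) -scaleN1r; exact: PL.
(* The right factor 1 is generalised, so that the claim becomes stable under products of arbitrary
   elements. *)
elim/palg_ind: x (1) P1 => [g||k x IH|x y IHx IHy|x y IHx IHy] z Pz.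
- exact: Pg.
- by rewrite mul1r.
- by rewrite -scalerAl -[_ *: _]addr0; apply: PL => //; apply: IH.
- by rewrite mulrDl -[x * z]scale1r; apply: PL; [apply: IHx|apply: IHy].
- by rewrite -mulrA; apply/IHx/IHy.
Qed.

Definition odd_gen (g : Agen) : bool :=
  match g with Gb | Gc => true | _ => false end.

Definition par_if (p : bool) (x : A) : A := if p then parity x else x.

(* In A(σ) ⊗ A(σ), left multiplication by [gen g1 ⊗ gen g2] acts on the first
  leg as [gmul g1 (odd_gen g2)]: the parity automorphism is the Koszul sign. *)
Definition gmul (g : Agen) (p : bool) (x : A) : A := gen g * par_if p x.

Definition cop (g : Agen) : seq (Agen * Agen) :=
  match g with
  | Ga => [:: (Ga, Ga); (Gb, Gc)]
  | Gb => [:: (Ga, Gb); (Gb, Gd)]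
  | Gc => [:: (Gc, Ga); (Gd, Gc)]
  | Gd => [:: (Gc, Gb); (Gd, Gd)]
  | Gs => [:: (Gs, Gs)]
  end.

Lemma cop_odd g h : h \in cop g -> odd_gen h.1 (+) odd_gen h.2 = odd_gen g.
Proof. by case: g; rewrite /= !inE; do ?[case/orP]; move/eqP=> ->. Qed.

(** The letters [a, b, c, d] span a 2 by 2 matrix coalgebra: both sides run over the same triples,
    at most in another order. *)
Lemma cop_coassoc (V : nmodType) (F : Agen -> Agen -> Agen -> V) g :
  \sum_(h <- cop g) \sum_(l <- cop h.1) F l.1 l.2 h.2 =
  \sum_(h <- cop g) \sum_(l <- cop h.2) F h.1 l.1 l.2.
Proof.
by case: g; rewrite /= ?(big_cons, big_nil) /= ?addr0 // addrACA.
Qed.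

Lemma parity_linear : linear (@parity C t).
Proof. exact: linearP. Qed.

Lemma par_if_linear p : linear (par_if p).
Proof. by case: p => //; exact: parity_linear. Qed.

Lemma gmul_linear g p : linear (gmul g p).
Proof. by move=> k x y; rewrite /gmul par_if_linear mulrDr -scalerAr. Qed.

Lemma par_if_gen p g : par_if p (gen g) = (-1) ^+ (p && odd_gen g) *: gen g.
Proof.
by case: p; case: g => /=; rewrite ?parity_gen_homog ?expr0 ?expr1 ?scaleN1r ?scale1r.
Qed.

Lemma par_ifM p x y : par_if p (x * y) = par_if p x * par_if p y.
Proof. by case: p => //=; rewrite rmorphM. Qed.

Lemma par_if_comp p p' x : par_if p (par_if p' x) = par_if (p (+) p') x.
Proof. by case: p p' => [] [] //=; rewrite parityK. Qed.

Lemma par_if_gmul p g p' x :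
  par_if p (gmul g p' x) = (-1) ^+ (p && odd_gen g) *: gmul g (p (+) p') x.
Proof. by rewrite /gmul par_ifM par_if_gen par_if_comp scalerAl. Qed.

Lemma gen_odd g : homog (odd_gen g) (gen g).
Proof. by case: g; exact: gen_homog. Qed.

Lemma tensA_mul_gen g1 g2 (z : tensA t) :
  (gen g1 ⊗ gen g2 : tensA t) * z =
  tens_map (gmul g1 (odd_gen g2)) (gmul g2 false) z.
Proof.
apply: (tens_ext (tensA_mul_linearr _)) => [|y w].
  by apply: tmap_linear; exact: gmul_linear.
rewrite tmapE; try exact: gmul_linear.
rewrite -[tensA_mul _ _]/((_ : tensA t) * _) -{1}(hpart_sum y) tpureDl mulrDr.
rewrite !(tensAM_homog _ _ (gen_odd g2) (hpart_homog _ _)) andbF andbT scale1r.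
rewrite -tpureZl -tpureDl scalerAr -mulrDr; congr (_ ⊗ _); rewrite /gmul.
congr (_ * _); rewrite -{3}(hpart_sum y) (Defs.linearPD (par_if_linear _)).
by case: (odd_gen g2); rewrite /= ?parity_hpart ?expr0 ?expr1 !scale1r.
Qed.

Lemma Delta_gen_mul g x : Delta (gen g * x) =
  \sum_(h <- cop g) tens_map (gmul h.1 (odd_gen h.2)) (gmul h.2 false) (Delta x).
Proof.
have [_ DM] := Delta_morphism t0; rewrite DM Delta_genE //.
by case: g; rewrite ?big_cons big_nil addr0 -?tensA_mul_gen -?(@mulrDl (tensA t)).
Qed.

Local Notation DeltaL := (Delta_linear t0).

Lemma Delta1 : Delta (1 : A) = 1 ⊗ 1.
Proof. by have [-> _] := Delta_morphism t0. Qed.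

(** Holds because Δ preserves parity on generators ([cop_odd]). It is used when Δ is applied to the
    first leg of [Delta (gen g * x)], where the Koszul sign has left a parity automorphism. *)
Lemma Delta_par_if p x :
  Delta (par_if p x) = tens_map (par_if p) (par_if p) (Delta x).
Proof.
have pl := par_if_linear; have tl := tmap_linear (pl p) (pl p).
elim/Asig_ind_gen: x => [|k x y IHx IHy|g x IH].
- by rewrite Delta1 tmapE //; case: p {pl tl}; rewrite /= ?rmorph1 Delta1.
- by rewrite pl !DeltaL tl IHx IHy.
rewrite par_ifM par_if_gen -scalerAl (Defs.linearPZ DeltaL) !Delta_gen_mul IH.
rewrite (lin_sum tl) scaler_sumr; apply: eq_big_seq => h hg.
have gl := gmul_linear.
rewrite !tmap_comp //.
apply: (tens_ext (f := fun x => _ *: tens_map _ _ x)) => [||u v].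
- move=> l y z; rewrite tmap_linear; do ?[exact: lin_comp].
  by rewrite scalerDr !scalerA mulrC.
- by apply: tmap_linear; exact: lin_comp.
rewrite !tmapE; do ?[exact: lin_comp].
rewrite !par_if_gmul addbF /gmul /= tpureZl tpureZr par_if_comp [p (+) _]addbC.
by rewrite scalerA -signr_addb -andb_addr addbC (cop_odd hg).
Qed.

Definition coassociative_at (x : A) : Prop :=
  tens_assoc (tens_map (@Delta C t) idfun (Delta x)) =
  tens_map idfun (@Delta C t) (Delta x).

(** Induction on words: both iterated coproducts of [gen g * x] arise from those of [x] by the same
    sum of operators on the triple tensor product. This replaces a comparison of two algebra
    morphisms on generators. *)
Lemma coassoc x : coassociative_at x.
Proof.
have pl := par_if_linear; have gl := gmul_linear.
have il : linear (idfun : A -> A) by [].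
have Dl := DeltaL; have al := @tassoc_linear.
elim/Asig_ind_gen: x => [|k x y IHx IHy|g x IH]; rewrite /coassociative_at.
- by rewrite !Delta1 !tmapE // !Delta1 tens_assocE.
- rewrite DeltaL !(tmap_linear Dl il, tmap_linear il Dl).
  by rewrite tassoc_linear IHx IHy.
(* Left multiplication by [h1 ⊗ h2 ⊗ h3] in the graded triple tensor product: each leg is twisted by
   the total parity of the factors to its right. *)
pose Q (h1 h2 h3 : Agen) := tens_map (gmul h1 (odd_gen h2 (+) odd_gen h3))
  (tens_map (gmul h2 (odd_gen h3)) (gmul h3 false)).
have Ql h1 h2 h3 : linear (Q h1 h2 h3) by do ![apply: tmap_linear => //].
pose QL := \sum_(h <- cop g) \sum_(l <- cop h.1)
  Q l.1 l.2 h.2 (tens_assoc (tens_map (@Delta C t) idfun (Delta x))).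
pose QR := \sum_(h <- cop g) \sum_(l <- cop h.2)
  Q h.1 l.1 l.2 (tens_map idfun (@Delta C t) (Delta x)).
have -> : tens_assoc (tens_map (@Delta C t) idfun (Delta (gen g * x))) = QL.
  rewrite Delta_gen_mul !(lin_sum (lin_comp (al _ _ _ _) (tmap_linear Dl il))).
  apply: eq_bigr => h _; rewrite tmap_comp //.
  rewrite /QL; move: (Delta x) => z.
  apply: (tens_ext (f := fun z => tens_assoc (tens_map _ _ z))
    (g := fun z => \sum_(l <- cop h.1) Q l.1 l.2 h.2
       (tens_assoc (tens_map (@Delta C t) idfun z)))) => [||u v].
  - apply: lin_comp; [exact: al|apply: tmap_linear].
      exact: lin_comp.
    exact: gl.
  - apply: lin_bigsum => l; apply: lin_comp => //.
    by apply: lin_comp; [exact: al|exact: tmap_linear].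
  rewrite !tmapE //; last exact: lin_comp.
  rewrite /gmul Delta_gen_mul Delta_par_if tpure_suml (lin_sum (al _ _ _ _)).
  apply: eq_bigr => l _; rewrite tmap_comp //.
  rewrite (tassoc_map (h := gmul h.2 false)) //; try exact: lin_comp.
  congr (tens_map _ (tens_map _ _) _); apply: funext => y.
    by rewrite /gmul par_if_comp.
  exact: lin_comp Dl (gl _ _).
have -> : tens_map idfun (@Delta C t) (Delta (gen g * x)) = QR.
  rewrite Delta_gen_mul !(lin_sum (tmap_linear il Dl)).
  apply: eq_bigr => h _; rewrite tmap_comp //.
  rewrite /QR; move: (Delta x) => z.
  apply: (tens_ext (f := fun z => (tens_map _ _ z))
    (g := fun z => \sum_(l <- cop h.2) Q h.1 l.1 l.2
       (tens_map idfun (@Delta C t) z))) => [||u v].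
  - by apply: tmap_linear => //; exact: lin_comp.
  - apply: lin_bigsum => l; apply: lin_comp => //; exact: tmap_linear.
  rewrite !tmapE //; last exact: lin_comp.
  rewrite [gmul h.2 _ _]/gmul /= Delta_gen_mul tpure_sumr.
  apply: eq_big_seq => l hl; rewrite /Q tmapE //; last by apply: tmap_linear.
  by rewrite (cop_odd hl).
  exact: gl.
rewrite /QL /QR; move: IH; rewrite /coassociative_at => ->.
exact: (cop_coassoc (fun h1 h2 h3 => Q h1 h2 h3 _)).
Qed.

End Coalgebra.

(** * Functionals on A(σ) *)

Section Contractions.
Variables (K : fieldType) (U V : lmodType K).
Implicit Types φ : U -> K^o.

Definition lcon φ : tens U V -> V := tens_lift (fun u v => φ u *: v).
Definition rcon φ : tens V U -> V := tens_lift (fun v u => φ u *: v).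

Lemma lcon_bilin φ : linear φ -> bilin (fun u (v : V) => φ u *: v).
Proof.
move=> φl; split=> [v|u] k x y; first by rewrite φl scalerDl scalerA.
by rewrite scalerDr !scalerA mulrC.
Qed.

Lemma rcon_bilin φ : linear φ -> bilin (fun (v : V) u => φ u *: v).
Proof. by case/lcon_bilin. Qed.

Lemma lcon_linear φ : linear φ -> linear (lcon φ).
Proof. by move=> φl; apply/tens_lift_linear/lcon_bilin. Qed.

Lemma rcon_linear φ : linear φ -> linear (rcon φ).
Proof. by move=> φl; apply/tens_lift_linear/rcon_bilin. Qed.

Lemma lconE φ u v : linear φ -> lcon φ (u ⊗ v) = φ u *: v.
Proof. by move=> φl; rewrite /lcon tens_liftE //; exact: lcon_bilin. Qed.

Lemma rconE φ u v : linear φ -> rcon φ (v ⊗ u) = φ u *: v.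
Proof. by move=> φl; rewrite /rcon tens_liftE //; exact: rcon_bilin. Qed.

Lemma lcon0 z : lcon (fun=> 0) z = 0.
Proof.
have l0 (X W : lmodType K) : linear (fun _ : X => 0 : W).
  by move=> k x y; rewrite scaler0 addr0.
apply: (tens_ext (f := lcon _) (g := fun=> 0)) => [||u v].
- exact: lcon_linear (l0 _ _).
- exact: l0.
- by rewrite lconE ?scale0r //; exact: l0.
Qed.

Lemma rcon0 z : rcon (fun=> 0) z = 0.
Proof.
have l0 (X W : lmodType K) : linear (fun _ : X => 0 : W).
  by move=> k x y; rewrite scaler0 addr0.
apply: (tens_ext (f := rcon _) (g := fun=> 0)) => [||u v].
- exact: rcon_linear (l0 _ _).
- exact: l0.
- by rewrite rconE ?scale0r //; exact: l0.
Qed.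

Lemma lcon_scale k φ z : linear φ ->
  lcon (fun u => k *: φ u) z = k *: lcon φ z.
Proof.
move=> φl; have kl : linear (fun u => k *: φ u).
  by move=> l x y; rewrite φl scalerDr !scalerA [k * l]mulrC.
apply: (tens_ext (f := lcon _) (g := fun z => k *: lcon φ z)) => [||u v].
- exact: lcon_linear.
- by move=> l x y; rewrite lcon_linear // scalerDr !scalerA mulrC.
- by rewrite !lconE // scalerA.
Qed.

End Contractions.

(** Both sides are [φ ⊗ ψ] evaluated at [z]. For right comodules this gives access to [coef_conv],
    which is stated with [Lact]. *)
Lemma con_swap (K : fieldType) (U V : lmodType K) (φ : U -> K^o) (ψ : V -> K^o) z :
  linear φ -> linear ψ -> ψ (lcon φ z) = φ (rcon ψ z).
Proof.
move=> φl ψl; apply: (tens_ext (f := fun z => ψ (lcon φ z))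
  (g := fun z => φ (rcon ψ z))) => [||u v].
- exact: lin_comp ψl (lcon_linear φl).
- exact: lin_comp φl (rcon_linear ψl).
- rewrite lconE // rconE // (Defs.linearPZ φl) (Defs.linearPZ ψl).
  exact: mulrC.
Qed.

Lemma lcon_map (K : fieldType) (U V U' V' : lmodType K) (φ : U' -> K^o)
    (f : U -> U') (g : V -> V') z : linear φ -> linear f -> linear g ->
  lcon φ (tens_map f g z) = g (lcon (fun u => φ (f u)) z).
Proof.
move=> φl fl gl; have φf := lin_comp φl fl.
apply: (tens_ext (f := fun z => lcon φ (tens_map f g z))
  (g := fun z => g (lcon (fun u => φ (f u)) z))) => [||u v].
- by apply: lin_comp; [exact: lcon_linear | exact: tmap_linear].
- by apply: lin_comp => //; exact: lcon_linear.
- by rewrite tmapE // !lconE // (Defs.linearPZ gl).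
Qed.

Lemma rcon_map (K : fieldType) (U V U' V' : lmodType K) (φ : U' -> K^o)
    (f : U -> U') (g : V -> V') z : linear φ -> linear f -> linear g ->
  rcon φ (tens_map g f z) = g (rcon (fun u => φ (f u)) z).
Proof.
move=> φl fl gl; have φf := lin_comp φl fl.
apply: (tens_ext (f := fun z => rcon φ (tens_map g f z))
  (g := fun z => g (rcon (fun u => φ (f u)) z))) => [||u v].
- by apply: lin_comp; [exact: rcon_linear | exact: tmap_linear].
- by apply: lin_comp => //; exact: rcon_linear.
- by rewrite tmapE // !rconE // (Defs.linearPZ gl).
Qed.

Section Functionals.
Variables (C : numClosedFieldType) (t : C).
Hypothesis t0 : t != 0.

Local Notation A := (Asig t).
Local Notation gen := (gen t).
Local Notation a := (gen Ga).
Local Notation b := (gen Gb).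
Local Notation c := (gen Gc).
Local Notation d := (gen Gd).
Local Notation σ := (gen Gs).
Local Notation epsA := (@eps C t : A -> C^o).
Implicit Types φ : A -> C^o.

(** On matrix elements [Lact] changes the row index and [Ract] the column index. *)
Definition Lact φ (x : A) : A := lcon φ (Delta x).
Definition Ract φ (x : A) : A := rcon φ (Delta x).

Lemma Lact_linear φ : linear φ -> linear (Lact φ).
Proof.
by move=> φl; apply: lin_comp; [exact: lcon_linear|exact: Delta_linear].
Qed.

Lemma Ract_linear φ : linear φ -> linear (Ract φ).
Proof.
by move=> φl; apply: lin_comp; [exact: rcon_linear|exact: Delta_linear].
Qed.

Lemma Lact_gen φ g x : linear φ -> Lact φ (gen g * x) =
  \sum_(h <- cop g)
    gen h.2 * lcon (fun u => φ (gmul h.1 (odd_gen h.2) u)) (Delta x).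
Proof.
move=> φl; have gl := @gmul_linear C t.
rewrite /Lact Delta_gen_mul // (lin_sum (lcon_linear φl)).
by apply: eq_bigr => h _; rewrite lcon_map.
Qed.

Lemma Ract_gen φ g x : linear φ -> Ract φ (gen g * x) =
  \sum_(h <- cop g) gmul h.1 (odd_gen h.2)
    (rcon (fun u => φ (gmul h.2 false u)) (Delta x)).
Proof.
move=> φl; have gl := @gmul_linear C t.
rewrite /Ract Delta_gen_mul // (lin_sum (rcon_linear φl)).
by apply: eq_bigr => h _; rewrite rcon_map.
Qed.

Lemma lcon_eq (φ ψ : A -> C^o) k z : linear ψ ->
  (forall u, φ u = k * ψ u) -> lcon φ z = k *: lcon ψ z :> A.
Proof. by move=> ψl E; rewrite -lcon_scale //; congr lcon; apply: funext. Qed.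

Lemma rcon_eq (φ ψ : A -> C^o) k z : linear ψ ->
  (forall u, φ u = k * ψ u) -> rcon φ z = k *: rcon ψ z :> A.
Proof.
move=> ψl E; have -> : φ = (fun u => k *: ψ u) by apply: funext.
have kl : linear (fun u => k *: ψ u).
  by move=> l x y; rewrite ψl scalerDr !scalerA [k * l]mulrC.
apply: (tens_ext (f := rcon _) (g := fun z => k *: rcon ψ z)) => [||u v].
- exact: rcon_linear.
- by move=> l x y; rewrite rcon_linear // scalerDr !scalerA mulrC.
- by rewrite !rconE // scalerA.
Qed.

Section Character.
Variables l s : C.
Hypotheses (l0 : l != 0) (ss : s * s = 1).

(** The value at [d] is dictated by [ad + tbc = σ]. *)
Definition chi_gen (g : Agen) : C^o :=
  match g with Ga => l | Gd => s / l | Gs => s | _ => 0 end.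

Definition chi (x : A) : C^o := palg_lift chi_gen x.

Lemma chi_rel x y : Arel t x y -> peval chi_gen x = peval chi_gen y.
Proof.
apply: Arel_peval; rewrite /chi_gen ?mulr0 ?mul0r ?scaler0 ?oppr0 ?addr0 //.
- by rewrite mulrC subrr.
- exact: mulrC.
- exact: mulrC.
- by rewrite mulrC divfK.
Qed.

Lemma chi_linear : linear chi.
Proof. exact: (palg_lift_linear chi_rel). Qed.

Lemma chi1 : chi 1 = 1.
Proof. exact: (palg_lift_multiplicative chi_rel).1. Qed.

Lemma chi_genM g x : chi (gen g * x) = chi_gen g * chi x.
Proof.
have [_ M] := palg_lift_multiplicative chi_rel.
by rewrite /chi M; congr (_ * _); rewrite -[RHS](palg_lift_gen chi_rel).
Qed.

(** A character kills the odd generators, so Koszul signs are invisible to it. *)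
Lemma chi_par p x : chi (par_if p x) = chi x.
Proof.
elim/Asig_ind_gen: x => [|k x y IHx IHy|g x IH].
- by case: p; rewrite //= rmorph1.
- by rewrite par_if_linear !chi_linear IHx IHy.
rewrite par_ifM par_if_gen -scalerAl (Defs.linearPZ chi_linear) !chi_genM IH.
by case: p {IH}; case: g; rewrite /= ?scale1r // !mul0r scaler0.
Qed.

End Character.

Lemma epsE (x : A) : eps x = chi 1 1 x.
Proof.
rewrite /eps /chi; suff -> : chi_gen 1 1 = @eps_gen C by [].
by apply: funext; case=> //=; rewrite divr1.
Qed.

Lemma eps_lin : linear epsA.
Proof. by move=> k x y; rewrite linearP. Qed.

Lemma eps_gmul g p x : eps (gmul g p x : A) = eps (gen g) * eps x.
Proof. by rewrite /gmul rmorphM /= 2!epsE chi_par ?mulr1 ?oner_neq0 // -!epsE. Qed.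

Lemma Lact_eps x : Lact epsA x = x.
Proof.
have el := eps_lin.
elim/Asig_ind_gen: x => [|k x y IHx IHy|g x IH].
- by rewrite /Lact Delta1 // lconE // rmorph1 scale1r.
- by rewrite Lact_linear // IHx IHy.
rewrite Lact_gen //.
rewrite (eq_bigr (fun h => eps (gen h.1) *: (gen h.2 * x))) => [|h _].
  by case: g; rewrite /= ?big_cons big_nil /= !eps_genE /= ?scale1r ?scale0r ?addr0 ?add0r.
rewrite (@lcon_eq _ epsA (eps (gen h.1))) // => [|u].
  by rewrite -scalerAr -[lcon _ _]/(Lact _ _) IH.
exact: eps_gmul.
Qed.

Lemma Ract_eps x : Ract epsA x = x.
Proof.
have el := eps_lin.
elim/Asig_ind_gen: x => [|k x y IHx IHy|g x IH].
- by rewrite /Ract Delta1 // rconE // rmorph1 scale1r.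
- by rewrite Ract_linear // IHx IHy.
rewrite Ract_gen // (eq_bigr (fun h => eps (gen h.2) *: gmul h.1 (odd_gen h.2) x)).
  by case: g; rewrite /= ?big_cons big_nil /= !eps_genE /= ?scale1r ?scale0r ?addr0 ?add0r.
move=> h _; rewrite -(Defs.linearPZ (gmul_linear _ _)); congr gmul.
rewrite (@rcon_eq _ epsA (eps (gen h.2))) // => [|u].
  by rewrite -[rcon _ _]/(Ract _ _) IH.
exact: eps_gmul.
Qed.

(* The functional [u |-> Φ(u)_01] of the representation Φ of A(σ) by upper
   triangular matrices with diagonal part diag(χ, ε), χ = [chi t (-1)]. *)
Section SkewPrimitive.
Variables x0 y0 : C.

Definition skew_gen (g : Agen) : 'M[C]_2 :=
  \matrix_(i, j) match g with
    | Ga => if i == j then if i == 0 then t else 1 else 0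
    | Gb => if (i == 0) && (j == 1) then x0 else 0
    | Gc => if (i == 0) && (j == 1) then y0 else 0
    | Gd => if i == j then if i == 0 then - t^-1 else 1 else 0
    | Gs => if i == j then if i == 0 then -1 else 1 else 0
    end.

Definition skew_rep (x : A) : 'M[C]_2 := palg_lift skew_gen x.
Definition skewf (x : A) : C^o := skew_rep x 0 1.

Lemma skew_rel x y : Arel t x y -> peval skew_gen x = peval skew_gen y.
Proof.
apply: Arel_peval; apply/matrixP => i j.
all: rewrite !mxE ?big_ord_recl ?big_ord0 !mxE.
all: case: i => [[|[|//]] ?]; case: j => [[|[|//]] ?];
  rewrite /= ?(mulr0, mul0r, addr0, add0r, mulr1, mul1r).
all: try by [].
all: by field.
Qed.

Lemma skew_rep_linear : linear skew_rep.
Proof. exact: (palg_lift_linear skew_rel). Qed.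

Lemma skew_linear : linear skewf.
Proof. by move=> k x y; rewrite /skewf skew_rep_linear !mxE. Qed.

Lemma skew_repM g x : skew_rep (gen g * x) = skew_gen g *m skew_rep x.
Proof.
have [_ M] := palg_lift_multiplicative skew_rel.
by rewrite /skew_rep M; congr (_ *m _); exact: (palg_lift_gen skew_rel).
Qed.

Lemma skew_rep11 x : skew_rep x 1 1 = eps x.
Proof.
elim/Asig_ind_gen: x => [|k x y IHx IHy|g x IH].
- rewrite /skew_rep (palg_lift_multiplicative skew_rel).1 .
  by rewrite mxE epsE chi1 ?mulr1 ?oner_neq0.
- by rewrite skew_rep_linear !mxE IHx IHy linearP.
rewrite skew_repM mxE !big_ord_recl big_ord0 rmorphM /= eps_genE.
have -> : lift ord0 ord0 = 1 :> 'I_2 by apply: val_inj.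
by rewrite IH !mxE /=; case: g; rewrite /= ?mul0r ?add0r ?addr0.
Qed.

Definition skew_diag (g : Agen) : C :=
  match g with Ga => t | Gd => - t^-1 | Gs => -1 | _ => 0 end.
Definition skew_off (g : Agen) : C :=
  match g with Gb => x0 | Gc => y0 | _ => 0 end.

Lemma skew_genM g x :
  skewf (gen g * x) = skew_diag g * skewf x + skew_off g * eps x.
Proof.
rewrite /skewf skew_repM mxE !big_ord_recl big_ord0.
have -> : lift ord0 ord0 = 1 :> 'I_2 by apply: val_inj.
by rewrite skew_rep11 !mxE /= addr0; case: g.
Qed.

Lemma skew1 : skewf 1 = 0.
Proof. by rewrite /skewf /skew_rep (palg_lift_multiplicative skew_rel).1 mxE. Qed.

Lemma eps_par p (x : A) : eps (par_if p x) = eps x.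
Proof. by rewrite 2!epsE chi_par ?mulr1 ?oner_neq0. Qed.

(** The corner entry is an odd functional: only words with an odd number of letters [b], [c] can
    reach the corner. *)
Lemma skew_par p x : skewf (par_if p x) = (-1) ^+ p * skewf x.
Proof.
elim/Asig_ind_gen: x => [|k x y IHx IHy|g x IH].
- by case: p; rewrite /= ?rmorph1 skew1 mulr0.
- rewrite par_if_linear !skew_linear IHx IHy mulrDr; congr (_ + _).
  exact: mulrCA.
rewrite par_ifM par_if_gen -scalerAl (Defs.linearPZ skew_linear) !skew_genM IH.
rewrite eps_par.
case: p {IH}; case: g;
 rewrite /= ?expr0 ?expr1 ?scale1r ?mul1r ?scaleN1r ?mul0r ?add0r ?addr0 //;
 by rewrite ?mulN1r ?mulrN.
Qed.

(** The twisted Leibniz rule: [t] is the diagonal value at [a], and the second term comes from the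
    summand [b ⊗ c] of [Δ(a)], since [skewf (b * u)] is [x0] times [eps u]. *)
Lemma Lact_skew_a x :
  Lact skewf (a * x) = t *: (a * Lact skewf x) + x0 *: (c * x).
Proof.
have sl := skew_linear; have el := eps_lin.
rewrite Lact_gen // /= !big_cons big_nil addr0 /=.
congr (_ + _); rewrite scalerAr; congr (_ * _).
  rewrite -[Lact _ _]/(lcon _ _); apply: lcon_eq => // u.
  by rewrite /gmul skew_genM mul0r addr0.
rewrite -{2}(Lact_eps x); apply: lcon_eq => // u.
by rewrite /gmul skew_genM mul0r add0r eps_par.
Qed.

Lemma Lact_skew_c x :
  Lact skewf (c * x) = t^-1 *: (c * Lact skewf x) + y0 *: (a * x).
Proof.
have sl := skew_linear; have el := eps_lin.
rewrite Lact_gen // /= !big_cons big_nil addr0 /=.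
rewrite addrC; congr (_ + _); rewrite scalerAr; congr (_ * _).
  rewrite -[Lact _ _]/(lcon _ _); apply: lcon_eq => // u.
  (* Two signs cancel: that of the diagonal value [-t^-1] at [d], and the Koszul sign of [d ⊗ c],
     seen by an odd functional. *)
  by rewrite /gmul skew_genM skew_par mul0r addr0 mulN1r mulrNN.
rewrite -{2}(Lact_eps x); apply: lcon_eq => // u.
by rewrite /gmul skew_genM mul0r add0r.
Qed.

End SkewPrimitive.

End Functionals.

Lemma big_square_pick (V : nmodType) n p q (f : nat -> nat -> V) :
    (p <= n)%N -> (q <= n)%N ->
  \sum_(i < n.+1) \sum_(j < n.+1)
    (if (i == p :> nat) && (j == q :> nat) then f i j else 0) = f p q.
Proof.
move=> pn qn; rewrite (bigD1 (Ordinal (pn : (p < n.+1)%N))) //=.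
rewrite (bigD1 (Ordinal (qn : (q < n.+1)%N))) //= !eqxx /= !big1 ?addr0 //.
  move=> i ip; rewrite big1 // => j _; case: eqP => // ip'.
  by case/eqP: ip; exact: val_inj.
by move=> j jq; case: eqP => // jq'; case/eqP: jq; exact: val_inj.
Qed.

Definition qnum (K : fieldType) (v : K) (k : nat) : K := \sum_(j < k) v ^+ j.

Lemma qnumS (K : fieldType) (v : K) k : qnum v k.+1 = 1 + v * qnum v k.
Proof.
rewrite /qnum big_ord_recl expr0 mulr_sumr; congr (_ + _).
by apply: eq_bigr => j _; rewrite -exprS.
Qed.

Lemma qnum_neq0 (K : fieldType) (v : K) k : v ^+ k != 1 -> qnum v k != 0.
Proof. by rewrite -subr_eq0 subrX1 mulf_eq0 negb_or => /andP[]. Qed.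

(** In characteristic zero the points 1, 2, 3, ... are more roots than the degree allows. The point
    0 is avoided because [chi l s] requires [l != 0]. *)
Lemma poly_eq0_nonzero (F : numDomainType) (p : {poly F}) :
  (forall x, x != 0 -> p.[x] = 0) -> p = 0.
Proof.
move=> h; apply/eqP/negPn/negP => p0.
pose rs : seq F := [seq i.+1%:R | i <- iota 0 (size p)].
have : (size rs < size p)%N.
  apply: max_poly_roots => //.
    by apply/allP => _ /mapP[i _ ->]; apply/eqP/h; rewrite pnatr_eq0.
  rewrite map_inj_uniq ?iota_uniq // => i j /eqP.
  by rewrite eqr_nat eqSS => /eqP.
by rewrite size_map size_iota ltnn.
Qed.

(** * Matrix elements *)

Section MatrixElements.
Variables (C : numClosedFieldType) (t : C).
Hypothesis t0 : t != 0.
Hypothesis tr : forall n, (0 < n)%N -> (t ^+ 2) ^+ n != 1.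
Variables (rt : nat -> nat -> C) (m : forall n : nat, 'I_n.+1 -> 'I_n.+1 -> Asig t).
Hypothesis rt0 : forall n k, (k <= n)%N -> rt n k != 0.
Hypothesis hm : matrix_elements rt m.

Local Notation A := (Asig t).
Local Notation gen := (gen t).
Local Notation a := (gen Ga).
Local Notation b := (gen Gb).
Local Notation c := (gen Gc).
Local Notation d := (gen Gd).
Local Notation σ := (gen Gs).
Local Notation epsA := (@eps C t : A -> C^o).

Local Notation lowf := (@skewf C t 0 1 : A -> C^o).
Local Notation upf := (@skewf C t 1 0 : A -> C^o).

Lemma low_linear : linear lowf. Proof. exact: skew_linear. Qed.
Lemma up_linear : linear upf. Proof. exact: skew_linear. Qed.

(** Each further [c] brings one factor [t^-1] from the Leibniz rule and another from moving past
    [a], whence the base [t^-2]. At [k = 0] the q-number vanishes, which makes the truncated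
    exponent [k.-1] harmless. *)
Lemma Lact_low_cX k :
  Lact lowf (c ^+ k) = qnum (t ^- 2) k *: (a * c ^+ k.-1).
Proof.
have ca : c * a = t^-1 *: (a * c) by rewrite -[a]expr1 c_aX.
elim: k => [|k IH].
  rewrite /Lact expr0 Delta1 // /qnum big_ord0 scale0r.
  by rewrite lconE ?skew1 ?scale0r //; exact: low_linear.
rewrite exprS Lact_skew_c // IH scale1r -scalerAr !scalerA mulrA ca -scalerAl.
rewrite scalerA qnumS scalerDl scale1r addrC; congr (_ + _).
case: k {IH} => [|k]; first by rewrite /qnum big_ord0 !(mulr0, mul0r, scale0r).
by rewrite -[a * c * _]mulrA -exprS; congr (_ *: _); field.
Qed.

Lemma Lact_low_monomial i k : Lact lowf (a ^+ i * c ^+ k) =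
  (t ^+ i * qnum (t ^- 2) k) *: (a ^+ i.+1 * c ^+ k.-1).
Proof.
elim: i => [|i IH]; first by rewrite !mul1r Lact_low_cX.
rewrite exprS -mulrA Lact_skew_a // IH scale0r addr0 -scalerAr scalerA !mulrA.
by rewrite -exprS -exprS.
Qed.

Lemma Lact_up_monomial i k : Lact upf (a ^+ i * c ^+ k) =
  (t ^- i.-1 * qnum (t ^+ 2) i) *: (a ^+ i.-1 * c ^+ k.+1).
Proof.
elim: i => [|i IH].
  rewrite expr0 mul1r /qnum big_ord0 mulr0 scale0r.
  elim: k => [|k IH].
    by rewrite /Lact Delta1 // lconE ?skew1 ?scale0r //; exact: up_linear.
  by rewrite exprS Lact_skew_c // IH mulr0 scaler0 scale0r addr0.
rewrite exprS -mulrA Lact_skew_a // IH scale1r mulrA c_aX // -scalerAr scalerA.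
rewrite -scalerAl -mulrA -exprS qnumS mulrDr mulr1 scalerDl addrC; congr (_ + _).
case: i {IH} => [|i]; first by rewrite /qnum big_ord0 !mulr0 !scale0r.
rewrite /= [a * (_ * _)]mulrA -exprS; congr (_ *: _); rewrite [t ^+ i.+1]exprS.
by field; rewrite expf_neq0 t0.
Qed.

Definition wt (n k : nat) : C := 'i ^+ k./2 * rt n k.

Lemma wt_neq0 n k : (k <= n)%N -> wt n k != 0.
Proof. by move=> kn; rewrite mulf_neq0 ?rt0 ?expf_neq0 ?neq0Ci. Qed.

Definition X n k : A := wt n k *: (a ^+ (n - k) * c ^+ k).

(** The factors by which the two operators move along the [X n k]; the genericity of [q] makes them
    nonzero inside the range. *)
Definition lowc n k : C := wt n k * t ^+ (n - k) * qnum (t ^- 2) k / wt n k.-1.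
Definition upc n k : C :=
  wt n k * t ^- (n - k).-1 * qnum (t ^+ 2) (n - k) / wt n k.+1.

Lemma lowc_neq0 n k : (0 < k <= n)%N -> lowc n k != 0.
Proof.
case/andP=> k0 kn; have kn' := leq_trans (leq_pred k) kn.
have qk : qnum (t ^- 2) k != 0.
  by apply: qnum_neq0; rewrite exprVn invr_eq1; exact: tr.
apply: mulf_neq0; last by rewrite invr_neq0 ?wt_neq0.
apply: mulf_neq0; last exact: qk.
by apply: mulf_neq0; [exact: wt_neq0|exact: expf_neq0].
Qed.

Lemma upc_neq0 n k : (k < n)%N -> upc n k != 0.
Proof.
move=> kn; have qk : qnum (t ^+ 2) (n - k) != 0.
  by apply: qnum_neq0; apply: tr; rewrite subn_gt0.
apply: mulf_neq0; last by rewrite invr_neq0 ?wt_neq0.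
apply: mulf_neq0; last exact: qk.
apply: mulf_neq0; last by rewrite invr_neq0 ?expf_neq0.
exact: wt_neq0 (ltnW kn).
Qed.

Lemma Lact_low_X n k : (k <= n)%N -> Lact lowf (X n k) = lowc n k *: X n k.-1.
Proof.
move=> kn; rewrite (Defs.linearPZ (Lact_linear t0 low_linear)) Lact_low_monomial.
rewrite !scalerA /lowc divfK ?wt_neq0 ?(leq_trans (leq_pred _)) //.
case: k kn => [|k] kn; first by rewrite /qnum big_ord0 !mulr0 !scale0r.
by rewrite mulrA /= -subSn.
Qed.

Lemma Lact_up_X n k : (k <= n)%N ->
  Lact upf (X n k) = if (k < n)%N then upc n k *: X n k.+1 else 0.
Proof.
move=> kn; rewrite (Defs.linearPZ (Lact_linear t0 up_linear)) Lact_up_monomial.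
case: ltnP => [kn'|nk]; last first.
  have -> : (n - k = 0)%N by apply/eqP; rewrite subn_eq0.
  by rewrite /qnum big_ord0 mulr0 scale0r scaler0.
by rewrite !scalerA /upc divfK ?wt_neq0 // mulrA subnS.
Qed.

Lemma eps_X n k : (k <= n)%N -> eps (X n k) = (k == 0)%:R * wt n 0.
Proof.
move=> kn; rewrite linearZ /= rmorphM /= !rmorphXn /= !eps_genE /= expr1n mul1r.
by case: k kn => [|k] _; rewrite ?expr0 ?mulr1 ?mul1r // exprS mul0r mulr0 mul0r.
Qed.

(** The counit sees [X n 0] alone; composing it [k] times with the lowering operator, suitably
    rescaled, gives the functional that sees [X n k] alone. *)
Lemma X_dual n k : (k <= n)%N -> exists δ : A -> C^o,
  linear δ /\ forall j, (j <= n)%N -> δ (X n j) = (j == k)%:R.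
Proof.
elim: k => [|k IH] kn.
  exists (fun x => (wt n 0)^-1 *: epsA x); split=> [l x y|j jn].
    by rewrite eps_lin scalerDr !scalerA [l * _]mulrC.
  by rewrite eps_X // [LHS]mulrC mulfK // wt_neq0.
have [δ [δl δE]] := IH (ltnW kn).
exists (fun x => (lowc n k.+1)^-1 *: δ (Lact lowf x)); split=> [l x y|j jn].
  by rewrite Lact_linear ?δl ?scalerDr ?scalerA 1?[l * _]mulrC //; exact: low_linear.
rewrite Lact_low_X // (Defs.linearPZ δl).
case: j jn => [|j] jn.
  by rewrite /lowc /qnum big_ord0 mulr0 mul0r scale0r scaler0.
rewrite /= δE ?(ltnW jn) // eqSS; case: eqP => [->|_]; last by rewrite !scaler0.
by rewrite scalerA mulVf ?scale1r // lowc_neq0.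
Qed.

(** Natural indices let [i.-1] and [i - p] be written without bound proofs. Out of range [inord]
    falls back to 0, hence the bounds in the lemmas below. *)
Definition mm n i j : A := m (inord i : 'I_n.+1) (inord j).

Lemma Delta_X n i : (i <= n)%N -> Delta (X n i) = \sum_(j < n.+1) mm n i j ⊗ X n j.
Proof.
move=> ni; have := hm (Ordinal (ni : (i < n.+1)%N)); rewrite /xi /= => ->.
apply: eq_bigr => j _; rewrite /mm inord_val; congr (m _ _ ⊗ _).
by apply: val_inj; rewrite /= inordK.
Qed.

(** Contracting both legs of [Delta (X n i)] turns the value of a functional on a matrix element
    into a computation with the monomials [a^(n-k) c^k]. *)
Lemma mm_val n i j : (i <= n)%N -> (j <= n)%N -> exists δ : A -> C^o,
  [/\ linear δ, forall k, (k <= n)%N -> δ (X n k) = (k == j)%:R &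
    forall φ : A -> C^o, linear φ -> φ (mm n i j) = δ (Lact φ (X n i))].
Proof.
move=> ni nj; have [δ [δl δE]] := X_dual nj; exists δ; split=> // φ φl.
rewrite /Lact Delta_X // (lin_sum (lcon_linear φl)) (lin_sum δl).
rewrite (bigD1 (Ordinal (nj : (j < n.+1)%N))) //= big1 => [|k kj].
  by rewrite lconE // (Defs.linearPZ δl) δE // eqxx addr0 [RHS]mulr1.
rewrite lconE // (Defs.linearPZ δl) δE -1?ltnS //.
have -> : (k == j :> nat) = false by apply: contra_neqF kj => /eqP kj; exact: val_inj.
exact: mulr0.
Qed.

Lemma Ract_dual_X n i j (δ : A -> C^o) : linear δ ->
    (forall k, (k <= n)%N -> δ (X n k) = (k == j)%:R) ->
  (i <= n)%N -> (j <= n)%N -> Ract δ (X n i) = mm n i j.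
Proof.
move=> δl δE ni nj; rewrite /Ract Delta_X // (lin_sum (rcon_linear δl)).
rewrite (bigD1 (Ordinal (nj : (j < n.+1)%N))) //= big1 => [|k kj].
  by rewrite rconE // δE // eqxx scale1r addr0.
rewrite rconE // δE -1?ltnS //; case: eqP => [ej|_]; last by rewrite scale0r.
by case/eqP: kj; exact: val_inj.
Qed.

(** Coassociativity at [X n i], with the last leg contracted by the functional dual to [X n j]. *)
Lemma Delta_mm n i j : (i <= n)%N -> (j <= n)%N ->
  Delta (mm n i j) = \sum_(k < n.+1) mm n i k ⊗ mm n k j.
Proof.
move=> ni nj; have [δ [δl δE]] := X_dual nj.
have Dl := Delta_linear t0; have il : linear (idfun : A -> A) by [].
have rl := rcon_linear (V := A) δl; have al := @tassoc_linear.
have := coassoc t0 (X n i); rewrite /coassociative_at Delta_X //.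
move/(congr1 (tens_map (idfun : A -> A) (rcon δ))).
rewrite !(lin_sum (tmap_linear Dl il), lin_sum (tmap_linear il Dl)).
rewrite (lin_sum (al _ _ _ _)) !(lin_sum (tmap_linear il rl)).
have E (z : tensA t) x :
    tens_map (idfun : A -> A) (rcon δ) (tens_assoc (z ⊗ x)) = δ x *: z.
  apply: (tens_ext (f := fun z => tens_map (idfun : A -> A) (rcon δ) (tens_assoc (z ⊗ x)))
    (g := fun z => δ x *: z)) => [||u v].
  - apply: lin_comp; first exact: tmap_linear.
    apply: lin_comp; first exact: al.
    by move=> k y y'; rewrite tpureDl tpureZl.
  - by move=> k y y'; rewrite scalerDr !scalerA mulrC.
  - by rewrite tens_assocE tmapE // rconE // tpureZr.
rewrite (bigD1 (Ordinal (nj : (j < n.+1)%N))) //= big1 => [|k kj]; last first.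
  rewrite tmapE // E δE -1?ltnS //.
  have -> : (k == j :> nat) = false by apply: contra_neqF kj => /eqP kj; exact: val_inj.
  by rewrite scale0r.
rewrite tmapE // E δE // eqxx scale1r addr0 => ->.
apply: eq_bigr => k _; rewrite tmapE // Delta_X -1?ltnS // tpure_sumr.
rewrite (lin_sum (tmap_linear il rl)).
rewrite (bigD1 (Ordinal (nj : (j < n.+1)%N))) //= big1 => [|l lj]; last first.
  rewrite tmapE // rconE // δE -1?ltnS //.
  have -> : (l == j :> nat) = false by apply: contra_neqF lj => /eqP lj; exact: val_inj.
  by rewrite scale0r tpure0r.
by rewrite tmapE // rconE // δE // eqxx scale1r addr0.
Qed.

Lemma eps_mm n i j : (i <= n)%N -> (j <= n)%N -> eps (mm n i j) = (i == j)%:R.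
Proof.
move=> ni nj; have [δ [δl δE E]] := mm_val ni nj.
by rewrite -[eps _]/(epsA _) E; [rewrite Lact_eps // δE|exact: eps_lin].
Qed.

Lemma low_mm n i j : (i <= n)%N -> (j <= n)%N ->
  lowf (mm n i j) = (i == j.+1)%:R * lowc n i.
Proof.
move=> ni nj; have [δ [δl δE E]] := mm_val ni nj.
rewrite E; last exact: low_linear.
rewrite Lact_low_X // (Defs.linearPZ δl) δE ?(leq_trans (leq_pred _)) //.
case: i ni {E} => [|i] _; last by rewrite [LHS]mulrC.
by rewrite /lowc /qnum big_ord0 mulr0 !mul0r scale0r.
Qed.

Lemma up_mm n i j : (i <= n)%N -> (j <= n)%N ->
  upf (mm n i j) = (j == i.+1)%:R * upc n i.
Proof.
move=> ni nj; have [δ [δl δE E]] := mm_val ni nj.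
rewrite E; last exact: up_linear.
rewrite Lact_up_X //; case: ltnP => [ni'|ni'].
  by rewrite (Defs.linearPZ δl) δE // eq_sym [LHS]mulrC.
by rewrite (lin0 δl) ltn_eqF ?mul0r // ltnS (leq_trans nj).
Qed.

Lemma Lact_chi_aX l s n : l != 0 -> s * s = 1 ->
  Lact (chi l s : A -> C^o) (a ^+ n) = l ^+ n *: a ^+ n.
Proof.
move=> l0 ss; have cl := chi_linear (t := t) l0 ss.
elim: n => [|n IH].
  by rewrite /Lact !expr0 Delta1 // lconE // chi1.
rewrite exprS Lact_gen // /= !big_cons big_nil addr0 /=.
rewrite (_ : _ + _ = a * (l *: Lact (chi l s : A -> C^o) (a ^+ n)) +
                     c * (0 *: Lact (chi l s : A -> C^o) (a ^+ n))).
  by rewrite IH scale0r mulr0 addr0 scalerA -scalerAr -exprS.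
by congr (_ * _ + _ * _); apply: lcon_eq => // u; rewrite /gmul chi_genM // ?mul0r.
Qed.

(** [X n 0] is a multiple of [a^n], an eigenvector of the action of a character with eigenvalue
    [l^n]. *)
Lemma chi_mm l s n j : l != 0 -> s * s = 1 -> (j <= n)%N ->
  chi l s (mm n 0 j) = (j == 0)%:R * l ^+ n.
Proof.
move=> l0 ss nj; have [δ [δl δE E]] := mm_val (leq0n n) nj.
have cl := chi_linear (t := t) l0 ss.
rewrite E // /X subn0 mulr1 (Defs.linearPZ (Lact_linear t0 cl)) Lact_chi_aX //.
rewrite scalerA mulrC -scalerA (Defs.linearPZ δl).
have := δE 0%N (leq0n n); rewrite /X subn0 mulr1 => ->.
by rewrite eq_sym [LHS]mulrC.
Qed.

End MatrixElements.

(** Grouping the terms by [α.2] gives two polynomials in [l]; the choices 1 and -1 of [s] make their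
    sum and their difference vanish at every nonzero [l]. *)
Lemma character_independence (C : numClosedFieldType) (r : seq (nat * bool))
    (g : nat * bool -> C) : uniq r ->
    (forall l s : C, l != 0 -> s * s = 1 ->
       \sum_(α <- r) g α * (l ^+ α.1 * s ^+ α.2) = 0) ->
  forall α, α \in r -> g α = 0.
Proof.
move=> ur h [n0 s0] ar.
pose P s : {poly C} := \sum_(α <- r | α.2 == s) g α *: 'X^(α.1).
have PE l s : l != 0 -> s * s = 1 -> (P false).[l] + s * (P true).[l] = 0.
  move=> l0 ss; rewrite -(h l s l0 ss) (bigID (fun α : nat * bool => α.2 == false)) /=.
  rewrite !horner_sum mulr_sumr; congr (_ + _).
    by apply: eq_bigr => -[n s'] /= /eqP ->; rewrite hornerZ hornerXn mulr1.
  rewrite [RHS](eq_bigl (fun α : nat * bool => α.2 == true)); last by case=> ? [].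
  apply: eq_bigr => -[n s'] /= /eqP ->.
  by rewrite hornerZ hornerXn expr1 mulrCA [s * _]mulrC.
have P0 s : P s = 0.
  apply: poly_eq0_nonzero => x x0.
  have nn : (-1 : C) * -1 = 1 by rewrite mulrNN mulr1.
  have := PE x 1 x0 (mulr1 1); have := PE x (-1) x0 nn.
  rewrite mul1r mulN1r => /eqP; rewrite subr_eq0 => /eqP ft.
  rewrite ft -mulr2n => /eqP; rewrite mulrn_eq0 /= => /eqP e.
  by case: s; rewrite ?ft.
have := congr1 (fun p : {poly C} => p`_n0) (P0 s0); rewrite coef0 coef_sum => <-.
rewrite (big_rem _ ar) /= eqxx coefZ coefXn eqxx mulr1 big_seq_cond big1 ?addr0 //.
case=> n s /= /andP[]; rewrite mem_rem_uniq // !inE => /andP[ne _] /eqP es.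
rewrite coefZ coefXn; case: eqP => [en|]; last by rewrite mulr0.
by move: ne; rewrite es en eqxx.
Qed.

(** * Linear independence of the matrix elements *)

Section Independence.
Variables (C : numClosedFieldType) (t : C).
Hypothesis t0 : t != 0.
Hypothesis tr : forall n, (0 < n)%N -> (t ^+ 2) ^+ n != 1.
Variables (rt : nat -> nat -> C) (m : forall n : nat, 'I_n.+1 -> 'I_n.+1 -> Asig t).
Hypothesis rt0 : forall n k, (k <= n)%N -> rt n k != 0.
Hypothesis hm : matrix_elements rt m.

Local Notation A := (Asig t).
Local Notation gen := (gen t).
Local Notation a := (gen Ga).
Local Notation b := (gen Gb).
Local Notation c := (gen Gc).
Local Notation d := (gen Gd).
Local Notation σ := (gen Gs).
Local Notation epsA := (@eps C t : A -> C^o).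
Local Notation lowf := (@skewf C t 0 1 : A -> C^o).
Local Notation upf := (@skewf C t 1 0 : A -> C^o).
Local Notation mm := (mm m).

Definition Ms (α : nat * bool) i j : A := mm α.1 i j * σ ^+ α.2.

Definition rsig (s : bool) (x : A) : A := x * σ ^+ s.

Lemma rsig_linear s : linear (rsig s).
Proof. by move=> k x y; rewrite /rsig mulrDl -scalerAl. Qed.

Lemma Delta_rsig s x : Delta (rsig s x) = tens_map (rsig s) (rsig s) (Delta x).
Proof.
have rl := rsig_linear s; rewrite /rsig.
have [_ DM] := Delta_morphism t0.
case: s rl => rl; last first.
  rewrite mulr1; apply/esym; apply: (tens_ext (g := idfun)) => [||u v] //.
    exact: tmap_linear.
  by rewrite tmapE // /rsig !mulr1.
rewrite expr1 DM Delta_genE //=.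
apply: (tens_ext (tensA_mul_linearl _)) => [|u v]; first exact: tmap_linear.
rewrite tmapE // -[tensA_mul _ _]/((_ : tensA t) * _) -{1}(hpart_sum v).
rewrite tpureDr mulrDl; have hs := gen_odd t Gs.
rewrite !(tensAM_homog _ _ (hpart_homog _ _) hs) !andbF !scale1r -tpureDr.
by rewrite -mulrDl hpart_sum.
Qed.

(** Right multiplication by [σ] scales the corner entry by the lower diagonal entry of its image,
    which is [ε(σ) = 1]. *)
Lemma skew_rsig x0 y0 s x : skewf x0 y0 (rsig s x) = skewf x0 y0 x.
Proof.
case: s; rewrite /rsig ?mulr1 // expr1.
have [_ M] := palg_lift_multiplicative (skew_rel t0 x0 y0).
rewrite /skewf /skew_rep M (_ : palg_lift _ σ = skew_gen t x0 y0 Gs); last first.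
  exact: (palg_lift_gen (skew_rel t0 x0 y0)).
rewrite mxE !big_ord_recl big_ord0.
have -> : lift ord0 ord0 = 1 :> 'I_2 by apply: val_inj.
by rewrite !mxE /= mulr0 add0r mulr1 addr0.
Qed.

Lemma chi_rsig l z s x : l != 0 -> z * z = 1 ->
  chi l z (rsig s x) = chi l z x * z ^+ s.
Proof.
move=> l0 zz; case: s; rewrite /rsig ?mulr1 // !expr1.
have [_ M] := palg_lift_multiplicative (@chi_rel C t l z l0 zz).
rewrite /chi M; congr (_ * _).
exact: (palg_lift_gen (@chi_rel C t l z l0 zz)).
Qed.

Lemma eps_rsig s x : eps (rsig s x) = eps x.
Proof. by rewrite /rsig rmorphM /= rmorphXn /= eps_genE /= expr1n mulr1. Qed.

Lemma Delta_Ms α i j : (i <= α.1)%N -> (j <= α.1)%N ->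
  Delta (Ms α i j) = \sum_(k < α.1.+1) Ms α i k ⊗ Ms α k j.
Proof.
move=> ni nj; have rl := rsig_linear α.2.
rewrite -[Ms α i j]/(rsig _ _) Delta_rsig (Delta_mm t0 tr rt0 hm) //.
by rewrite (lin_sum (tmap_linear rl rl)); apply: eq_bigr => k _; rewrite tmapE.
Qed.

Lemma eps_Ms α i j : (i <= α.1)%N -> (j <= α.1)%N ->
  eps (Ms α i j) = (i == j)%:R.
Proof. by move=> ni nj; rewrite -[Ms α i j]/(rsig _ _) eps_rsig (eps_mm t0 tr rt0 hm). Qed.

(** [upc n j'] belongs to the step from [j'] to [j'.+1], which [Ract] runs backwards; the value 0 at
    [j = 0] makes the iteration stop at the edge. *)
Definition upc' n j := if j is j'.+1 then upc t rt n j' else 0.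

Lemma Lact_low_Ms α i j : (i <= α.1)%N -> (j <= α.1)%N ->
  Lact lowf (Ms α i j) = lowc t rt α.1 i *: Ms α i.-1 j.
Proof.
move=> ni nj; have sl : linear lowf by exact: skew_linear.
rewrite /Lact Delta_Ms // (lin_sum (lcon_linear sl)).
have ni' : (i.-1 < α.1.+1)%N by rewrite ltnS (leq_trans (leq_pred _)).
rewrite (bigD1 (Ordinal ni')) //= big1 => [|k ki]; rewrite lconE // -[Ms α i _]/(rsig _ _).
  rewrite skew_rsig (low_mm t0 tr rt0 hm) // addr0.
  case: i ni {ni'} => [|i] ni; last by rewrite eqxx mul1r.
  by rewrite /lowc /qnum big_ord0 mulr0 mul0r mulr0 !scale0r.
rewrite skew_rsig (low_mm t0 tr rt0 hm) -1?ltnS //.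
case: eqP => [ei|_]; last by rewrite mul0r scale0r.
by case/eqP: ki; apply: val_inj; rewrite /= ei.
Qed.

Lemma Ract_up_Ms α i j : (i <= α.1)%N -> (j <= α.1)%N ->
  Ract upf (Ms α i j) = upc' α.1 j *: Ms α i j.-1.
Proof.
move=> ni nj; have sl : linear upf by exact: skew_linear.
rewrite /Ract Delta_Ms // (lin_sum (rcon_linear sl)).
have nj' : (j.-1 < α.1.+1)%N by rewrite ltnS (leq_trans (leq_pred _)).
rewrite (bigD1 (Ordinal nj')) //= big1 => [|k kj]; rewrite rconE // -[Ms α _ j]/(rsig _ _).
  rewrite skew_rsig (up_mm t0 tr rt0 hm) // addr0.
  case: j nj {nj'} => [|j] nj; last by rewrite eqxx mul1r.
  by rewrite mul0r !scale0r.
rewrite skew_rsig (up_mm t0 tr rt0 hm) -1?ltnS //.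
case: eqP => [ej|_]; last by rewrite mul0r scale0r.
by case/eqP: kj; apply: val_inj; rewrite /= ej.
Qed.

Lemma iter_low_Ms α i j p : (i <= α.1)%N -> (j <= α.1)%N ->
  iter p (Lact lowf) (Ms α i j) =
  (\prod_(k < p) lowc t rt α.1 (i - k)) *: Ms α (i - p) j.
Proof.
move=> ni nj; elim: p => [|p IH]; first by rewrite big_ord0 subn0 scale1r.
have sl : linear lowf by exact: skew_linear.
rewrite iterS IH (Defs.linearPZ (Lact_linear t0 sl)) Lact_low_Ms ?scalerA //.
  by rewrite big_ord_recr /= subnS.
by rewrite (leq_trans (leq_subr _ _)).
Qed.

Lemma iter_up_Ms α i j p : (i <= α.1)%N -> (j <= α.1)%N ->
  iter p (Ract upf) (Ms α i j) =
  (\prod_(k < p) upc' α.1 (j - k)) *: Ms α i (j - p).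
Proof.
move=> ni nj; elim: p => [|p IH]; first by rewrite big_ord0 subn0 scale1r.
have sl : linear upf by exact: skew_linear.
rewrite iterS IH (Defs.linearPZ (Ract_linear t0 sl)) Ract_up_Ms ?scalerA //.
  by rewrite big_ord_recr /= subnS.
by rewrite (leq_trans (leq_subr _ _)).
Qed.

Lemma lin_iter (V : lmodType C) (f : V -> V) p : linear f -> linear (iter p f).
Proof. by move=> fl; elim: p => [|p IH] k x y; rewrite ?iterS ?IH //= fl. Qed.

(** Carries the entry [(p, r)] of every block to the corner [(0, 0)] and evaluates a character
    there. *)
Definition probe p r l z (x : A) : C^o :=
  chi l z (iter r (Ract upf) (iter p (Lact lowf) x)).

Lemma probe_linear p r l z : l != 0 -> z * z = 1 -> linear (probe p r l z).
Proof.
move=> l0 zz; have sl x0 y0 := skew_linear t0 x0 y0.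
apply: lin_comp (chi_linear l0 zz) _; apply: (lin_comp (V := A)).
  exact/lin_iter/Ract_linear.
exact/lin_iter/Lact_linear.
Qed.

Definition probe_coef n p r : C :=
  (\prod_(k < p) lowc t rt n (p - k)) * (\prod_(k < r) upc' n (r - k)).

Lemma probe_coef_neq0 n p r : (p <= n)%N -> (r <= n)%N -> probe_coef n p r != 0.
Proof.
move=> pn rn; apply: mulf_neq0; apply/prodf_neq0 => k _.
  apply: lowc_neq0 => //.
  by rewrite subn_gt0 ltn_ord (leq_trans (leq_subr _ _)).
have : (0 < r - k <= n)%N by rewrite subn_gt0 ltn_ord (leq_trans (leq_subr _ _)).
by case: (r - k)%N => // j jn; exact: upc_neq0.
Qed.

(** A row [i < p] or, in row [p], a column [j < r] meets the vanishing factor at index 0; a column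
    [j > r] ends in row 0 off the corner, where characters vanish. Rows [i > p] may survive, so
    independence is proved from the largest row downwards. *)
Lemma probe_Ms p r l z α i j : l != 0 -> z * z = 1 ->
    (i <= p)%N -> (i <= α.1)%N -> (j <= α.1)%N ->
  probe p r l z (Ms α i j) =
  if (i == p) && (j == r) then probe_coef α.1 p r * (l ^+ α.1 * z ^+ α.2) else 0.
Proof.
move=> l0 zz ip ni nj; have sl x0 y0 := skew_linear t0 x0 y0.
have cl := chi_linear (t := t) l0 zz.
rewrite /probe iter_low_Ms //.
rewrite (Defs.linearPZ (lin_iter r (Ract_linear t0 (sl 1 0)))) (Defs.linearPZ cl).
have [ei|ne] := eqVneq i p; last first.
  have ltip : (i < p)%N by rewrite ltn_neqAle ne.
  rewrite (bigD1 (Ordinal ltip)) //= subnn (_ : lowc t rt α.1 0 = 0).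
    by rewrite mul0r scale0r.
  by rewrite /lowc /qnum big_ord0 mulr0 mul0r.
rewrite ei subnn iter_up_Ms // (Defs.linearPZ cl) -[Ms _ _ _]/(rsig _ _) chi_rsig //.
rewrite (chi_mm t0 tr rt0 hm) ?(leq_trans (leq_subr _ _)) //= subn_eq0.
case: (ltngtP j r) => [jr|rj|<-].
- rewrite (bigD1 (Ordinal jr)) //= subnn mul0r scale0r.
  exact: scaler0.
- by rewrite !mul0r scaler0 scaler0.
- by rewrite mul1r scalerA.
Qed.

Lemma Ms_independent (r : seq (nat * bool)) (k : nat * bool -> nat -> nat -> C) :
    uniq r ->
    \sum_(α <- r) \sum_(i < α.1.+1) \sum_(j < α.1.+1) k α i j *: Ms α i j = 0 ->
  forall α i j, α \in r -> (i <= α.1)%N -> (j <= α.1)%N -> k α i j = 0.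
Proof.
move=> ur sum0.
have step p : (forall α i j, α \in r -> (i <= α.1)%N -> (j <= α.1)%N ->
    (p < i)%N -> k α i j = 0) ->
  forall α j, α \in r -> (p <= α.1)%N -> (j <= α.1)%N -> k α p j = 0.
  move=> kp α q ar pn qn.
  (* The coefficients of the relation between characters obtained by probing; blocks too small to
     have an entry [(p, q)] contribute 0. *)
  pose g β := if (p <= β.1)%N && (q <= β.1)%N then k β p q * probe_coef β.1 p q else 0.
  suff : g α = 0.
    rewrite /g pn qn /= => /eqP; rewrite mulf_eq0 => /orP[/eqP //|].
    by rewrite (negPf (probe_coef_neq0 pn qn)).
  apply: (character_independence ur) ar => l z l0 zz.
  have pl := probe_linear p q l0 zz.
  have := congr1 (probe p q l z) sum0; rewrite (lin0 pl) (lin_sum pl) => sum0'.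
  suff E β : β \in r -> g β * (l ^+ β.1 * z ^+ β.2) =
      probe p q l z (\sum_(i < β.1.+1) \sum_(j < β.1.+1) k β i j *: Ms β i j).
    by rewrite big_seq (eq_bigr _ E) -big_seq; exact: sum0'.
  move=> br; rewrite (lin_sum pl).
  transitivity (\sum_(i < β.1.+1) \sum_(j < β.1.+1)
    if (i == p :> nat) && (j == q :> nat) then g β * (l ^+ β.1 * z ^+ β.2) else 0).
    rewrite /g; case: ifP => [/andP[pb qb]|pqb].
      by rewrite (big_square_pick (fun _ _ => _) pb qb).
    rewrite mul0r big1 // => i _; rewrite big1 // => j _; exact: if_same.
  apply: eq_bigr => i _; rewrite (lin_sum pl); apply: eq_bigr => j _.
  have [ni nj] : (i <= β.1)%N /\ (j <= β.1)%N by split; rewrite -ltnS ltn_ord.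
  rewrite (Defs.linearPZ pl); have [ip|pi] := leqP i p; last first.
    by rewrite kp // scale0r gtn_eqF.
  rewrite probe_Ms //.
  case: (i =P p :> nat) => [ei|_] /=; last by rewrite scaler0.
  case: (j =P q :> nat) => [ej|_] /=; last by rewrite scaler0.
  by rewrite /g -ei -ej ni nj /= -mulrA.
have bound α : α \in r -> (α.1 <= \max_(β <- r) β.1)%N.
  by move=> ar; rewrite (big_rem _ ar) leq_maxl.
(* Downward induction on the row, written as an induction on [N]: at [N = 0] the row would exceed
   the size of every block. *)
suff H N i α j : (\max_(β <- r) β.1 < i + N)%N -> α \in r -> (i <= α.1)%N ->
    (j <= α.1)%N -> k α i j = 0.
  move=> α i j; apply: (H (\max_(β <- r) β.1).+1).
  by rewrite addnS ltnS leq_addl.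
elim: N i α j => [|N IH] i α j; rewrite ?addn0 => iN ar ni nj.
  by have := leq_trans iN (leq_trans ni (bound _ ar)); rewrite ltnn.
apply: step => // β i' j' br ni' nj' ii'; apply: IH => //.
by rewrite (leq_trans iN) // addnS -addSn leq_add2r.
Qed.

End Independence.

(** * Spanning *)

Section Exchange.
Variables (F : fieldType) (V : lmodType F) (I : eqType).

Definition lspan (r : seq I) (f : I -> V) (x : V) : Prop :=
  exists k : I -> F, x = \sum_(i <- r) k i *: f i.

Lemma lspan_lin r f l x y : lspan r f x -> lspan r f y -> lspan r f (l *: x + y).
Proof.
move=> [k ->] [k' ->]; exists (fun i => l * k i + k' i).
rewrite scaler_sumr -big_split; apply: eq_bigr => i _.
by rewrite scalerA scalerDl.
Qed.

Lemma lspan0 r f : lspan r f 0.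
Proof. by exists (fun=> 0); rewrite big1 // => i _; rewrite scale0r. Qed.

Lemma lspan_mem r f i : uniq r -> i \in r -> lspan r f (f i).
Proof.
move=> ur ir; exists (fun j => (j == i)%:R).
rewrite (bigD1_seq i) //= eqxx scale1r big1 ?addr0 // => j ji.
by rewrite (negPf ji) scale0r.
Qed.

Lemma lspan_sum r f J (s : seq J) (g : J -> V) (k : J -> F) :
  (forall j, lspan r f (g j)) -> lspan r f (\sum_(j <- s) k j *: g j).
Proof.
move=> h; elim: s => [|j s IH]; first by rewrite big_nil; exact: lspan0.
by rewrite big_cons; exact: lspan_lin.
Qed.

(** The matrix writing the [g i] in terms of the [f j] is square because both families have the same
    index list. Independence of the [g i] gives it a trivial left kernel, and its inverse writes the
    [f i] in terms of the [g j]. *)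
Lemma exchange r (f g : I -> V) : uniq r ->
    (forall i, i \in r -> lspan r f (g i)) ->
    (forall k, \sum_(i <- r) k i *: g i = 0 -> forall i, i \in r -> k i = 0) ->
  forall i, i \in r -> lspan r g (f i).
Proof.
move=> ur gf gi i0 i0r; set N := size r.
have sumE (h : I -> V) : \sum_(i <- r) h i = \sum_(i < N) h (nth i0 r i).
  by rewrite (big_nth i0) big_mkord.
have mem (i : 'I_N) : nth i0 r i \in r by apply: mem_nth.
have cof i : exists k : I -> F, i \in r -> g i = \sum_(j <- r) k j *: f j.
  have [/gf[k]|_] := boolP (i \in r); last by exists (fun=> 0).
  by exists k.
pose Q := \matrix_(i < N, j < N) projT1 (cid (cof (nth i0 r i))) (nth i0 r j).
have gE (i : 'I_N) : g (nth i0 r i) = \sum_(j < N) Q i j *: f (nth i0 r j).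
  rewrite [LHS](projT2 (cid (cof (nth i0 r i))) (mem i)) sumE.
  by apply: eq_bigr => j _; rewrite mxE.
have uQ : Q \in unitmx.
  rewrite -row_free_unit -kermx_eq0; apply/rowV0P => v /sub_kermxP vQ.
  have v0 : \sum_(i < N) v 0 i *: g (nth i0 r i) = 0.
    under eq_bigr => i _ do rewrite gE scaler_sumr.
    rewrite exchange_big big1 // => j _.
    under eq_bigr => i _ do rewrite scalerA.
    rewrite -scaler_suml; have := congr1 (fun A : 'rV_N => A 0 j) vQ.
    by rewrite !mxE => ->; rewrite scale0r.
  apply/rowP => i; rewrite mxE.
  pose k j := if insub (index j r) is Some l then v 0 l else 0.
  have kE (l : 'I_N) : k (nth i0 r l) = v 0 l.
    by rewrite /k index_uniq // valK.
  rewrite -kE; apply: gi (mem i); rewrite sumE -[RHS]v0.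
  by apply: eq_bigr => l _; rewrite kE.
have fE (i : 'I_N) : f (nth i0 r i) = \sum_(j < N) invmx Q i j *: g (nth i0 r j).
  under eq_bigr => j _ do rewrite gE scaler_sumr.
  rewrite exchange_big /=.
  under eq_bigr => l _.
    under eq_bigr => j _ do rewrite scalerA.
    rewrite -scaler_suml.
    have := congr1 (fun A : 'M_N => A i l) (mulVmx uQ); rewrite !mxE => ->.
    over.
  rewrite (bigD1 i) //= eqxx scale1r big1 ?addr0 // => j ji.
  by rewrite eq_sym (negPf ji) scale0r.
have i0N : (index i0 r < N)%N by rewrite index_mem.
have := fE (Ordinal i0N); rewrite /= nth_index // => ->.
apply: (lspan_sum _ (g := fun j : 'I_N => g (nth i0 r j))) => j.
by apply: lspan_mem.
Qed.

End Exchange.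

(** * Index sets of the matrix elements up to a given level *)

Section Indices.
Local Open Scope nat_scope.

Definition lvl N : seq (nat * bool) :=
  [seq (n, s) | n <- iota 0 N.+1, s <- [:: false; true]].

Definition square n : seq (nat * nat) :=
  [seq (i, j) | i <- index_iota 0 n.+1, j <- index_iota 0 n.+1].

Definition idx (r : seq (nat * bool)) : seq (nat * bool * (nat * nat)) :=
  [seq (α, ij) | α <- r, ij <- square α.1].

Lemma mem_lvl N α : (α \in lvl N) = (α.1 <= N).
Proof.
case: α => n s; apply/allpairsP/idP => [[[n' s'] []]|nN].
  by rewrite mem_iota /= add0n ltnS => h _ [-> _].
exists (n, s); split=> //; last by clear nN; case: s.
by rewrite mem_iota /= add0n ltnS.
Qed.

Lemma lvl_uniq N : uniq (lvl N).
Proof. by apply: allpairs_uniq; rewrite ?iota_uniq // => -[? ?] [? ?] _ _ []-> ->. Qed.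

Lemma mem_square n i j : ((i, j) \in square n) = (i <= n) && (j <= n).
Proof.
apply/allpairsP/andP => [[[i' j'] []]|[ni nj]].
  by rewrite !mem_index_iota !ltnS => h h' [-> ->].
by exists (i, j); rewrite !mem_index_iota !ltnS.
Qed.

Lemma mem_idx r α i j :
  ((α, (i, j)) \in idx r) = [&& α \in r, i <= α.1 & j <= α.1].
Proof.
apply/allpairsPdep/and3P => [[α' [[i' j'] [ar]]]|[ar ni nj]].
  by rewrite mem_square => /andP[ni nj] [-> -> ->].
by exists α, (i, j); rewrite mem_square ni nj.
Qed.

Lemma idx_uniq r : uniq r -> uniq (idx r).
Proof.
move=> ur; apply: allpairs_uniq_dep => // [α _|[? ?] [? ?] _ _ [-> ->] //].
by apply: allpairs_uniq; rewrite ?iota_uniq // => -[? ?] [? ?] _ _ []-> ->.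
Qed.

Lemma big_idx (V : nmodType) r (f : nat * bool -> nat -> nat -> V) :
  (\sum_(k <- idx r) f k.1 k.2.1 k.2.2 =
  \sum_(α <- r) \sum_(i < α.1.+1) \sum_(j < α.1.+1) f α i j)%R.
Proof.
rewrite big_allpairs_dep /=; apply: eq_bigr => α _.
rewrite big_allpairs_dep /= big_mkord; apply: eq_bigr => i _.
by rewrite big_mkord.
Qed.

End Indices.

(** * Monomials spanning the degree filtration *)

Section Monomials.
Variables (C : numClosedFieldType) (t : C).
Hypothesis t0 : t != 0.

Local Notation A := (Asig t).
Local Notation gen := (gen t).
Local Notation a := (gen Ga).
Local Notation b := (gen Gb).
Local Notation c := (gen Gc).
Local Notation d := (gen Gd).
Local Notation σ := (gen Gs).

(** Spans do not depend on the scalars produced by reordering letters, so these stay existential. *)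
Definition qcomm (x y : A) : Prop := exists k : C, x * y = k *: (y * x).

Lemma qcommM x y z : qcomm x y -> qcomm x z -> qcomm x (y * z).
Proof.
move=> [k xy] [l xz]; exists (k * l).
by rewrite mulrA xy -scalerAl -[y * x * z]mulrA xz -scalerAr mulrA scalerA.
Qed.

Lemma qcommX x y n : qcomm x y -> qcomm x (y ^+ n).
Proof.
move=> xy; elim: n => [|n IH]; first by exists 1; rewrite mulr1 mul1r scale1r.
by rewrite exprS; exact: qcommM.
Qed.

Lemma qcomm_gen :
  [/\ qcomm b a, qcomm b d, qcomm c a, qcomm c d & qcomm c b] /\
  [/\ qcomm σ a, qcomm σ d, qcomm σ b & qcomm σ c].
Proof.
have [[h1 h2 h3 h4 h5] [[h6 h7 h8 h9 h10] _]] := Asig_rel t.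
split; split.
- by exists t^-1; rewrite h1 scalerA mulVf // scale1r.
- by exists (- t); rewrite h4 scaleNr.
- by exists t^-1; rewrite h2 scalerA mulVf // scale1r.
- by exists (- t); rewrite h5 scaleNr.
- by exists (-1); rewrite h3 scaleN1r opprK.
- by exists 1; rewrite h7 scale1r.
- by exists 1; rewrite h8 scale1r.
- by exists (-1); rewrite h9 scaleN1r.
- by exists (-1); rewrite h10 scaleN1r.
Qed.

(* The basis monomials are those with first letter [a] ([p = true]) or [d]. *)
Definition mon (p : bool) x y z (s : bool) : A :=
  (if p then a else d) ^+ x * b ^+ y * c ^+ z * σ ^+ s.

Lemma mon1 : 1 = mon true 0 0 0 false.
Proof. by rewrite /mon !mulr1. Qed.

Lemma mul_b_mon p x y z s : exists k, b * mon p x y z s = k *: mon p x y.+1 z s.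
Proof.
have [[ba bd _ _ _] _] := qcomm_gen.
have [|k e] := @qcommX b (if p then a else d) x; first by case: (p).
by exists k; rewrite /mon !mulrA e -!scalerAl -[_ * b * _]mulrA -exprS.
Qed.

Lemma mul_c_mon p x y z s : exists k, c * mon p x y z s = k *: mon p x y z.+1 s.
Proof.
have [[_ _ ca cd cb] _] := qcomm_gen.
have [||k e] := @qcommM c ((if p then a else d) ^+ x) (b ^+ y).
- by apply: qcommX; case: (p).
- exact: qcommX.
by exists k; rewrite /mon !mulrA -[c * _ * _]mulrA e -!scalerAl -[_ * c * _]mulrA -exprS.
Qed.

Lemma sigma_expS (s : bool) : σ * σ ^+ s = σ ^+ (~~ s).
Proof. by have [_ [_ [ss _]]] := Asig_rel t; case: s; rewrite /= ?mulr1 ?expr1. Qed.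

Lemma mul_sigma_mon p x y z s :
  exists k, σ * mon p x y z s = k *: mon p x y z (~~ s).
Proof.
have [_ [sa sd sb sc]] := qcomm_gen.
have [||k e] := @qcommM σ ((if p then a else d) ^+ x * b ^+ y) (c ^+ z).
- by apply: qcommM; apply: qcommX => //; case: (p).
- exact: qcommX.
by exists k; rewrite /mon mulrA e -scalerAl -[_ * σ * _]mulrA sigma_expS.
Qed.

Lemma mon_mul_sigma p x y z s : mon p x y z s * σ = mon p x y z (~~ s).
Proof.
rewrite /mon -mulrA; congr (_ * _).
by rewrite -sigma_expS; case: s; rewrite ?expr1 ?mulr1 ?mul1r.
Qed.

Lemma parity_mon p x y z s : exists k, parity (mon p x y z s) = k *: mon p x y z s.
Proof.
exists ((-1) ^+ y * (-1) ^+ z); rewrite /mon !rmorphM !rmorphXn /= !parity_gen_homog.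
rewrite (_ : parity _ = if p then a else d); last by case: p; rewrite parity_gen_homog.
rewrite -[- b]scaleN1r -[- c]scaleN1r !exprZn.
by rewrite -!(scalerAr, scalerAl) scalerA mulrC.
Qed.

(** A filtration by degree in [a, b, c, d], with [σ] of degree 0. *)
Inductive inB (N : nat) : A -> Prop :=
| inB0 : inB N 0
| inB_mon p x y z s : (x + y + z <= N)%N -> inB N (mon p x y z s)
| inB_lin k x y : inB N x -> inB N y -> inB N (k *: x + y).

Lemma inBZ N k x : inB N x -> inB N (k *: x).
Proof. by move=> hx; rewrite -[_ *: _]addr0; apply: inB_lin => //; exact: inB0. Qed.

Lemma inBD N x y : inB N x -> inB N y -> inB N (x + y).
Proof. by move=> hx hy; rewrite -[x]scale1r; exact: inB_lin. Qed.

Lemma inB_sum N I (r : seq I) (f : I -> A) : (forall i, inB N (f i)) ->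
  inB N (\sum_(i <- r) f i).
Proof. by move=> h; elim/big_ind: _ => //; [exact: inB0|exact: inBD]. Qed.

Lemma inB_linear N N' (f : A -> A) : linear f ->
    (forall p x y z s, (x + y + z <= N)%N -> inB N' (f (mon p x y z s))) ->
  forall x, inB N x -> inB N' (f x).
Proof.
move=> fl fm x; elim=> {x} [|p x y z s /fm //|k x y _ IHx _ IHy].
  by rewrite (lin0 fl); exact: inB0.
by rewrite fl; exact: inB_lin.
Qed.

Lemma inB_mono N N' x : (N <= N')%N -> inB N x -> inB N' x.
Proof.
move=> NN'; apply: (inB_linear (f := id)) => // p {}x y z s h.
by apply: inB_mon; exact: leq_trans NN'.
Qed.

Lemma inB_par N p x : inB N x -> inB N (par_if p x).
Proof.
apply: inB_linear => [|p' {}x y z s h]; first exact: par_if_linear.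
case: p => /=; last exact: inB_mon.
by have [k ->] := parity_mon p' x y z s; apply/inBZ/inB_mon.
Qed.

Lemma inB_mul_sigma N (s : bool) x : inB N x -> inB N (x * σ ^+ s).
Proof.
apply: (inB_linear (f := fun x => x * σ ^+ s)) => [k u v|p {}x y z s' h].
  by rewrite mulrDl scalerAl.
by case: s; rewrite ?mulr1 ?expr1 ?mon_mul_sigma; exact: inB_mon.
Qed.

Lemma mulgen_linear g : linear (fun x : A => gen g * x).
Proof. by move=> k x y; rewrite mulrDr scalerAr. Qed.

Lemma inB_mul_gen N g x : inB N x -> inB N.+1 (gen g * x).
Proof.
have [_ [[h6 _ _ _ _] [_ h12]]] := Asig_rel t.
have bc k p x' y z s : (x' + y + z < N)%N -> inB N.+1 (k *: (b * c) * mon p x' y z s).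
  move=> h; rewrite -scalerAl -mulrA; apply: inBZ.
  have [k1 ->] := mul_c_mon p x' y z s; rewrite -scalerAr; apply: inBZ.
  have [k2 ->] := mul_b_mon p x' y z.+1 s; apply/inBZ/inB_mon.
  by lia.
have sg p x' y z s : (x' + y + z < N)%N -> inB N.+1 (σ * mon p x' y z s).
  move=> h; have [k1 ->] := mul_sigma_mon p x' y z s; apply/inBZ/inB_mon; lia.
have shift p x' y z s :
    (if p then a else d) * mon p x' y z s = mon p x'.+1 y z s.
  by rewrite /mon !mulrA -exprS.
have zero p p' y z s : mon p 0 y z s = mon p' 0 y z s by rewrite /mon !expr0.
apply: (inB_linear (mulgen_linear g)) => p {}x y z s h; case: g.
- case: p; first by rewrite (shift true); apply: inB_mon; lia.
  case: x h => [|x] h; first by rewrite (zero _ true) (shift true); apply: inB_mon; lia.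
  (* A product [a d] is not a basis word; [ad = σ - tbc] replaces it by a term two degrees lower and
     one of the same degree. *)
  rewrite -(shift false) mulrA (_ : a * d = σ + (- t) *: (b * c)).
    by rewrite mulrDl; apply: inBD; [apply: sg|apply: bc]; lia.
  by rewrite -h12 scaleNr addrK.
- by have [k ->] := mul_b_mon p x y z s; apply/inBZ/inB_mon; lia.
- by have [k ->] := mul_c_mon p x y z s; apply/inBZ/inB_mon; lia.
- case: p; last by rewrite (shift false); apply: inB_mon; lia.
  case: x h => [|x] h; first by rewrite (zero _ false) (shift false); apply: inB_mon; lia.
  (* Likewise [da = σ - t^-1 bc], which combines the relations for [ad] and for [ad - da]. *)
  rewrite -(shift true) mulrA (_ : d * a = σ + (- t^-1) *: (b * c)).
    by rewrite mulrDl; apply: inBD; [apply: sg|apply: bc]; lia.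
  rewrite -h12 -addrA -scalerDl addrC; apply/eqP; rewrite -subr_eq; apply/eqP.
  by rewrite -opprB h6 -scaleNr opprB.
- by have [k ->] := mul_sigma_mon p x y z s; apply/inBZ/inB_mon; lia.
Qed.

Lemma inB_all x : exists N, inB N x.
Proof.
elim/Asig_ind_gen: x => [|k x y [N hx] [N' hy]|g x [N hx]].
- by exists 0%N; rewrite mon1; exact: inB_mon.
- by exists (maxn N N'); apply: inB_lin; apply: inB_mono (_ : inB _ _);
    try eassumption; rewrite ?leq_maxl ?leq_maxr.
- by exists N.+1; exact: inB_mul_gen.
Qed.

(** Numbers the monomials of degree [n = α.1] by the pairs [i, j <= n]: first letter [a] for
    [i + j < n], [d] for [i + j > n], neither on the antidiagonal. Monomials and matrix elements
    thus share one index list, as [exchange] requires. *)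
Definition pbw (α : nat * bool) i j : A :=
  if (i + j <= α.1)%N then mon true (α.1 - i - j) i j α.2
  else mon false (i + j - α.1) (α.1 - j) (α.1 - i) α.2.

Lemma inB_pbw N x : inB N x ->
  lspan (idx (lvl N)) (fun k => pbw k.1 k.2.1 k.2.2) x.
Proof.
elim=> {x} [|p x y z s h|k x y _ IHx _ IHy]; [exact: lspan0| |exact: lspan_lin].
have [i [j [ni nj ->]]] : exists i j, [/\ (i <= x + y + z)%N, (j <= x + y + z)%N &
    mon p x y z s = pbw (x + y + z, s)%N i j].
  case: p.
    exists y, z; split; try lia; rewrite /pbw ifT /=; last lia.
    by congr mon; lia.
  case: x h => [|x] h.
    exists y, z; split; try lia; rewrite /pbw ifT /=; last lia.
    by rewrite /mon !expr0 (_ : 0 + y + z - y - z = 0)%N //; lia.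
  exists (x.+1 + y)%N, (x.+1 + z)%N; split; try lia; rewrite /pbw ifF /=; last lia.
  by congr mon; lia.
have : (((x + y + z)%N, s), (i, j)) \in idx (lvl N).
  by rewrite mem_idx mem_lvl /= h ni nj.
exact: (lspan_mem _ (idx_uniq (lvl_uniq N))).
Qed.

Lemma Ract_word_inB (φ : A -> C^o) n x :
  (forall φ : A -> C^o, linear φ -> inB n (Ract φ x)) -> forall g,
  forall φ : A -> C^o, linear φ -> inB n.+1 (Ract φ (gen g * x)).
Proof.
move=> h g {}φ φl; rewrite Ract_gen //; apply: inB_sum => k.
apply/inB_mul_gen/inB_par; apply: (h (fun u => φ (gmul k.2 false u))).
exact: lin_comp φl (gmul_linear _ _).
Qed.

(** The induction must range over all functionals: peeling off a generator replaces [φ] by its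
    composite with a left multiplication. *)
Lemma Ract_monomial_inB i k (φ : A -> C^o) : linear φ ->
  inB (i + k) (Ract φ (a ^+ i * c ^+ k)).
Proof.
elim: i φ => [|i IH] φ φl; last by rewrite exprS -mulrA; exact: Ract_word_inB.
rewrite expr0 mul1r; elim: k φ φl => [|k IH] φ φl.
  rewrite /Ract expr0 Delta1 // rconE //; apply: inBZ.
  by rewrite mon1; exact: inB_mon.
by rewrite exprS; exact: Ract_word_inB.
Qed.

End Monomials.

(** * The matrix elements span the algebra *)

Section Spanning.
Variables (C : numClosedFieldType) (t : C).
Hypothesis t0 : t != 0.
Hypothesis tr : forall n, (0 < n)%N -> (t ^+ 2) ^+ n != 1.
Variables (rt : nat -> nat -> C) (m : forall n : nat, 'I_n.+1 -> 'I_n.+1 -> Asig t).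
Hypothesis rt0 : forall n k, (k <= n)%N -> rt n k != 0.
Hypothesis hm : matrix_elements rt m.
Local Notation A := (Asig t).
Local Notation Ms := (Ms m).

Lemma mm_inB n i j : (i <= n)%N -> (j <= n)%N -> inB n (mm m n i j).
Proof.
move=> ni nj; have [δ [δl δE]] := X_dual t0 tr rt0 nj.
rewrite -(Ract_dual_X hm δl δE) //.
rewrite /X (Defs.linearPZ (Ract_linear t0 δl)); apply: inBZ.
by have := Ract_monomial_inB t0 (n - i) i δl; rewrite subnK.
Qed.

Lemma Ms_spanning x : exists N (k : nat * bool -> nat -> nat -> C),
  x = \sum_(α <- lvl N) \sum_(i < α.1.+1) \sum_(j < α.1.+1) k α i j *: Ms α i j.
Proof.
have [N xB] := inB_all t0 x; exists N.
pose f (k : nat * bool * (nat * nat)) := pbw t k.1 k.2.1 k.2.2.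
pose g (k : nat * bool * (nat * nat)) := Ms k.1 k.2.1 k.2.2.
have ul := lvl_uniq N; have ui := idx_uniq ul.
have gf k : k \in idx (lvl N) -> lspan (idx (lvl N)) f (g k).
  case: k => -[n s] [i j]; rewrite mem_idx mem_lvl => /and3P[/= nN ni nj].
  by apply/(inB_pbw t0)/inB_mul_sigma/(inB_mono nN)/mm_inB.
have gi l : \sum_(k <- idx (lvl N)) l k *: g k = 0 -> forall k, k \in idx (lvl N) -> l k = 0.
  move=> l0 -[α [i j]]; rewrite mem_idx => /and3P[ar ni nj].
  apply: (@Ms_independent _ _ t0 tr _ _ rt0 hm _ (fun α i j => l (α, (i, j))) ul) => //.
  rewrite -[RHS]l0 -(big_idx _ (fun α i j => l (α, (i, j)) *: Ms α i j)).
  by apply: eq_bigr => -[? [? ?]] _.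
have [k ->] : lspan (idx (lvl N)) g x.
  have [k ->] := inB_pbw t0 xB; rewrite big_seq.
  elim/big_ind: _ => [||l lr]; first exact: lspan0.
    by move=> u v; rewrite -{2}[u]scale1r; exact: lspan_lin.
  rewrite -[_ *: _]addr0; apply: lspan_lin; last exact: lspan0.
  exact: (exchange ui gf gi).
exists (fun α i j => k (α, (i, j))).
rewrite -(big_idx _ (fun α i j => k (α, (i, j)) *: Ms α i j)).
by apply: eq_bigr => -[? [? ?]] _.
Qed.

End Spanning.

Lemma big_lvl_widen (V : nmodType) N N' (f : nat * bool -> V) : (N <= N')%N ->
  \sum_(α <- lvl N) f α = \sum_(α <- lvl N' | (α.1 <= N)%N) f α.
Proof.
move=> NN'; rewrite -[RHS]big_filter; apply: perm_big; apply: uniq_perm.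
- exact: lvl_uniq.
- exact/filter_uniq/lvl_uniq.
- move=> α; rewrite mem_filter !mem_lvl.
  by case: leqP => // /leq_trans ->.
Qed.

(** * Irreducible representations of matrix units *)

Section IrreducibleMatrixUnits.
Variables (K : fieldType) (V : vectType K).
Variable E : nat * bool -> nat -> nat -> V -> V.
Hypothesis El : forall α i j, linear (E α i j).
Hypothesis EM : forall α β i j k l v, (i <= α.1)%N -> (j <= α.1)%N ->
  (k <= β.1)%N -> (l <= β.1)%N ->
  E β k l (E α i j v) = if (α == β) && (j == k) then E α i l v else 0.
Hypothesis E1 : forall v, exists N,
  v = \sum_(α <- lvl N) \sum_(i < α.1.+1) E α i i v.
Hypothesis V0 : fullv != 0%VS :> {vspace V}.
Hypothesis Eirr : forall W : {vspace V},
  (forall α i j w, (i <= α.1)%N -> (j <= α.1)%N -> w \in W -> E α i j w \in W) ->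
  W = 0%VS \/ W = fullv.

(** The [E α i i] sum to the identity, so one of them does not kill a given nonzero [v]. The vectors
    [E α i l v] with this [i] fixed span a stable nonzero subspace, hence everything. *)
Lemma irreducible_matrix_units : exists α (u : nat -> V),
  (forall β k l i, (k <= β.1)%N -> (l <= β.1)%N -> (i <= α.1)%N ->
     E β k l (u i) = if (β == α) && (k == i) then u l else 0) /\
  basis_of fullv [tuple u i | i < α.1.+1].
Proof.
pose v := vpick (fullv : {vspace V}); have v0 : v != 0 by rewrite vpick0.
have [α [i [ni Ei0]]] : exists α i, (i <= α.1)%N /\ E α i i v != 0.
  apply: contrapT => h; case/eqP: v0; have [N ->] := E1 v.
  rewrite big1 // => α _; rewrite big1 // => i _.
  by apply/eqP/negPn/negP => n0; apply: h; exists α, i; rewrite -ltnS.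
pose u l := E α i l v; exists α, u.
have Eu β k l j : (k <= β.1)%N -> (l <= β.1)%N -> (j <= α.1)%N ->
     E β k l (u j) = if (β == α) && (k == j) then u l else 0.
  by move=> nk nl nj; rewrite EM // eq_sym [j == k]eq_sym.
split=> //; set X := [tuple u i | i < α.1.+1].
have XE (l : 'I_α.1.+1) : X`_l = u l.
  by rewrite (nth_map l) ?size_enum_ord // nth_ord_enum.
have uX l : (l <= α.1)%N -> u l \in <<X>>%VS.
  move=> nl; apply: memv_span; apply/tnthP; exists (Ordinal (nl : (l < α.1.+1)%N)).
  by rewrite tnth_mktuple.
rewrite /basis_of; apply/andP; split.
  case: (Eirr (W := <<X>>%VS)) => [β k l w nk nl wX|X0|->] //.
    rewrite (coord_span wX) (lin_sum (El β k l)); apply: memv_suml => j _.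
    rewrite (Defs.linearPZ (El β k l)) memvZ // XE Eu // -1?ltnS //.
    case: ifP => [/andP[/eqP e _]|_]; last exact: mem0v.
    by apply: uX; rewrite -e.
  by have := uX i ni; rewrite X0 memv0 (negPf Ei0).
apply/freeP => k k0 l.
have nl : (l <= α.1)%N by rewrite -ltnS.
(* [E α l i] sends [u l] to [u i], nonzero by the choice of [i], and kills the other [u j]. *)
have := congr1 (E α l i) k0; rewrite (lin0 (El _ _ _)) (lin_sum (El _ _ _)).
rewrite (bigD1 l) //= big1 => [|j jl].
  rewrite (Defs.linearPZ (El _ _ _)) XE Eu // !eqxx addr0 => /eqP.
  by rewrite scaler_eq0 (negPf Ei0) orbF => /eqP.
rewrite (Defs.linearPZ (El _ _ _)) XE Eu // -1?ltnS //.
case: (l =P j :> nat) => [lj|_]; last by rewrite andbF scaler0.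
by case/eqP: jl; exact: val_inj.
Qed.

End IrreducibleMatrixUnits.

Lemma tsub_pure (K : fieldType) (U V : lmodType K) (P : set U) (Q : set V) u v :
  P u -> Q v -> tsub P Q (u ⊗ v).
Proof.
by exists [:: (u, v)]; rewrite ?big_seq1 // => p; rewrite inE => /eqP ->.
Qed.

Lemma tsub_sum (K : fieldType) (U V : lmodType K) (P : set U) (Q : set V)
    I (r : seq I) (f : I -> tens U V) :
  (forall i, tsub P Q (f i)) -> tsub P Q (\sum_(i <- r) f i).
Proof.
move=> h; elim/big_ind: _ => [|x y [s sP ->] [s' sP' ->]|i _]; last exact: h.
  by exists [::]; rewrite ?big_nil.
exists (s ++ s'); last by rewrite big_cat.
by move=> p; rewrite mem_cat => /orP[/sP|/sP'].
Qed.

(** * Coordinate functionals *)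

Section Decomposition.
Variables (C : numClosedFieldType) (t : C).
Hypothesis t0 : t != 0.
Hypothesis tr : forall n, (0 < n)%N -> (t ^+ 2) ^+ n != 1.
Variables (rt : nat -> nat -> C) (m : forall n : nat, 'I_n.+1 -> 'I_n.+1 -> Asig t).
Hypothesis rt0 : forall n k, (k <= n)%N -> rt n k != 0.
Hypothesis hm : matrix_elements rt m.

Local Notation A := (Asig t).
Local Notation gen := (gen t).
Local Notation a := (gen Ga).
Local Notation b := (gen Gb).
Local Notation c := (gen Gc).
Local Notation σ := (gen Gs).
Local Notation Ms := (Ms m).
Local Notation epsA := (@eps C t : A -> C^o).

Definition expansion N (k : nat * bool -> nat -> nat -> C) : A :=
  \sum_(α <- lvl N) \sum_(i < α.1.+1) \sum_(j < α.1.+1) k α i j *: Ms α i j.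

Lemma expansion_lin N l k k' :
  l *: expansion N k + expansion N k' =
  expansion N (fun α i j => l * k α i j + k' α i j).
Proof.
rewrite /expansion scaler_sumr -big_split; apply: eq_bigr => α _.
rewrite scaler_sumr -big_split; apply: eq_bigr => i _.
rewrite scaler_sumr -big_split; apply: eq_bigr => j _.
by rewrite scalerA scalerDl.
Qed.

Lemma expansion_inj N k k' : expansion N k = expansion N k' ->
  forall α i j, (α.1 <= N)%N -> (i <= α.1)%N -> (j <= α.1)%N ->
  k α i j = k' α i j.
Proof.
move=> e α i j aN ni nj; apply/eqP; rewrite -subr_eq0 addrC -mulN1r; apply/eqP.
apply: (Ms_independent t0 tr rt0 hm (k := fun α i j => -1 * k' α i j + k α i j)
  (lvl_uniq N)); rewrite ?mem_lvl //.
by rewrite -[RHS](addNr (expansion N k')) -scaleN1r -{2}e expansion_lin.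
Qed.

Definition level (x : A) : nat := projT1 (cid (Ms_spanning t0 tr rt0 hm x)).

(** The coefficients are chosen at a level depending on [x]; linearity rests on [coef_unique], by
    which every expansion of [x] yields the same ones. *)
Definition coef (α : nat * bool) (i j : nat) (x : A) : C^o :=
  if [&& (α.1 <= level x)%N, (i <= α.1)%N & (j <= α.1)%N]
  then projT1 (cid (projT2 (cid (Ms_spanning t0 tr rt0 hm x)))) α i j else 0.

Lemma expansion_coef x N : (level x <= N)%N ->
  x = expansion N (fun α i j => coef α i j x).
Proof.
move=> xN; rewrite {1}(projT2 (cid (projT2 (cid (Ms_spanning t0 tr rt0 hm x))))).
rewrite -/(level x) (big_lvl_widen _ xN) /expansion big_mkcond.
apply: eq_bigr => α _; case: ifP => aN; last first.
  by rewrite big1 // => i _; rewrite big1 // => j _; rewrite /coef aN scale0r.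
apply: eq_bigr => i _; apply: eq_bigr => j _.
by rewrite /coef aN -ltnS ltn_ord -ltnS ltn_ord.
Qed.

Lemma coef_unique N k x α i j : x = expansion N k ->
  coef α i j x = if [&& (α.1 <= N)%N, (i <= α.1)%N & (j <= α.1)%N] then k α i j else 0.
Proof.
(* Extension by zero, so that the given expansion and the chosen one can be compared at a common
   level. *)
move=> xE; pose k' α i j := if (α.1 <= N)%N then k α i j else 0.
have xE' : x = expansion (maxn N (level x)) k'.
  rewrite {1}xE /expansion (big_lvl_widen _ (leq_maxl N (level x))) big_mkcond.
  apply: eq_bigr => β _; rewrite /k'; case: ifP => // _.
  by rewrite big1 // => l _; rewrite big1 // => l' _; rewrite scale0r.
have := expansion_coef (leq_maxr N (level x)); rewrite {1}xE'.
move/expansion_inj => /(_ α i j) e.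
have [/andP[ni nj]|nij] := boolP ((i <= α.1)%N && (j <= α.1)%N); last first.
  by rewrite /coef (negPf nij) !andbF.
have [aN|aN] := leqP α.1 (maxn N (level x)).
  by rewrite -e // /k' !andbT.
rewrite /coef; move: aN; rewrite gtn_max => /andP[aN al].
by rewrite [(α.1 <= level x)%N]leqNgt [(α.1 <= N)%N]leqNgt aN al.
Qed.

Lemma coef_linear α i j : linear (coef α i j).
Proof.
move=> l x y; set N := maxn (level x) (level y).
have [xE yE] := (expansion_coef (leq_maxl _ _ : (level x <= N)%N),
                 expansion_coef (leq_maxr _ _ : (level y <= N)%N)).
have xyE : l *: x + y = expansion N (fun α i j => l * coef α i j x + coef α i j y).
  by rewrite -expansion_lin -xE -yE.
rewrite (coef_unique _ _ _ xyE); case: ifP => // h.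
by rewrite (coef_unique α i j xE) (coef_unique α i j yE) h scaler0 addr0.
Qed.

Lemma coef_Ms α i j β p q : (i <= α.1)%N -> (j <= α.1)%N ->
    (p <= β.1)%N -> (q <= β.1)%N ->
  coef α i j (Ms β p q) = ((α == β) && ((i == p) && (j == q)))%:R.
Proof.
move=> ni nj np nq.
have MsE : Ms β p q =
    expansion β.1 (fun α i j => ((α == β) && ((i == p) && (j == q)))%:R).
  rewrite /expansion (bigD1_seq β) ?lvl_uniq ?mem_lvl //= [X in _ + X]big1.
    rewrite addr0 -[LHS](big_square_pick (fun i j => Ms β i j) np nq).
    apply: eq_bigr => i' _; apply: eq_bigr => j' _; rewrite eqxx /=.
    by case: ifP => _; rewrite ?scale1r ?scale0r.
  move=> γ gb; rewrite big1 // => i' _; rewrite big1 // => j' _.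
  by rewrite (negPf gb) scale0r.
rewrite (coef_unique _ _ _ MsE) ni nj !andbT; case: eqP => [->|]; rewrite ?leqnn //.
by case: ifP.
Qed.

Lemma A_ext (W : lmodType C) (f g : A -> W) : linear f -> linear g ->
    (forall α i j, (i <= α.1)%N -> (j <= α.1)%N -> f (Ms α i j) = g (Ms α i j)) ->
  f =1 g.
Proof.
move=> fl gl e x; rewrite (expansion_coef (leqnn (level x))) /expansion.
rewrite !(lin_sum fl, lin_sum gl); apply: eq_bigr => α _.
rewrite !(lin_sum fl, lin_sum gl); apply: eq_bigr => i _.
rewrite !(lin_sum fl, lin_sum gl); apply: eq_bigr => j _.
by rewrite (Defs.linearPZ fl) (Defs.linearPZ gl) e // -ltnS.
Qed.

(* The [coef α i j] multiply as matrix units for the convolution product. *)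
Lemma coef_conv α β i j k l x : (i <= α.1)%N -> (j <= α.1)%N ->
    (k <= β.1)%N -> (l <= β.1)%N ->
  coef β k l (Lact (coef α i j) x) =
  if (α == β) && (j == k) then coef α i l x else 0.
Proof.
move=> ni nj nk nl; have cl := coef_linear.
apply: (A_ext (f := fun x => coef β k l (Lact (coef α i j) x))
  (g := fun x => if (α == β) && (j == k) then coef α i l x else 0)).
- exact: lin_comp (cl _ _ _) (Lact_linear t0 (cl _ _ _)).
- by case: (_ && _) => z u v; [exact: cl|rewrite scaler0 addr0].
move=> γ p q np nq; rewrite /Lact (Delta_Ms t0 tr rt0 hm) //.
rewrite (lin_sum (lcon_linear (cl _ _ _))) (lin_sum (cl _ _ _)).
have [e|ne] := eqVneq α γ; last first.
  rewrite [RHS](_ : _ = 0); last first.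
    case: ifP => // /andP[/eqP ab _].
    by rewrite coef_Ms ?(negPf ne) // (leq_trans nl) // ab.
  rewrite big1 // => r _.
  have nr : (r <= γ.1)%N by rewrite -ltnS.
  by rewrite lconE // coef_Ms // (negPf ne) scale0r (lin0 (cl _ _ _)).
move: np nq; rewrite -{}e => np nq.
rewrite (bigD1 (Ordinal (nj : (j < α.1.+1)%N))) //= big1 => [|r rj]; last first.
  have nr : (r <= α.1)%N by rewrite -ltnS.
  rewrite lconE // coef_Ms //; case: (j =P r :> nat) => [e|_].
    by case/eqP: rj; exact: val_inj.
  by rewrite !andbF scale0r (lin0 (cl _ _ _)).
rewrite addr0 lconE // (Defs.linearPZ (cl _ _ _)).
rewrite (@coef_Ms α i j) // (@coef_Ms β k l) // !eqxx andbT /=.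
have [e|_] := eqVneq α β; last by rewrite eq_sym; case: eqP => //= _; rewrite scaler0.
rewrite -?e ?eqxx [k == j]eq_sym /=; case: (j == k) => /=; last by rewrite scaler0.
rewrite coef_Ms // ?e // eqxx /=.
by do ![case: eqP => //= _]; rewrite ?scale1r ?scaler0 ?scale0r.
Qed.

End Decomposition.

(** * Linear maps prescribed on a basis *)

Section BasisMaps.
Variables (K : fieldType) (V : vectType K) (n : nat) (u : nat -> V).
Hypothesis ub : basis_of fullv [tuple u i | i < n].

Let tupleE (i : 'I_n) : [tuple u i | i < n]`_i = u i.
Proof. by rewrite -tnth_nth tnth_mktuple. Qed.

Lemma basis_ext (W : lmodType K) (f g : V -> W) : linear f -> linear g ->
  (forall i : 'I_n, f (u i) = g (u i)) -> f =1 g.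
Proof.
move=> fl gl e v; rewrite (coord_basis ub (memvf v)).
rewrite (lin_sum fl) (lin_sum gl); apply: eq_bigr => i _.
by rewrite (Defs.linearPZ fl) (Defs.linearPZ gl) tupleE e.
Qed.

Lemma basis_map (W : lmodType K) (y : nat -> W) :
    (forall k : 'I_n -> K, \sum_(i < n) k i *: y i = 0 -> forall i, k i = 0) ->
  exists f : {linear V -> W}, [/\ injective f,
    range f = [set x : W | exists k : 'I_n -> K, x = \sum_(i < n) k i *: y i]%classic &
    forall i : 'I_n, f (u i) = y i].
Proof.
move=> yfree; pose X := [tuple u i | i < n].
pose f v := \sum_(i < n) coord X i v *: y i.
have fl : linear f.
  move=> k v w; rewrite /f scaler_sumr -big_split; apply: eq_bigr => i _.
  by rewrite linearP scalerDl scalerA.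
have fk (k : 'I_n -> K) : f (\sum_i k i *: u i) = \sum_i k i *: y i.
  apply: eq_bigr => i _; congr (_ *: _); rewrite linear_sum /= (bigD1 i) //= big1.
    by rewrite linearZ /= -tupleE coord_free ?(basis_free ub) // eqxx addr0 mulr1.
  move=> j ji; rewrite linearZ /= -tupleE coord_free ?(basis_free ub) //.
  by rewrite (negPf ji) mulr0.
pose fL := HB.pack_for {linear V -> W} f (GRing.isLinear.Build _ _ _ _ f fl).
exists fL; split=> [v w /= fvw||i].
- have k0 : \sum_(i < n) (coord X i v - coord X i w) *: y i = 0.
    under eq_bigr => i _ do rewrite scalerBl.
    by rewrite sumrB -[X in X - _]/(f v) fvw subrr.
  rewrite (coord_basis ub (memvf v)) (coord_basis ub (memvf w)).
  apply: eq_bigr => i _; congr (_ *: _).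
  by have /eqP := yfree _ k0 i; rewrite subr_eq0 => /eqP.
- apply/seteqP; split=> x /= [].
    by move=> v _ <-; exists (fun i => coord X i v).
  by move=> k ->; exists (\sum_i k i *: u i); rewrite ?fk.
- have := fk (fun j => (j == i)%:R); rewrite (bigD1 i) //= big1 => [|j ji].
    rewrite eqxx scale1r addr0 => ->; rewrite (bigD1 i) //= big1 ?eqxx ?scale1r ?addr0 //.
    by move=> j ji; rewrite (negPf ji) scale0r.
  by rewrite (negPf ji) scale0r.
Qed.

End BasisMaps.

(** * Bicomodules and comodules *)

Section Comodules.
Variables (C : numClosedFieldType) (t : C).
Hypothesis t0 : t != 0.
Hypothesis tr : forall n, (0 < n)%N -> (t ^+ 2) ^+ n != 1.
Variables (rt : nat -> nat -> C) (m : forall n : nat, 'I_n.+1 -> 'I_n.+1 -> Asig t).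
Hypothesis rt0 : forall n k, (k <= n)%N -> rt n k != 0.
Hypothesis hm : matrix_elements rt m.

Local Notation A := (Asig t).
Local Notation gen := (gen t).
Local Notation a := (gen Ga).
Local Notation b := (gen Gb).
Local Notation c := (gen Gc).
Local Notation σ := (gen Gs).
Local Notation Ms := (Ms m).
Local Notation epsA := (@eps C t : A -> C^o).
Local Notation coef := (coef t0 tr rt0 hm).
Local Notation level := (level t0 tr rt0 hm).
Let cl := coef_linear t0 tr rt0 hm.
Let expE x N : (level x <= N)%N -> x = expansion m N (fun α i j => coef α i j x).
Proof. exact: expansion_coef. Qed.

(** [ε] kills [X n j] for [j > 0], so the counit axiom on the right leg of [Delta (X n i)] leaves
    column 0 only. *)
Lemma mm_col n i : (i <= n)%N ->
  mm m n i 0 = (wt rt n 0)^-1 *: X t rt n i.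
Proof.
move=> ni; have el := @eps_lin C t.
rewrite -[X in _ *: X](Ract_eps t0) /Ract (Delta_X hm) // (lin_sum (rcon_linear el)).
rewrite big_ord_recl rconE // (eps_X _ _ (leq0n n)) mul1r scalerDr scalerA.
rewrite mulVf ?scale1r ?wt_neq0 // big1 ?scaler0 ?addr0 // => j _.
by rewrite rconE // eps_X ?mul0r ?scale0r // -ltnS ltn_ord.
Qed.

(** The q-binomial expansion of the [n]-th power of [a ⊗ a + b ⊗ c], with its coefficients left
    unspecified. *)
Lemma Delta_aX n :
  lspan (iota 0 n.+1) (fun j => (a ^+ (n - j) * b ^+ j) ⊗ (a ^+ (n - j) * c ^+ j))
    (Delta (a ^+ n) : tensA t).
Proof.
have Dl := Delta_linear t0; have gl := @gmul_linear C t.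
have mem N j (f : nat -> tensA t) : (j <= N)%N -> lspan (iota 0 N.+1) f (f j).
  by move=> jN; apply: lspan_mem; rewrite ?iota_uniq // mem_iota ltnS.
elim: n => [|n [k IH]].
  have := mem 0%N 0%N (fun j => (a ^+ (0 - j) * b ^+ j) ⊗ (a ^+ (0 - j) * c ^+ j)) isT.
  by rewrite subnn !mulr1 Delta1.
rewrite exprS Delta_gen_mul // /cop !big_cons big_nil addr0 IH.
rewrite !(lin_sum (tmap_linear (gl _ _) (gl _ _))) -big_split.
rewrite big_seq_cond; elim/big_ind: _ => [||j]; first exact: lspan0.
  by move=> u v; rewrite -{2}[u]scale1r; exact: lspan_lin.
rewrite mem_iota add0n ltnS andbT => /= jn.
rewrite !(Defs.linearPZ (tmap_linear (gl _ _) (gl _ _))) -scalerDr.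
rewrite -[_ *: _]addr0; apply: lspan_lin; last exact: lspan0.
rewrite !tmapE // /gmul /= !mulrA -!exprS -subSn //.
rewrite -[X in X + _]scale1r; apply: lspan_lin.
  exact: (mem n.+1 j (fun j => _ ⊗ _) (leqW jn)).
have [k1 e1] : exists k, b * parity (a ^+ (n - j) * b ^+ j) =
    k *: (a ^+ (n.+1 - j.+1) * b ^+ j.+1).
  have [k1 e1] := parity_mon t true (n - j) j 0 false.
  have [k2 e2] := mul_b_mon t0 true (n - j) j 0 false.
  exists (k1 * k2); move: e1 e2; rewrite /mon /= !mulr1 subSS => -> e2.
  by rewrite -scalerAr e2 scalerA.
have -> : c * a ^+ (n - j) * c ^+ j = t ^- (n - j) *: (a ^+ (n.+1 - j.+1) * c ^+ j.+1).
  by rewrite c_aX // -scalerAl -mulrA -exprS.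
rewrite e1 tpureZl tpureZr scalerA -[_ *: _]addr0.
apply: lspan_lin; last exact: lspan0.
exact: (mem n.+1 j.+1 (fun j => _ ⊗ _) jn).
Qed.

(** The functional dual to [X n j] isolates one term of [Delta (a ^+ n)]. The scalar cannot be 0,
    because [m_0j] has coordinate 1 along itself. *)
Lemma mm_row n j : (j <= n)%N ->
  exists2 k, k != 0 & mm m n 0 j = k *: (a ^+ (n - j) * b ^+ j).
Proof.
move=> nj; have [δ [δl δE]] := X_dual t0 tr rt0 nj.
have mE := Ract_dual_X hm δl δE (leq0n n) nj.
have δm i : (i <= n)%N -> δ (a ^+ (n - i) * c ^+ i) = (wt rt n i)^-1 * (i == j)%:R.
  move=> ni; rewrite -(δE _ ni) (Defs.linearPZ δl).
  rewrite [_ *: _](_ : _ = wt rt n i * δ (a ^+ (n - i) * c ^+ i)) // mulrA.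
  by rewrite mulVf ?mul1r ?wt_neq0.
have [k mk] : exists k, mm m n 0 j = k *: (a ^+ (n - j) * b ^+ j).
  have [e De] := Delta_aX n.
  exists (wt rt n 0 * (e j * (wt rt n j)^-1)).
  rewrite -mE {1}/X subn0 mulr1 (Defs.linearPZ (Ract_linear t0 δl)) /Ract De.
  rewrite (lin_sum (rcon_linear δl)) -[RHS]scalerA; congr (_ *: _).
  rewrite (bigD1_seq j) ?iota_uniq ?mem_iota ?ltnS // big_seq_cond big1 => [|i].
    by rewrite /= (Defs.linearPZ (rcon_linear δl)) rconE // δm // eqxx mulr1 addr0 scalerA.
  rewrite mem_iota add0n ltnS => /= /andP[ni ij].
  rewrite (Defs.linearPZ (rcon_linear δl)) rconE // δm // (negPf ij) mulr0.
  by rewrite scale0r scaler0.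
exists k => //; apply/eqP => k0; move: mk; rewrite k0 scale0r => mk.
have := coef_Ms t0 tr rt0 hm (α := (n, false)) (β := (n, false)) (leq0n n) nj (leq0n n) nj.
rewrite /Ms /= mk mul0r (lin0 (cl _ _ _)) !eqxx => /esym/eqP.
by rewrite oner_eq0.
Qed.

Lemma Mspan_Ms α i j : Mspan m α.1 α.2 (Ms α i j).
Proof.
exists (fun i' j' => ((i' == inord i) && (j' == inord j))%:R).
rewrite (bigD1 (inord i)) //= (bigD1 (inord j)) //= !eqxx scale1r !big1 ?addr0 //.
  by move=> i' ii; rewrite big1 // => j' _; rewrite (negPf ii) scale0r.
by move=> j' jj; rewrite (negPf jj) andbF scale0r.
Qed.

Lemma mE n (s : bool) (i j : 'I_n.+1) : m i j * σ ^+ s = Ms (n, s) i j.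
Proof. by rewrite /Ms /mm /= !inord_val. Qed.

Lemma Mspan_subbicomodule n s : is_subbicomodule (Mspan m n s).
Proof.
have Dl := Delta_linear t0.
move=> x [l ->]; rewrite (lin_sum Dl); split; apply: tsub_sum => i;
  rewrite (lin_sum Dl); apply: tsub_sum => j;
  rewrite (Defs.linearPZ Dl) mE (Delta_Ms t0 tr rt0 hm) -1?ltnS // scaler_sumr;
  apply: tsub_sum => k.
  by rewrite -tpureZl; apply: tsub_pure => //; exact: (Mspan_Ms (n, s)).
by rewrite -tpureZr; apply: tsub_pure => //; exact: (Mspan_Ms (n, s)).
Qed.

Lemma Mspan_direct_sum : is_direct_sum (fun ns : nat * bool => Mspan m ns.1 ns.2).
Proof.
split=> [x|r f ur fM f0 α ar].
  have xE := expE (leqnn (level x)).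
  exists (lvl (level x)).
  exists (fun α => \sum_(i < α.1.+1) \sum_(j < α.1.+1) coef α i j x *: Ms α i j).
  split=> [|[n s] _|]; [exact: lvl_uniq| |exact: xE].
  exists (fun i j => coef (n, s) i j x); apply: eq_bigr => i _.
  by apply: eq_bigr => j _; rewrite mE.
have fE β : exists k : nat -> nat -> C, β \in r ->
    f β = \sum_(i < β.1.+1) \sum_(j < β.1.+1) k i j *: Ms β i j.
  have [/fM|_] := boolP (β \in r); last by exists (fun _ _ => 0).
  case: β => n s [l /= ->]; exists (fun i j => l (inord i) (inord j)) => _.
  by apply: eq_bigr => i _; apply: eq_bigr => j _; rewrite mE !inord_val.
pose k β := projT1 (cid (fE β)).
have kE β : β \in r -> f β = \sum_(i < β.1.+1) \sum_(j < β.1.+1) k β i j *: Ms β i j.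
  exact: projT2 (cid (fE β)).
rewrite kE // big1 // => i _; rewrite big1 // => j _.
rewrite (Ms_independent t0 tr rt0 hm ur (k := k)) ?scale0r -1?ltnS //.
by rewrite -[RHS]f0 big_seq [RHS]big_seq; apply: eq_bigr => β /kE ->.
Qed.

Lemma VL_span n s : VL rt n s =
  [set x : A | exists k : 'I_n.+1 -> C, x = \sum_i k i *: Ms (n, s) i 0]%classic.
Proof.
have w0 : wt rt n 0 != 0 by exact: wt_neq0.
have xiE (k : 'I_n.+1) : xi t rt k * σ ^+ s = wt rt n 0 *: Ms (n, s) k 0.
  by rewrite /Ms mm_col -1?ltnS // scalerAl scalerA mulfV // scale1r.
apply/seteqP; split=> x /= [k ->].
  exists (fun i => k i * wt rt n 0); apply: eq_bigr => i _.
  by rewrite xiE scalerA.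
exists (fun i => k i / wt rt n 0); apply: eq_bigr => i _.
by rewrite xiE scalerA divfK.
Qed.

Lemma VR_span n s : VR rt n s =
  [set x : A | exists k : 'I_n.+1 -> C, x = \sum_i k i *: Ms (n, s) 0 i]%classic.
Proof.
have [c0 c0n cE] : exists2 c0 : nat -> C, forall i : 'I_n.+1, c0 i != 0 &
    forall i : 'I_n.+1, Ms (n, s) 0 i = c0 i *: (Defs.eta t rt i * σ ^+ s).
  have h i : exists k : C, (i <= n)%N -> k != 0 /\ Ms (n, s) 0 i =
      k *: (wt rt n i *: (a ^+ (n - i) * b ^+ i) * σ ^+ s).
    case: (leqP i n) => [ni|_]; last by exists 0.
    have [k k0 kE] := mm_row ni; have w0 := wt_neq0 rt0 ni.
    exists (k / wt rt n i) => _; split; first by rewrite mulf_neq0 ?invr_neq0.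
    by rewrite /Ms kE [RHS]scalerAl scalerA divfK.
  exists (fun i => projT1 (cid (h i))) => i;
    by have [] := projT2 (cid (h i)) (ltn_ord i).
apply/seteqP; split=> x /= [k ->].
  exists (fun i => k i / c0 i); apply: eq_bigr => i _.
  by rewrite cE scalerA divfK.
exists (fun i => k i * c0 i); apply: eq_bigr => i _.
by rewrite cE scalerA.
Qed.

(** * Irreducible left comodules *)

Section LeftComodule.
Variables (V : vectType C) (ρ : {linear V -> tens A V}).
Hypothesis ρ_irr : irreducible_lcomodule ρ.

Let E α i j v : V := lcon (coef α i j) (ρ v).

Let El α i j : linear (E α i j).
Proof. by apply: lin_comp (lcon_linear (cl _ _ _)) _; exact: linearP. Qed.

(** Valid at all large levels, so that the expansions of two tensors can be added. *)
Lemma lcon_expansion (z : tens A V) : exists N, forall N', (N <= N')%N ->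
  z = \sum_(α <- lvl N') \sum_(i < α.1.+1) \sum_(j < α.1.+1)
        Ms α i j ⊗ lcon (coef α i j) z.
Proof.
elim/tens_ind: z => [u v|x y [N IHx] [N' IHy]|k x [N IH]].
- exists (level u) => N' uN; rewrite {1}(expE uN) tpure_suml.
  apply: eq_bigr => α _; rewrite tpure_suml; apply: eq_bigr => i _.
  rewrite tpure_suml; apply: eq_bigr => j _.
  by rewrite lconE // tpureZl tpureZr.
- exists (maxn N N') => n; rewrite geq_max => /andP[/IHx {1}-> /IHy {1}->].
  rewrite -big_split; apply: eq_bigr => α _; rewrite -big_split.
  apply: eq_bigr => i _; rewrite -big_split; apply: eq_bigr => j _.
  by rewrite (Defs.linearPD (lcon_linear (cl _ _ _))) tpureDr.
- exists N => n /IH {1}->.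
  rewrite scaler_sumr; apply: eq_bigr => α _; rewrite scaler_sumr.
  apply: eq_bigr => i _; rewrite scaler_sumr; apply: eq_bigr => j _.
  by rewrite (Defs.linearPZ (lcon_linear (cl _ _ _))) tpureZr.
Qed.

(** Coassociativity of [ρ] turns successive contractions into one contraction by a convolution
    product, given by [coef_conv]. *)
Let EM α β i j k l v : (i <= α.1)%N -> (j <= α.1)%N ->
  (k <= β.1)%N -> (l <= β.1)%N ->
  E β k l (E α i j v) = if (α == β) && (j == k) then E α i l v else 0.
Proof.
move=> ni nj nk nl; have [[assoc _] _] := ρ_irr.
have ll α' i' j' := lcon_linear (V := V) (cl α' i' j').
have Dl := Delta_linear t0; have rl : linear ρ by exact: linearP.
have il (W : lmodType C) : linear (idfun : W -> W) by [].
have := congr1 (fun z => lcon (coef β k l) (lcon (coef α i j) z)) (assoc v).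
rewrite (lcon_map _ (cl _ _ _) (il _) rl) => /esym; rewrite -/(E _ _ _ _) => ->.
pose g := if (α == β) && (j == k) then coef α i l else fun=> 0.
have gl : linear g by rewrite /g; case: ifP => // _ x y z; rewrite scaler0 addr0.
transitivity (lcon g (ρ v)); last first.
  by rewrite /E /g; case: ifP => // _; exact: lcon0.
move: (ρ v) => z.
apply: (tens_ext
  (f := fun z => lcon (coef β k l) (lcon (coef α i j)
                   (tens_assoc (tens_map (@Delta C t) idfun z))))
  (g := fun z => lcon g z)) => [||x w].
- apply: lin_comp; first exact: ll.
  apply: lin_comp; first exact: lcon_linear.
  by apply: lin_comp; [exact: tassoc_linear|exact: tmap_linear].
- exact: lcon_linear.
rewrite tmapE // lconE //.
have -> : g x = coef β k l (Lact (coef α i j) x).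
  by rewrite coef_conv // /g; case: ifP.
rewrite /Lact; move: (Delta x) => y.
have pl : linear (fun y : tens A A => y ⊗ (w : V)).
  by move=> k' y' y''; rewrite tpureDl tpureZl.
apply: (tens_ext
  (f := fun y => lcon (coef β k l) (lcon (coef α i j) (tens_assoc (y ⊗ w))))
  (g := fun y => coef β k l (lcon (coef α i j) y) *: w)) => [||u u'].
- apply: lin_comp; first exact: ll.
  apply: lin_comp; first exact: lcon_linear.
  by apply: lin_comp; [exact: tassoc_linear|exact: pl].
- by move=> k' y' y''; rewrite lcon_linear // cl scalerDl scalerA.
rewrite tens_assocE !lconE // (Defs.linearPZ (ll _ _ _)) lconE //.
by rewrite (Defs.linearPZ (cl _ _ _)) scalerA.
Qed.

Let E1 v : exists N, v = \sum_(α <- lvl N) \sum_(i < α.1.+1) E α i i v.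
Proof.
have [[_ counit] _] := ρ_irr; have [N vN] := lcon_expansion (ρ v); exists N.
have el := lcon_linear (V := V) (@eps_lin C t).
rewrite -{1}(counit v) -[tens_lift _ _]/(lcon epsA (ρ v)) {1}(vN N) // (lin_sum el).
apply: eq_bigr => α _; rewrite (lin_sum el); apply: eq_bigr => i _.
rewrite (lin_sum el) (bigD1 i) //= big1 => [|j ji].
  by rewrite lconE ?(eps_Ms t0 tr rt0 hm) -1?ltnS ?eqxx ?scale1r ?addr0 //; exact: eps_lin.
rewrite lconE ?(eps_Ms t0 tr rt0 hm) -1?ltnS //; last exact: eps_lin.
case: eqP => [ij|_]; last by rewrite scale0r.
by case/eqP: ji; exact/esym/val_inj.
Qed.

Lemma left_irreducible_iso : exists n s, lcomodule_iso ρ (VL rt n s).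
Proof.
have [_ [V0 irr]] := ρ_irr.
have rl : linear ρ by exact: linearP.
have [|α [u [Eu Xb]]] := irreducible_matrix_units El EM E1 V0.
  (* A subspace stable under the matrix units is a subcomodule: expand [ρ w] along the matrix
     elements. *)
  move=> W stable; apply: irr => w wW; have [N wN] := lcon_expansion (ρ w).
  rewrite (wN N) //; do 3![apply: tsub_sum => ?].
  by apply: tsub_pure => //=; apply: stable => //; rewrite -ltnS.
have yfree : forall k : 'I_α.1.+1 -> C, \sum_i k i *: Ms α i 0 = 0 -> forall i, k i = 0.
  move=> k k0 i; have := congr1 (coef α i 0) k0.
  rewrite (lin0 (cl _ _ _)) (lin_sum (cl _ _ _)).
  rewrite (bigD1 i) //= big1 => [|j ji].
    rewrite (Defs.linearPZ (cl _ _ _)) coef_Ms -1?ltnS // !eqxx addr0 => <-.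
    by rewrite [RHS]mulr1.
  rewrite (Defs.linearPZ (cl _ _ _)) coef_Ms -1?ltnS //.
  case: (i =P j :> nat) => [ij|_]; last by rewrite /= andbF scaler0.
  by case/eqP: ji; exact/esym/val_inj.
have [f [finj frange fu]] := @basis_map _ _ _ u Xb _ (fun i => Ms α i 0) yfree.
exists α.1, α.2, f; split=> //; first by rewrite frange VL_span; case: (α).
have fl : linear f by exact: linearP.
have il : linear (idfun : A -> A) by [].
have Df := lin_comp (Delta_linear t0) fl.
(* Since [ρ (u i)] is the sum of the [m_il ⊗ u l], both maps send [u i] to the sum of the
   [m_il ⊗ m_l0], up to the common [σ^s]. *)
apply: (basis_ext (u := u) Xb Df (lin_comp (tmap_linear il fl) rl)) => i.
have ni : (i <= α.1)%N by rewrite -ltnS.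
rewrite fu (Delta_Ms t0 tr rt0 hm) //.
have [N uN] := lcon_expansion (ρ (u i)).
rewrite (uN _ (leq_maxr α.1 N)) (bigD1_seq α) ?lvl_uniq ?mem_lvl ?leq_maxl //=.
rewrite [X in _ + X]big1 => [|β ba]; last first.
  rewrite big1 // => k _; rewrite big1 // => l _.
  by rewrite -[lcon _ _]/(E _ _ _ _) Eu -1?ltnS // (negPf ba) tpure0r.
rewrite addr0 [in RHS](bigD1 i) //= [X in _ + X]big1 => [|k ki]; last first.
  rewrite big1 // => l _; rewrite -[lcon _ _]/(E _ _ _ _) Eu -1?ltnS //.
  rewrite eqxx /=; case: eqP => [e|_]; last by rewrite tpure0r.
  by case/eqP: ki; exact: val_inj.
rewrite addr0 (lin_sum (tmap_linear il fl)); apply: eq_bigr => l _.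
by rewrite -[lcon _ _]/(E _ _ _ _) Eu -1?ltnS // !eqxx tmapE // fu.
Qed.

End LeftComodule.

(** * Irreducible right comodules *)

Section RightComodule.
Variables (V : vectType C) (ρ : {linear V -> tens V A}).
Hypothesis ρ_irr : irreducible_rcomodule ρ.

(** The indices of [coef] are transposed: contracting right legs reverses the order of the
    convolution product, and the transposition restores the composition rule of the left case. *)
Let E α i j v : V := rcon (coef α j i) (ρ v).

Let El α i j : linear (E α i j).
Proof. by apply: lin_comp (rcon_linear (cl _ _ _)) _; exact: linearP. Qed.

Lemma rcon_expansion (z : tens V A) : exists N, forall N', (N <= N')%N ->
  z = \sum_(α <- lvl N') \sum_(i < α.1.+1) \sum_(j < α.1.+1)
        rcon (coef α i j) z ⊗ Ms α i j.
Proof.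
elim/tens_ind: z => [v u|x y [N IHx] [N' IHy]|k x [N IH]].
- exists (level u) => N' uN; rewrite {1}(expE uN) tpure_sumr.
  apply: eq_bigr => α _; rewrite tpure_sumr; apply: eq_bigr => i _.
  rewrite tpure_sumr; apply: eq_bigr => j _.
  by rewrite rconE // tpureZl tpureZr.
- exists (maxn N N') => n; rewrite geq_max => /andP[/IHx {1}-> /IHy {1}->].
  rewrite -big_split; apply: eq_bigr => α _; rewrite -big_split.
  apply: eq_bigr => i _; rewrite -big_split; apply: eq_bigr => j _.
  by rewrite (Defs.linearPD (rcon_linear (cl _ _ _))) tpureDl.
- exists N => n /IH {1}->.
  rewrite scaler_sumr; apply: eq_bigr => α _; rewrite scaler_sumr.
  apply: eq_bigr => i _; rewrite scaler_sumr; apply: eq_bigr => j _.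
  by rewrite (Defs.linearPZ (rcon_linear (cl _ _ _))) tpureZl.
Qed.

Let EM α β i j k l v : (i <= α.1)%N -> (j <= α.1)%N ->
  (k <= β.1)%N -> (l <= β.1)%N ->
  E β k l (E α i j v) = if (α == β) && (j == k) then E α i l v else 0.
Proof.
move=> ni nj nk nl; have [[assoc _] _] := ρ_irr.
have ll (W : lmodType C) α' i' j' := rcon_linear (V := W) (cl α' i' j').
have Dl := Delta_linear t0; have rl : linear ρ by exact: linearP.
have il (W : lmodType C) : linear (idfun : W -> W) by [].
(* In [(ρ ⊗ id) ρ] the last leg comes from the coaction applied first, so it is the one contracted
   with [coef α j i]. *)
pose φ (y : tens A A) : C^o := coef β l k (rcon (coef α j i) y).
have φl : linear φ by exact: lin_comp (cl _ _ _) (ll _ _ _ _).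
have φE (y : tens V A) x :
    rcon φ (tens_assoc (y ⊗ x)) = coef α j i x *: rcon (coef β l k) y.
  apply: (tens_ext (f := fun y => rcon φ (tens_assoc (y ⊗ x)))
    (g := fun y => coef α j i x *: rcon (coef β l k) y)) => [||w u].
  - apply: lin_comp; first exact: rcon_linear.
    apply: lin_comp; first exact: tassoc_linear.
    by move=> k' y' y''; rewrite tpureDl tpureZl.
  - by move=> k' y' y''; rewrite ll scalerDr !scalerA mulrC.
  by rewrite tens_assocE !rconE // /φ rconE // (Defs.linearPZ (cl _ _ _)) scalerA.
have := congr1 (rcon φ) (assoc v).
rewrite (rcon_map _ φl Dl (il _)) => ρE.
transitivity (rcon φ (tens_assoc (tens_map ρ idfun (ρ v)))).
  rewrite /E; move: (ρ v) => z.
  apply: (tens_ext (f := fun z => rcon (coef β l k) (ρ (rcon (coef α j i) z)))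
    (g := fun z => rcon φ (tens_assoc (tens_map ρ idfun z)))) => [||w x].
  - apply: lin_comp; first exact: ll.
    by apply: lin_comp; [exact: rl|exact: ll].
  - apply: lin_comp; first exact: rcon_linear.
    by apply: lin_comp; [exact: tassoc_linear|exact: tmap_linear].
  by rewrite tmapE // φE rconE // (Defs.linearPZ rl) (Defs.linearPZ (ll _ _ _ _)).
rewrite {}ρE; pose g := if (α == β) && (j == k) then coef α l i else fun=> 0.
transitivity (rcon g (ρ v)); last first.
  by rewrite /E /g; case: ifP => // _; exact: rcon0.
congr (rcon _ _); apply: funext => x.
rewrite /φ -con_swap // -[lcon _ _]/(Lact _ x) coef_conv // /g.
by rewrite eq_sym [k == j]eq_sym; case: ifP => // /andP[/eqP -> _].
Qed.

Let E1 v : exists N, v = \sum_(α <- lvl N) \sum_(i < α.1.+1) E α i i v.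
Proof.
have [[_ counit] _] := ρ_irr; have [N vN] := rcon_expansion (ρ v); exists N.
have el := rcon_linear (V := V) (@eps_lin C t).
rewrite -{1}(counit v) -[tens_lift _ _]/(rcon epsA (ρ v)) {1}(vN N) // (lin_sum el).
apply: eq_bigr => α _; rewrite (lin_sum el); apply: eq_bigr => i _.
rewrite (lin_sum el) (bigD1 i) //= big1 => [|j ji].
  by rewrite rconE ?(eps_Ms t0 tr rt0 hm) -1?ltnS ?eqxx ?scale1r ?addr0 //; exact: eps_lin.
rewrite rconE ?(eps_Ms t0 tr rt0 hm) -1?ltnS //; last exact: eps_lin.
case: eqP => [ij|_]; last by rewrite scale0r.
by case/eqP: ji; exact/esym/val_inj.
Qed.

Lemma right_irreducible_iso : exists n s, rcomodule_iso ρ (VR rt n s).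
Proof.
have [_ [V0 irr]] := ρ_irr.
have rl : linear ρ by exact: linearP.
have [|α [u [Eu Xb]]] := irreducible_matrix_units El EM E1 V0.
  move=> W stable; apply: irr => w wW; have [N wN] := rcon_expansion (ρ w).
  rewrite (wN N) //; do 3![apply: tsub_sum => ?].
  by apply: tsub_pure => //=; apply: stable => //; rewrite -ltnS.
have yfree : forall k : 'I_α.1.+1 -> C, \sum_i k i *: Ms α 0 i = 0 -> forall i, k i = 0.
  move=> k k0 i; have := congr1 (coef α 0 i) k0.
  rewrite (lin0 (cl _ _ _)) (lin_sum (cl _ _ _)).
  rewrite (bigD1 i) //= big1 => [|j ji].
    rewrite (Defs.linearPZ (cl _ _ _)) coef_Ms -1?ltnS // !eqxx addr0 => <-.
    by rewrite [RHS]mulr1.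
  rewrite (Defs.linearPZ (cl _ _ _)) coef_Ms -1?ltnS //.
  case: (i =P j :> nat) => [ij|_]; last by rewrite /= !andbF scaler0.
  by case/eqP: ji; exact/esym/val_inj.
have [f [finj frange fu]] := @basis_map _ _ _ u Xb _ (fun i => Ms α 0 i) yfree.
exists α.1, α.2, f; split=> //; first by rewrite frange VR_span; case: (α).
have fl : linear f by exact: linearP.
have il : linear (idfun : A -> A) by [].
have Df := lin_comp (Delta_linear t0) fl.
(* Here [ρ (u i)] is the sum of the [u l ⊗ m_li], matching Δ on row 0. *)
apply: (basis_ext (u := u) Xb Df (lin_comp (tmap_linear fl il) rl)) => i.
have ni : (i <= α.1)%N by rewrite -ltnS.
rewrite fu (Delta_Ms t0 tr rt0 hm) //.
have [N uN] := rcon_expansion (ρ (u i)).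
rewrite (uN _ (leq_maxr α.1 N)) (bigD1_seq α) ?lvl_uniq ?mem_lvl ?leq_maxl //=.
rewrite [X in _ + X]big1 => [|β ba]; last first.
  rewrite big1 // => k _; rewrite big1 // => l _.
  by rewrite -[rcon _ _]/(E _ _ _ _) Eu -1?ltnS // (negPf ba) tpure0l.
rewrite addr0 (lin_sum (tmap_linear fl il)); apply: eq_bigr => l _.
rewrite (bigD1 i) //= [X in _ + X]big1 => [|k ki]; last first.
  rewrite -[rcon _ _]/(E _ _ _ _) Eu -1?ltnS //.
  rewrite eqxx /=; case: eqP => [e|_]; last by rewrite tpure0l.
  by case/eqP: ki; exact: val_inj.
by rewrite addr0 -[rcon _ _]/(E _ _ _ _) Eu -1?ltnS // !eqxx tmapE // fu.
Qed.

End RightComodule.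

End Comodules.

Theorem theorem5p1 (R : realType) (q sqrtq t : R[i])
    (hq0 : q != 0) (hq : forall n : nat, (0 < n)%N -> q ^+ n != 1)
    (hsqrtq : sqrtq ^+ 2 = q) (ht : t = 'i * sqrtq)
    (rt : nat -> nat -> R[i])
    (hrt : forall n k : nat, (k <= n)%N -> rt n k ^+ 2 = qbin (t ^- 2) n k)
    (m : forall n : nat, 'I_n.+1 -> 'I_n.+1 -> Asig t)
    (hm : matrix_elements rt m) :
  (forall (V : vectType (R[i] : numClosedFieldType)) (ρ : {linear V -> tens (Asig t) V}),
     irreducible_lcomodule ρ ->
     exists (n : nat) (s : bool), lcomodule_iso ρ (VL rt n s)) /\
  (forall (V : vectType (R[i] : numClosedFieldType)) (ρ : {linear V -> tens V (Asig t)}),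
     irreducible_rcomodule ρ ->
     exists (n : nat) (s : bool), rcomodule_iso ρ (VR rt n s)) /\
  (forall (n : nat) (s : bool), is_subbicomodule (Mspan m n s)) /\
  is_direct_sum (fun ns : nat * bool => Mspan m ns.1 ns.2).
Proof.
have tq : t ^+ 2 = - q by rewrite ht exprMn sqrCi hsqrtq mulN1r.
have t0 : t != 0 by have := expf_eq0 t 2; rewrite tq oppr_eq0 (negPf hq0) /= => <-.
have tr n : (0 < n)%N -> (t ^+ 2) ^+ n != 1.
  (* If [(-q)^n = 1] then [q^(2n) = 1]. *)
  move=> n0; rewrite tq; apply/eqP => h.
  have := hq (2 * n)%N; rewrite muln_gt0 n0 => /(_ isT) /eqP; apply.
  by rewrite exprM -sqrrN exprAC h expr1n.
have vr k : (0 < k)%N -> t ^- 2 ^+ k != 1 by move=> k0; rewrite exprVn invr_eq1 tr.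
have rt0 n k : (k <= n)%N -> rt n k != 0.
  move=> kn; have := expf_eq0 (rt n k) 2; rewrite andTb => <-; rewrite hrt //.
  by rewrite mulf_neq0 ?invr_neq0 ?mulf_neq0 //; exact: qpoch_neq0.
split; first by move=> V ρ; exact: (left_irreducible_iso t0 tr rt0 hm).
split; first by move=> V ρ; exact: (right_irreducible_iso t0 tr rt0 hm).
split; last exact: (Mspan_direct_sum t0 tr rt0 hm).
by move=> n s; exact: (Mspan_subbicomodule t0 tr rt0 hm).
Qed.
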